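(* There is an $\mathrm{FO}(\subseteq)$-formula $\varphi$ with a $\forall\exists$-quantifier prefix for which the parameterized problem $\text{p-}\mathrm{WT}_\varphi$ is $\mathrm{W}[2]$-complete under fpt-reductions.
   Context: Team semantics: for a structure $\mathcal{A}$ with domain $A$, a team with domain $X$ is a set of assignments $s\colon X\to A$. $\mathrm{FO}(\subseteq)$ extends first-order logic (in negation normal form) by inclusion atoms $\mathbf t\subseteq\mathbf u$, with $\mathcal{A},T\models\mathbf t\subseteq\mathbf u$ iff for every $s_1\in T$ there is $s_2\in T$ with $\mathbf t\langle s_1\rangle=\mathbf u\langle s_2\rangle$. First-order literals hold in $T$ iff they hold under every $s\in T$; $\wedge$ is evaluated in the same team; $\mathcal{A},T\models\varphi_0\vee\varphi_1$ iff $T=T_0\cup T_1$ with $\mathcal{A},T_i\models\varphi_i$; $\mathcal{A},T\models\exists x\varphi$ iff $\mathcal{A},\{s[x\mapsto a]:s\in T,a\in f(s)\}\models\varphi$ for some $f\colon T\to\mathcal P(A)\setminus\{\emptyset\}$; $\mathcal{A},T\models\forall x\varphi$ iff $\mathcal{A},\{s[x\mapsto a]:s\in T,a\in A\}\models\varphi$. For a fixed formula $\varphi$, $\text{p-}\mathrm{WT}_\varphi$: given a finite structure $\mathcal{A}$ and $k\in\mathbb N$ (parameter $k$), is there a team $T$ with domain the set of free variables of $\varphi$ with $|T|=k$ and $\mathcal{A},T\models\varphi$? For a first-order $\psi(S)$ with free relation variable $S$, $\text{p-}\mathrm{WD}_\psi$ asks, given $\mathcal{A}$ and parameter $k$, whether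 some $S$ with $|S|=k$ satisfies $\mathcal{A}\models\psi(S)$. $\Pi_t$: prenex first-order formulas with $t$ alternating quantifier blocks, starting with a universal block. $\mathrm{W}[t]$ is the closure under fpt-reductions of $\{\text{p-}\mathrm{WD}_\psi:\psi\in\Pi_t\}$. *)

(* Defs.v *)
From HB Require Import structures.
From mathcomp Require Import all_boot.
From mathcomp Require Import finmap.

Set Implicit Arguments.
Unset Strict Implicit.
Unset Printing Implicit Defensive.

Local Open Scope fset_scope.
Local Open Scope fmap_scope.

(** * Vocabularies, finite structures and terms *)

(* Constants are function symbols of arity 0. *)
Record vocab := Vocab {
  rel_sym : finType;
  rel_ar : rel_sym -> nat;
  fun_sym : finType;
  fun_ar : fun_sym -> nat }.

(* Finite structures are nonempty; as problem instances they are presented on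
   an initial segment {0, ..., n} of the natural numbers. *)
Record structure (V : vocab) (n : nat) := Structure {
  rel_int : forall R : rel_sym V, (rel_ar R).-tuple 'I_n.+1 -> bool;
  fun_int : forall F : fun_sym V, (fun_ar F).-tuple 'I_n.+1 -> 'I_n.+1 }.

Inductive term (V : vocab) :=
| Var of nat
| App (F : fun_sym V) of ('I_(fun_ar F) -> term V).

Inductive atom (V : vocab) :=
| Eq of term V & term V
| Rel (R : rel_sym V) of ('I_(rel_ar R) -> term V).

Arguments Var {V}.

Fixpoint term_fv V (t : term V) : {fset nat} :=
  match t with
  | Var x => [fset x]
  | App _ ts => \big[fsetU/fset0]_i term_fv (ts i)
  end.

Definition atom_fv V (a : atom V) : {fset nat} :=
  match a with
  | Eq t u => term_fv t `|` term_fv u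
  | Rel _ ts => \big[fsetU/fset0]_i term_fv (ts i)
  end.

Fixpoint term_eval V n (A : structure V n) (e : nat -> 'I_n.+1) (t : term V) :
    'I_n.+1 :=
  match t with
  | Var x => e x
  | App _ ts => fun_int A [tuple term_eval A e (ts i) | i < _]
  end.

Definition atom_eval V n (A : structure V n) (e : nat -> 'I_n.+1) (a : atom V) :
    bool :=
  match a with
  | Eq t u => term_eval A e t == term_eval A e u
  | Rel _ ts => rel_int A [tuple term_eval A e (ts i) | i < _]
  end.

(** * First-order logic *)

Inductive fo (V : vocab) :=
| FAtom of atom V
| FNot of fo V
| FAnd of fo V & fo V
| FOr of fo V & fo V
| FEx of nat & fo V
| FAll of nat & fo V.

Fixpoint fo_fv V (psi : fo V) : {fset nat} :=
  match psi with
  | FAtom a => atom_fv a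
  | FNot p => fo_fv p
  | FAnd p q | FOr p q => fo_fv p `|` fo_fv q
  | FEx x p | FAll x p => fo_fv p `\ x
  end.

Definition upd (T : Type) (e : nat -> T) (x : nat) (a : T) : nat -> T :=
  fun y => if y == x then a else e y.

Fixpoint fo_sat V n (A : structure V n) (e : nat -> 'I_n.+1) (psi : fo V) :
    Prop :=
  match psi with
  | FAtom a => atom_eval A e a
  | FNot p => ~ fo_sat A e p
  | FAnd p q => fo_sat A e p /\ fo_sat A e q
  | FOr p q => fo_sat A e p \/ fo_sat A e q
  | FEx x p => exists a, fo_sat A (upd e x a) p
  | FAll x p => forall a, fo_sat A (upd e x a) p
  end.

Fixpoint fo_qf V (psi : fo V) : bool :=
  match psi with
  | FAtom _ => true
  | FNot p => fo_qf p
  | FAnd p q | FOr p q => fo_qf p && fo_qf q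
  | FEx _ _ | FAll _ _ => false
  end.

(* [prenex univ t psi]: a quantifier-free matrix behind exactly [t] nonempty
   alternating blocks, the outermost one universal iff [univ]. *)
Inductive prenex V : bool -> nat -> fo V -> Prop :=
| prenex_qf univ psi of fo_qf psi : prenex univ 0 psi
| prenex_new univ t x psi of prenex (~~ univ) t psi :
    prenex univ t.+1 (if univ then FAll x psi else FEx x psi)
| prenex_ext univ t x psi of prenex univ t.+1 psi :
    prenex univ t.+1 (if univ then FAll x psi else FEx x psi).

Definition Pi_class V (t : nat) (psi : fo V) : Prop := prenex true t psi.

(* A formula psi(S) over V with a free r-ary relation variable S is a formula
   over V with one additional r-ary relation symbol, [None]. *)
Definition vocab_ext (V : vocab) (r : nat) : vocab :=
  @Vocab (option (rel_sym V)) (fun R => if R is Some R' then rel_ar R' else r)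
         (fun_sym V) (@fun_ar V).

Definition expand V r n (A : structure V n) (S : {set r.-tuple 'I_n.+1}) :
    structure (vocab_ext V r) n :=
  @Structure (vocab_ext V r) n
    (fun R : option (rel_sym V) =>
       match R return
         (rel_ar (R : rel_sym (vocab_ext V r))).-tuple 'I_n.+1 -> bool
       with
       | Some R' => @rel_int V n A R'
       | None => fun v => v \in S
       end)
    (@fun_int V n A).

(** * Team semantics of FO(⊆) *)

Inductive teamfo (V : vocab) :=
| TLit of bool & atom V    (* the atom, or its negation for [false] *)
| TIncl m of ('I_m -> term V) & ('I_m -> term V)
| TAnd of teamfo V & teamfo V
| TOr of teamfo V & teamfo V
| TEx of nat & teamfo V
| TAll of nat & teamfo V.

Fixpoint team_fv V (phi : teamfo V) : {fset nat} :=
  match phi with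
  | TLit _ a => atom_fv a
  | TIncl _ ts us => \big[fsetU/fset0]_i (term_fv (ts i) `|` term_fv (us i))
  | TAnd p q | TOr p q => team_fv p `|` team_fv q
  | TEx x p | TAll x p => team_fv p `\ x
  end.

Fixpoint team_qf V (phi : teamfo V) : bool :=
  match phi with
  | TLit _ _ | TIncl _ _ _ => true
  | TAnd p q | TOr p q => team_qf p && team_qf q
  | TEx _ _ | TAll _ _ => false
  end.

(* Assignments have an explicit finite domain of variables [domf s]. *)
Definition assignment (n : nat) := {fmap nat -> 'I_n.+1}.

(* The default value is irrelevant: formulas are only evaluated in teams whose
   domain contains their free variables. *)
Definition env n (s : assignment n) : nat -> 'I_n.+1 :=
  fun x => odflt ord0 s.[? x].

Fixpoint team_sat V n (A : structure V n) (T : {fset assignment n})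
    (phi : teamfo V) : Prop :=
  match phi with
  | TLit b a => forall s, s \in T -> atom_eval A (env s) a = b
  | TIncl _ ts us =>
      forall s1, s1 \in T -> exists s2, s2 \in T /\
        forall i, term_eval A (env s1) (ts i) = term_eval A (env s2) (us i)
  | TAnd p q => team_sat A T p /\ team_sat A T q
  | TOr p q => exists T0 T1 : {fset assignment n},
      [/\ T = T0 `|` T1, team_sat A T0 p & team_sat A T1 q]
  | TEx x p => exists f : assignment n -> {set 'I_n.+1},
      (forall s, s \in T -> f s != set0) /\
      team_sat A [fset s.[x <- a] | s in T, a in f s] p
  | TAll x p =>
      team_sat A [fset s.[x <- a] | s in T, a in [set: 'I_n.+1]] p
  end.

(** * Multi-tape Turing machines *)

(* Tape alphabet {0, 1, blank}, blank being [None]. *)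
Definition cell := option bool.

(* A two-way infinite tape (l, r): [r] is read from the head to the right, [l]
   from the cell left of the head to the left; all other cells are blank. *)
Definition tape := (seq cell * seq cell)%type.

Inductive move := MoveL | MoveR | Stay.

Definition tape_read (tp : tape) : cell := head None tp.2.

Definition tape_write (c : cell) (tp : tape) : tape := (tp.1, c :: behead tp.2).

Definition tape_move (m : move) (tp : tape) : tape :=
  match m with
  | MoveL => (behead tp.1, head None tp.1 :: tp.2)
  | MoveR => (head None tp.2 :: tp.1, behead tp.2)
  | Stay => tp
  end.

Record TM := MkTM {
  tapes : nat;   (* the machine has tapes.+1 tapes *)
  state : finType;
  start : state;
  halting : pred state;
  delta : state -> ('I_tapes.+1 -> cell) ->
          state * ('I_tapes.+1 -> cell * move) }.

Definition config (M : TM) := (state M * ('I_(tapes M).+1 -> tape))%type.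

Definition step (M : TM) (c : config M) : config M :=
  if halting c.1 then c else
  let: (q, act) := delta c.1 (fun i => tape_read (c.2 i)) in
  (q, fun i => tape_move (act i).2 (tape_write (act i).1 (c.2 i))).

(* The input stands on the first tape, with the head on its first symbol. *)
Definition init (M : TM) (x : seq bool) : config M :=
  (start M, fun i => if i == ord0 then ([::], map Some x) else ([::], [::])).

Fixpoint bit_prefix (r : seq cell) : seq bool :=
  if r is Some b :: r' then b :: bit_prefix r' else [::].

(* The output is read on the last tape, from the head up to the first blank. *)
Definition output (M : TM) (c : config M) : seq bool := bit_prefix (c.2 ord_max).2.

Definition computes_within (M : TM) (x : seq bool) (t : nat) (y : seq bool) :
    Prop :=
  let c := iter t (@step M) (init M x) in halting c.1 /\ output c = y.

(** * Computable functions *)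

(* The total mu-recursive functions. *)
Inductive recursive : forall n, (n.-tuple nat -> nat) -> Prop :=
| rec_zero n : recursive (fun _ : n.-tuple nat => 0)
| rec_succ : recursive (fun v : 1.-tuple nat => (thead v).+1)
| rec_proj n (i : 'I_n) : recursive (fun v : n.-tuple nat => tnth v i)
| rec_comp n m (f : m.-tuple nat -> nat) (g : 'I_m -> n.-tuple nat -> nat) of
    recursive f & (forall i, recursive (g i)) :
    recursive (fun v : n.-tuple nat => f [tuple g i v | i < m])
| rec_prec n (f : n.-tuple nat -> nat) (g : n.+2.-tuple nat -> nat) of
    recursive f & recursive g :
    recursive (fun v : n.+1.-tuple nat =>
      iteri (thead v) (fun i acc => g [tuple of i :: acc :: behead v])
            (f [tuple of behead v]))
| rec_min n (f : n.+1.-tuple nat -> nat) (g : n.-tuple nat -> nat) of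
    recursive f &
    (forall v, f [tuple of g v :: v] = 0 /\
               forall m, m < g v -> f [tuple of m :: v] <> 0) :
    recursive g
| rec_eq n (f g : n.-tuple nat -> nat) of recursive f & f =1 g : recursive g.

Definition computable (f : nat -> nat) : Prop :=
  recursive (fun v : 1.-tuple nat => f (thead v)).

(** * Parameterized problems and fpt-reductions *)

(* A set of pairs (x, k) of a word x and a parameter k. *)
Definition pproblem := seq bool -> nat -> Prop.

(* The parameter is written in unary in front of the word. *)
Definition instance (x : seq bool) (k : nat) : seq bool :=
  nseq k true ++ false :: x.

Definition fpt_reducible (P Q : pproblem) : Prop :=
  exists (red : seq bool -> nat -> seq bool) (par : seq bool -> nat -> nat)
         (M : TM) (f g : nat -> nat) (c : nat),
    [/\ computable f,
        computable g,
        forall x k, P x k <-> Q (red x k) (par x k),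
        forall x k, par x k <= g k
      & forall x k, computes_within M (instance x k)
          (f k * size (instance x k) ^ c) (instance (red x k) (par x k))].

(** * Encoding of structures by words *)

(* All tuples, in lexicographic order. *)
Fixpoint all_tuples n (m : nat) : seq (m.-tuple 'I_n.+1) :=
  if m is m'.+1
  then [seq cons_tuple a v | a <- enum 'I_n.+1, v <- all_tuples n m']
  else [:: [tuple]].

(* The size of the universe in unary, followed by the characteristic words of
   the relations and of the graphs of the functions. *)
Definition encode V n (A : structure V n) : seq bool :=
  nseq n.+1 true ++ false ::
  flatten [seq [seq rel_int A v | v <- all_tuples n (rel_ar R)]
          | R <- enum (rel_sym V)] ++
  flatten [seq [seq fun_int A v == a | v <- all_tuples n (fun_ar F),
                                       a <- enum 'I_n.+1]
          | F <- enum (fun_sym V)].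

(** * Weighted definability, weighted team definability and the W-hierarchy *)

Definition pWT V (phi : teamfo V) : pproblem := fun x k =>
  exists n (A : structure V n), x = encode A /\
  exists T : {fset assignment n},
    [/\ forall s, s \in T -> domf s = team_fv phi,
        #|` T| = k
      & team_sat A T phi].

(* Only used for sentences psi, so that the choice of the environment is
   irrelevant. *)
Definition pWD V r (psi : fo (vocab_ext V r)) : pproblem := fun x k =>
  exists n (A : structure V n), x = encode A /\
  exists S : {set r.-tuple 'I_n.+1},
    #|S| = k /\ fo_sat (expand A S) (fun _ => ord0) psi.

Definition W (t : nat) (P : pproblem) : Prop :=
  exists V r (psi : fo (vocab_ext V r)),
    [/\ fo_fv psi = fset0, Pi_class t psi & fpt_reducible P (pWD psi)].

Definition W_complete (t : nat) (P : pproblem) : Prop :=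
  W t P /\ forall Q : pproblem, W t Q -> fpt_reducible Q P.

(* Main.v *)
(* Let phi be forall y exists z (z ⊆ x /\ E(y,z)), over one binary relation E.
   A nonempty team satisfies phi iff the set of its x-values contains, for every
   vertex y, some z with E(y,z): pWT phi asks for a hitting set of exact size k
   (or the empty team if k = 0).  This is a Pi_2 property of the set, whence
   membership in W[2], by the identity reduction.

   Hardness.  Let psi = forall xs exists ys chi with d - 1 atoms S(t), let N be
   the number of r-tuples of A, numbered from 1 to N.  A set S of size k is a
   strictly increasing sequence 0 = s_0 < s_1 < ... < s_k < s_(k+1) = N + 1.
   That a tuple c is in S is certified by one index, s_i = c, and that it is not
   in S by two, s_i < c < s_(i+1): every instance of chi is certified by 2d
   pairs (i, s_i).  The elements of the new universe stand for 2d such pairs; the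
   elements with the same indices form a block, and there are (k+2)^(2d) blocks.
   Clauses "some element of the block is chosen" together with the exact size
   (k+2)^(2d) force exactly one element per block.  Negative information can then
   be expressed positively, so that clauses also express that all blocks agree on
   one sequence s; the remaining clauses express, for each value of xs, that some
   chosen element certifies chi for some value of ys.

   The incidence of clauses and elements is an arithmetic formula with quantifiers
   bounded by polynomials, and with access to the bits of the input; a Turing
   machine evaluates it by brute force, storing numbers in unary. *)
Require Import Defs.
From mathcomp Require Import all_boot zify.
From mathcomp Require Import finmap.
From Stdlib Require Import FunctionalExtensionality.

Set Implicit Arguments.
Unset Strict Implicit.
Unset Printing Implicit Defensive.

(** Exactness comes from counting alone: the block clauses make the chosen elements project onto all
    index vectors, and as there are no more elements than vectors, the projection is injective. Then
    saying that the chosen element of a block lacks the value v amounts to saying that some chosen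
    element of that block has another value, so the implication from value v here to value v in the
    constant block becomes a clause. The order of s costs no clause: an element is admissible only
    if its first two pairs are correctly ordered, and any two indices meet in these places of some
    block. This needs at least two pairs per element, hence the extra certificate in d. Every number
    below the universe size is both a clause and an element. A meaningless clause is hit by all
    admissible elements, while an inadmissible element hits nothing. A word that encodes no
    structure yields a graph without edges, and the empty team does not help there because the new
    parameter is positive. A problem in W[2] is given only through some reducing machine, so the
    machine built here simulates that one and then works on its output; this is why compiled
    programs share their tapes with an arbitrary machine. *)

Definition keep (c : cell) : cell * move := (c, Stay).

Definition act_tape (a : cell * move) (tp : tape) : tape :=
  tape_move a.2 (tape_write a.1 tp).

(** * Structured machine fragments *)

Section Fragments.
Variable I : Type.

(** Tapes are addressed by an arbitrary index type, so that fragments sharing tapes compose without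
    renumbering; numbers are assigned only when a [TM] is formed. *)
Record frag := Frag {
  fstate : finType;
  fstart : fstate;
  fhalt : pred fstate;
  fdelta : fstate -> (I -> cell) -> fstate * (I -> cell * move) }.

Definition fstep (F : frag) (c : fstate F * (I -> tape)) : fstate F * (I -> tape) :=
  if fhalt c.1 then c else
  let: (q, act) := fdelta c.1 (fun i => tape_read (c.2 i)) in
  (q, fun i => act_tape (act i) (c.2 i)).

Definition runs (F : frag) (T : I -> tape) (n : nat) (T' : I -> tape) : Prop :=
  exists q, iter n (@fstep F) (fstart F, T) = (q, T') /\ fhalt q.

Definition hoare (F : frag) (P : (I -> tape) -> Prop) (t : nat)
    (Q : (I -> tape) -> Prop) : Prop :=
  forall T, P T -> exists n T', [/\ n <= t, runs F T n T' & Q T'].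

Lemma hoare_weaken F (P P' Q Q' : (I -> tape) -> Prop) t t' :
  (forall T, P' T -> P T) -> (forall T, Q T -> Q' T) -> t <= t' ->
  hoare F P t Q -> hoare F P' t' Q'.
Proof.
move=> hP hQ ht h T /hP /h [n [T' [hn hr hq]]].
by exists n, T'; split=> //; [exact: leq_trans ht | exact: hQ].
Qed.

Lemma hoare_le F (P Q : (I -> tape) -> Prop) t t' :
  hoare F P t Q -> t <= t' -> hoare F P t' Q.
Proof. by move=> h ht; apply: hoare_weaken h. Qed.

Lemma iter_fstep_halt (F : frag) n (c : fstate F * (I -> tape)) :
  fhalt c.1 -> iter n (@fstep F) c = c.
Proof. by move=> hc; elim: n => //= n ->; rewrite /fstep hc. Qed.

Definition fskip : frag := @Frag unit tt xpredT (fun _ rd => (tt, fun i => keep (rd i))).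

Lemma hoare_skip (P : (I -> tape) -> Prop) : hoare fskip P 0 P.
Proof. by move=> T hT; exists 0, T; split=> //; exists tt. Qed.

Definition prim (i0 : I) (f : cell -> I -> cell -> cell * move) : frag :=
  @Frag bool false id (fun _ rd => (true, fun i => f (rd i0) i (rd i))).

Lemma hoare_prim i0 f (P Q : (I -> tape) -> Prop) :
  (forall T, P T -> Q (fun i =>
     act_tape (f (tape_read (T i0)) i (tape_read (T i))) (T i))) ->
  hoare (prim i0 f) P 1 Q.
Proof. by move=> h T /h hT; do 2 eexists; split; [exact: leqnn | exists true | exact: hT]. Qed.

Definition fseq (F G : frag) : frag :=
  @Frag (fstate F + fstate G)%type (inl (fstart F))
    (fun q => if q is inr q' then fhalt q' else false)
    (fun q rd => match q with
     | inl q => if fhalt q then (inr (fstart G), fun i => keep (rd i))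
                else let: (q', act) := fdelta q rd in (inl q', act)
     | inr q => let: (q', act) := fdelta q rd in (inr q', act)
     end).

(* Between two fragments the machine spends a step that writes each scanned cell
   back; this may append explicit blanks to the lists representing a tape. *)
Definition rewr (T : I -> tape) : I -> tape :=
  fun i => act_tape (keep (tape_read (T i))) (T i).

(** [runs] may count idle steps after halting, whereas the sequence leaves [F] at its first halting
    state; hence the possibly smaller [m]. *)
Lemma fseq_left (F G : frag) n T q T' :
  iter n (@fstep F) (fstart F, T) = (q, T') -> fhalt q ->
  exists2 m, m <= n & exists2 q', iter m (@fstep F) (fstart F, T) = (q', T') /\ fhalt q' &
    iter m (@fstep (fseq F G)) (inl (fstart F), T) = (inl q', T').
Proof.
move: (fstart F) => q0; elim: n q0 T => [|n IHn] q0 T.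
  by case=> -> -> hq; exists 0 => //; exists q.
case hq0: (fhalt q0).
  rewrite (@iter_fstep_halt F n.+1 (q0, T)) // => -[<- <-] _.
  by exists 0 => //; exists q0.
rewrite iterSr {2}/fstep /= hq0; case E: fdelta => [q1 act] /IHn IH hq.
have [m hm [q' [h1 h2] h3]] := IH hq; exists m.+1 => //; exists q' => //.
  by split=> //; rewrite iterSr {2}/fstep /= hq0 E.
by rewrite iterSr {2}/fstep /= hq0 E.
Qed.

Lemma fseq_right (F G : frag) n q T :
  iter n (@fstep (fseq F G)) (inr q, T) =
  let: (q', T') := iter n (@fstep G) (q, T) in (inr q', T').
Proof.
elim: n => //= n ->; case: (iter n (@fstep G) (q, T)) => q' T' /=; rewrite /fstep /=.
by case: ifP => // _; case: fdelta.
Qed.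

Lemma hoare_fseq F G (P Q S : (I -> tape) -> Prop) t1 t2 :
  hoare F P t1 Q -> (forall T, Q T -> Q (rewr T)) -> hoare G Q t2 S ->
  hoare (fseq F G) P (t1 + t2).+1 S.
Proof.
move=> hF hQ hG T /hF [n [T' [hn [q [hr hq]] /hQ /hG [m [T'' [hm [p [hr' hp]] hS]]]]]].
have [n' hn' [q' [h1 h2] h3]] := fseq_left G hr hq.
exists (m + n'.+1), T''; split=> //; first by lia.
exists (inr p); split=> //; rewrite iterD iterS h3 {2}/fstep /= h2 fseq_right.
by rewrite -/(rewr T') hr'.
Qed.

Definition fwhile (i0 : I) (tst : cell -> bool) (F : frag) : frag :=
  @Frag (option (option (fstate F))) (Some None) (fun q => q == None)
    (fun q rd => match q with
     | None => (None, fun i => keep (rd i))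
     | Some None => (if tst (rd i0) then Some (Some (fstart F)) else None,
                     fun i => keep (rd i))
     | Some (Some q) => if fhalt q then (Some None, fun i => keep (rd i))
                else let: (q', act) := fdelta q rd in (Some (Some q'), act)
     end).

Lemma fwhile_body i0 tst (F : frag) n T q T' :
  iter n (@fstep F) (fstart F, T) = (q, T') -> fhalt q ->
  exists2 m, m <= n & exists2 q', iter m (@fstep F) (fstart F, T) = (q', T') /\ fhalt q' &
    iter m (@fstep (fwhile i0 tst F)) (Some (Some (fstart F)), T) = (Some (Some q'), T').
Proof.
move: (fstart F) => q0; elim: n q0 T => [|n IHn] q0 T.
  by case=> -> -> hq; exists 0 => //; exists q.
case hq0: (fhalt q0).
  rewrite (@iter_fstep_halt F n.+1 (q0, T)) // => -[<- <-] _.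
  by exists 0 => //; exists q0.
rewrite iterSr {2}/fstep /= hq0; case E: fdelta => [q1 act] /IHn IH hq.
have [m hm [q' [h1 h2] h3]] := IH hq; exists m.+1 => //; exists q' => //.
  by split=> //; rewrite iterSr {2}/fstep /= hq0 E.
by rewrite iterSr {2}/fstep /= hq0 E.
Qed.

(** The invariant is indexed by the number of completed rounds. A round costs two steps besides the
    body, one for the test and one for the return to it; the final step is the failing test. *)
Lemma hoare_fwhile i0 (tst : cell -> bool) (F : frag) (P : nat -> (I -> tape) -> Prop) n t :
  (forall j T, j <= n -> P j T -> P j (rewr T)) ->
  (forall j T, j < n -> P j T -> tst (tape_read (T i0))) ->
  (forall T, P n T -> ~~ tst (tape_read (T i0))) ->
  (forall j, j < n -> hoare F (P j) t (P j.+1)) ->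
  hoare (fwhile i0 tst F) (P 0) (n * t.+2).+1 (P n).
Proof.
move=> hre htst hend hF; have hk k : k <= n -> forall T, P (n - k) T ->
    exists m T', [/\ m <= (k * t.+2).+1, runs (fwhile i0 tst F) T m T' & P n T'].
  elim: k => [_|k IHk hk] T hT.
    rewrite subn0 in hT; exists 1, (rewr T); split=> //; last exact: hre.
    by exists None; rewrite /= /fstep /= (negbTE (hend _ hT)).
  have hlt : n - k.+1 < n by lia.
  have hT1 := hre _ _ (ltnW hlt) hT.
  have [m [T1 [hm [q [hr hq]] hP]]] := hF _ hlt _ hT1.
  have [m' hm' [q' [h1 h2] h3]] := fwhile_body i0 tst hr hq.
  have e : (n - k.+1).+1 = n - k by lia.
  rewrite e in hP; have hP' := hre _ _ (leq_subr _ _) hP.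
  have [l [T2 [hl [p [hr2 hp]] hP2]]] := IHk (ltnW hk) _ hP'.
  exists (l + m'.+2), T2; split=> //; first by rewrite mulSn; lia.
  exists p; split=> //; rewrite iterD -hr2; congr iter.
  rewrite -addn1 addSn iterS iterD /= {3}/fstep /= (htst _ _ hlt hT).
  by rewrite -/(rewr T) h3 /fstep /= h2 -/(rewr T1).
move=> T hT; have := hk n (leqnn _) T; rewrite subnn => /(_ hT) [m [T' [? ? ?]]].
by exists m, T'.
Qed.

End Fragments.

(** * One-way infinite tapes with known contents *)

(* Contents are compared through [nth], so that explicit trailing blanks do not
   matter. *)
Definition tape_at (c : nat -> cell) (p : nat) (tp : tape) : Prop :=
  (forall j, nth None tp.2 j = c (p + j)) /\
  (forall j, nth None tp.1 j = if j < p then c (p - j.+1) else None).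

Lemma tape_at_read c p tp : tape_at c p tp -> tape_read tp = c p.
Proof. by case=> /(_ 0); rewrite addn0 nth0. Qed.

Definition updf (K : eqType) (T : Type) (c : K -> T) (p : K) (x : T) : K -> T :=
  fun j => if j == p then x else c j.

Lemma tape_at_ext c c' p tp : c =1 c' -> tape_at c p tp -> tape_at c' p tp.
Proof. by move=> h [h1 h2]; split=> j; rewrite ?h1 ?h2 ?h. Qed.

Lemma tape_at_write c p x tp :
  tape_at c p tp -> tape_at (updf c p x) p (tape_write x tp).
Proof.
case: tp => l r [/= h1 h2]; split=> j /=.
  case: j => [|j] /=; first by rewrite addn0 /updf eqxx.
  by rewrite nth_behead h1 /updf; case: eqP => //; lia.
by rewrite h2 /updf; case: ifP => // hj; case: eqP => //; lia.
Qed.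

Lemma tape_at_R c p tp : tape_at c p tp -> tape_at c p.+1 (tape_move MoveR tp).
Proof.
case: tp => l r [/= h1 h2]; split=> j /=; first by rewrite nth_behead h1 addSnnS.
case: j => [|j] /=; first by rewrite -nth0 h1 addn0 subn1.
by rewrite h2 ltnS subSS.
Qed.

Lemma tape_at_L c p tp : tape_at c p.+1 tp -> tape_at c p (tape_move MoveL tp).
Proof.
case: tp => l r [/= h1 h2]; split=> j /=; last by rewrite nth_behead h2 ltnS subSS.
case: j => [|j] /=; first by rewrite -nth0 h2 /= subn1 addn0.
by rewrite h1 addSnnS.
Qed.

Lemma tape_at_act c p tp x m p' : tape_at c p tp ->
  (match m with MoveL => p = p'.+1 | MoveR => p' = p.+1 | Stay => p' = p end) ->
  tape_at (updf c p x) p' (act_tape (x, m) tp).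
Proof.
move=> /(tape_at_write x) h; rewrite /act_tape /=; case: m => [e|->|->] //.
  by apply: tape_at_L; rewrite -e.
exact: tape_at_R.
Qed.

Lemma updf_same (K : eqType) (T : Type) (c : K -> T) p : updf c p (c p) =1 c.
Proof. by move=> j; rewrite /updf; case: eqP => // ->. Qed.

Lemma tape_at_go c p tp m p' : tape_at c p tp ->
  (match m with MoveL => p = p'.+1 | MoveR => p' = p.+1 | Stay => p' = p end) ->
  tape_at c p' (act_tape (tape_read tp, m) tp).
Proof.
move=> h hm; apply: tape_at_ext (tape_at_act (tape_read tp) h hm).
by rewrite (tape_at_read h); exact: updf_same.
Qed.

Lemma tape_at_keep c p tp : tape_at c p tp ->
  tape_at c p (act_tape (keep (tape_read tp)) tp).
Proof. by move=> h; exact: (tape_at_go (m := Stay) h). Qed.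

(** * Polynomially bounded functions *)

(* The powers of M + 2 are cofinal among the polynomials in M. *)
Definition polyb (f : nat -> nat) : Prop := exists d, forall M, f M <= M.+2 ^ d.

Lemma polyb_le f f' : (forall M, f M <= f' M) -> polyb f' -> polyb f.
Proof. by move=> h [d hd]; exists d => M; exact: leq_trans (h M) (hd M). Qed.

Lemma polyb_const c : polyb (fun _ => c).
Proof. by exists c => M; apply: ltnW; exact: ltn_expl. Qed.

Lemma polyb_id : polyb id.
Proof. by exists 1 => M; rewrite expn1; lia. Qed.

Lemma polyb_mul f f' : polyb f -> polyb f' -> polyb (fun M => f M * f' M).
Proof.
by move=> [d hd] [d' hd']; exists (d + d') => M; rewrite expnD leq_mul.
Qed.

Lemma polyb_add f f' : polyb f -> polyb f' -> polyb (fun M => f M + f' M).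
Proof.
move=> [d hd] [d' hd']; exists (d + d').+1 => M.
have h1 := hd M; have h2 := hd' M; have h3 : M.+2 ^ d <= M.+2 ^ (d + d').
  by rewrite leq_pexp2l //; lia.
have h4 : M.+2 ^ d' <= M.+2 ^ (d + d') by rewrite leq_pexp2l //; lia.
by rewrite expnS; nia.
Qed.

Lemma polyb_S f : polyb f -> polyb (fun M => (f M).+1).
Proof.
by move=> /(polyb_add (polyb_const 1)) h; apply: polyb_le h => M.
Qed.

Lemma polyb_comp f f' : polyb f -> polyb f' -> polyb (fun M => f (f' M)).
Proof.
move=> [d hd] [d' hd']; exists (d'.+2 * d) => M; apply: leq_trans (hd _) _.
have -> : M.+2 ^ (d'.+2 * d) = (M.+2 ^ d'.+2) ^ d by rewrite expnM.
case: d {hd} => [|d]; first by rewrite !expn0.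
rewrite leq_exp2r // !expnS.
have h := hd' M; have h0 : 0 < M.+2 ^ d' by rewrite expn_gt0.
by nia.
Qed.

Ltac solve_polyb :=
  repeat first [ assumption | exact: polyb_id | exact: polyb_const
    | apply: polyb_S | apply: polyb_add | apply: polyb_mul ].

(** * Arithmetic expressions with access to an input word *)

Inductive exp :=
| Const of nat
| EVar of nat
| Add of exp & exp
| Sub of exp & exp
| Mul of exp & exp
| In of exp
| Sum of nat & exp & exp.

Fixpoint eval (w : seq bool) (rho : nat -> nat) (e : exp) : nat :=
  match e with
  | Const c => c
  | EVar x => rho x
  | Add a b => eval w rho a + eval w rho b
  | Sub a b => eval w rho a - eval w rho b
  | Mul a b => eval w rho a * eval w rho b
  | In a => nth false w (eval w rho a)
  | Sum x a b => \sum_(0 <= v < eval w rho a) eval w (upd rho x v) b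
  end.

Fixpoint names (e : exp) : nat :=
  match e with
  | Const _ => 0
  | EVar x => x
  | Add a b | Sub a b | Mul a b => maxn (names a) (names b)
  | In a => names a
  | Sum x a b => maxn x (maxn (names a) (names b))
  end.

(** Chosen so that [comp e b] touches no scratch register above [b + scratch e]. *)
Fixpoint scratch (e : exp) : nat :=
  match e with
  | Const _ => 0
  | EVar _ => 1
  | Add a b => maxn (scratch a) (scratch b)
  | Sub a b | Mul a b => (maxn (scratch a) (scratch b)).+2
  | In a => (scratch a).+2
  | Sum _ a b => (maxn (scratch a) (scratch b)).+3
  end.

(** * Counter registers on tapes *)

(** Left summands hold the variables of expressions, right summands are scratch space. *)
Definition reg := (nat + nat)%type.

Lemma eq_inl (x y : nat) : ((inl x : reg) == inl y) = (x == y). Proof. by []. Qed.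
Lemma eq_inr (x y : nat) : ((inr x : reg) == inr y) = (x == y). Proof. by []. Qed.
Lemma eq_inlr (x y : nat) : ((inl x : reg) == inr y) = false. Proof. by []. Qed.
Lemma eq_inrl (x y : nat) : ((inr x : reg) == inl y) = false. Proof. by []. Qed.

Ltac simp_reg := rewrite ?eq_inl ?eq_inr ?eq_inlr ?eq_inrl.

Ltac reg_ext := let r := fresh "r" in
  move=> r; rewrite /updf; case: r => r;
  rewrite ?eq_inl ?eq_inr ?eq_inlr ?eq_inrl;
  repeat (case: eqP => ? //=); subst; try lia.

(* Cell 0 stays blank and stops the head when it is moved back to the start. *)
Definition word_cells (w : seq bool) (j : nat) : cell :=
  if j is j'.+1 then nth None (map Some w) j' else None.

(* The value of a counter is the position of its head; the mark on cell 0 is used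
   to test for zero. *)
Definition counter_cells (j : nat) : cell := if j is 0 then Some true else None.

Section Compiler.
Variables (X : Type) (N Sc : nat) (w : seq bool).

(** [None] is the output tape, [Some None] the tape with the input word, all others are counters.
    [X] indexes the tapes of the machine that is simulated beforehand. *)
Definition aux := option (option ('I_N.+1 + 'I_Sc.+1)).
Definition tapeix := (X + aux)%type.

Definition itape : tapeix := inr (Some None).
Definition otape : tapeix := inr None.

Definition regix (r : reg) : aux :=
  Some (Some (match r with inl x => inl (inord x) | inr b => inr (inord b) end)).
Definition rtape (r : reg) : tapeix := inr (regix r).

Definition ixreg (i : 'I_N.+1 + 'I_Sc.+1) : reg :=
  match i with inl x => inl (val x) | inr b => inr (val b) end.

Definition valid (r : reg) : bool :=
  match r with inl x => x <= N | inr b => b <= Sc end.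

Definition is_aux (j0 : aux) (i : tapeix) : bool :=
  if i is inr j then j == j0 else false.

Lemma regixE r i : valid r -> (Some (Some i) == regix r) = (ixreg i == r).
Proof.
case: r i => [x|b] [y|c] //= h; rewrite /regix /ixreg.
- apply/eqP/eqP => [[->]|[<-]]; first by rewrite inordK.
  by rewrite inord_val.
- apply/eqP/eqP => [[->]|[<-]]; first by rewrite inordK.
  by rewrite inord_val.
Qed.

(** The heads on the two word tapes are shifted by one because cell 0 is the blank left marker.
    Nothing is claimed about the tapes in [X]. *)
Definition repr (p : nat) (g : reg -> nat) (o : seq bool) (T : tapeix -> tape) : Prop :=
  [/\ tape_at (word_cells w) p.+1 (T itape),
      tape_at (word_cells o) (size o).+1 (T otape)
    & forall i, tape_at counter_cells (g (ixreg i)) (T (inr (Some (Some i))))].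

Lemma repr_reg p g o T r : repr p g o T -> valid r ->
  tape_at counter_cells (g r) (T (rtape r)).
Proof.
move=> [_ _ h] hr; rewrite /rtape /regix; move: (h (match r with inl x => inl (inord x) | inr b => inr (inord b) end)).
by case: r hr => x hx /=; rewrite inordK.
Qed.

Lemma repr_rewr p g o T : repr p g o T -> repr p g o (rewr T).
Proof. by case=> h1 h2 h3; split=> *; apply: tape_at_keep. Qed.

Lemma hseq F G p g o (P : (tapeix -> tape) -> Prop) Q t1 t2 :
  hoare F P t1 (repr p g o) -> hoare G (repr p g o) t2 Q ->
  hoare (fseq F G) P (t1 + t2).+1 Q.
Proof. by move=> h1 h2; apply: hoare_fseq h1 _ h2; exact: repr_rewr. Qed.

Lemma hoare_eq F P t p g g' o : hoare F P t (repr p g o) -> g =1 g' ->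
  hoare F P t (repr p g' o).
Proof. by move=> h /functional_extensionality <-. Qed.

Definition nz (c : cell) : bool := c == None.

Lemma repr_nz p g o T r : repr p g o T -> valid r ->
  nz (tape_read (T (rtape r))) = (0 < g r).
Proof.
by move=> h hr; rewrite (tape_at_read (repr_reg h hr)) /nz; case: (g r).
Qed.

Definition loop r F : frag tapeix := fwhile (rtape r) nz F.

Lemma hloop r F (P : nat -> nat) (G : nat -> reg -> nat) (O : nat -> seq bool) n t :
  valid r -> (forall j, j < n -> 0 < G j r) -> G n r = 0 ->
  (forall j, j < n ->
    hoare F (repr (P j) (G j) (O j)) t (repr (P j.+1) (G j.+1) (O j.+1))) ->
  hoare (loop r F) (repr (P 0) (G 0) (O 0)) (n * t.+2).+1 (repr (P n) (G n) (O n)).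
Proof.
move=> hr h1 h2 h3; apply: (hoare_fwhile (P := fun j => repr (P j) (G j) (O j))) => //.
- by move=> j T _; exact: repr_rewr.
- by move=> j T /h1 hj hT; rewrite (repr_nz hT hr).
- by move=> T hT; rewrite (repr_nz hT hr) h2.
Qed.

Definition inc r : frag tapeix :=
  prim (rtape r) (fun _ i c => if is_aux (regix r) i then (c, MoveR) else keep c).

Lemma hinc r p g o : valid r ->
  hoare (inc r) (repr p g o) 1 (repr p (updf g r (g r).+1) o).
Proof.
move=> hr; apply: hoare_prim => T [h1 h2 h3]; split=> [||i]; try exact: tape_at_keep.
rewrite /is_aux regixE // /updf; case: eqP => [e|_]; last exact: tape_at_keep.
by apply: (tape_at_go (h3 i)); rewrite e.
Qed.

Definition dec r : frag tapeix :=
  prim (rtape r) (fun _ i c => if is_aux (regix r) i then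
    (if nz c then (c, MoveL) else keep c) else keep c).

Lemma hdec r p g o : valid r ->
  hoare (dec r) (repr p g o) 1 (repr p (updf g r (g r).-1) o).
Proof.
move=> hr; apply: hoare_prim => T [h1 h2 h3]; split=> [||i]; try exact: tape_at_keep.
rewrite /is_aux regixE // /updf; case: eqP => [e|_]; last exact: tape_at_keep.
rewrite (tape_at_read (h3 i)) /nz -e; move: (h3 i); case E: (g (ixreg i)) => [|n] h /=.
  by have := tape_at_keep h; rewrite (tape_at_read h).
by have := @tape_at_go _ _ _ MoveL n h erefl; rewrite (tape_at_read h).
Qed.

Definition imove (m : move) : frag tapeix :=
  prim itape (fun _ i c => if is_aux (Some None) i then (c, m) else keep c).

Lemma himoveR p g o : hoare (imove MoveR) (repr p g o) 1 (repr p.+1 g o).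
Proof.
apply: hoare_prim => T [h1 h2 h3]; split=> [||i]; try exact: tape_at_keep.
exact: (tape_at_go h1).
Qed.

Lemma himoveL p g o : hoare (imove MoveL) (repr p.+1 g o) 1 (repr p g o).
Proof.
apply: hoare_prim => T [h1 h2 h3]; split=> [||i]; try exact: tape_at_keep.
exact: (tape_at_go h1).
Qed.

Definition inc_in r : frag tapeix :=
  prim itape (fun c0 i c =>
    if is_aux (regix r) i && (c0 == Some true) then (c, MoveR) else keep c).

Lemma word_cells_true o p : (word_cells o p.+1 == Some true) = nth false o p.
Proof.
rewrite /=; have [h|h] := ltnP p (size o).
  by rewrite (nth_map false) //; case: nth.
by rewrite !nth_default // size_map.
Qed.

Lemma hinc_in r p g o : valid r ->
  hoare (inc_in r) (repr p g o) 1 (repr p (updf g r (g r + nth false w p)) o).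
Proof.
move=> hr; apply: hoare_prim => T [h1 h2 h3]; split=> [||i]; try exact: tape_at_keep.
rewrite (tape_at_read h1) word_cells_true /is_aux regixE // /updf.
case: eqP => [e|_] /=; last exact: tape_at_keep.
case: nth => /=; last by rewrite addn0 -e; exact: tape_at_keep.
by apply: (tape_at_go (h3 i)); rewrite e addn1.
Qed.

Definition append r : frag tapeix :=
  prim (rtape r) (fun c0 i c =>
    if is_aux None i then (Some (nz c0), MoveR) else keep c).

Lemma word_cells_rcons o b : updf (word_cells o) (size o).+1 (Some b) =1 word_cells (rcons o b).
Proof.
move=> [|j] //=; rewrite /updf eqSS map_rcons nth_rcons size_map.
case: ltngtP => // h; rewrite /= nth_default // size_map; lia.
Qed.

Lemma happend r p g o : valid r ->
  hoare (append r) (repr p g o) 1 (repr p g (rcons o (0 < g r))).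
Proof.
move=> hr; apply: hoare_prim => T h; have hnz := repr_nz h hr.
case: h => [h1 h2 h3]; split=> [||i]; try exact: tape_at_keep.
rewrite hnz size_rcons; apply: tape_at_ext (@tape_at_act _ _ _ _ MoveR _ h2 erefl).
exact: word_cells_rcons.
Qed.

Definition clear r := loop r (dec r).

Lemma hclear r p g o : valid r ->
  hoare (clear r) (repr p g o) (g r * 3).+1 (repr p (updf g r 0) o).
Proof.
move=> hr.
have := @hloop r (dec r) (fun _ => p) (fun j => updf g r (g r - j)) (fun _ => o) (g r) 1 hr.
rewrite subn0 subnn (functional_extensionality _ _ (updf_same g r)); apply.
- by move=> j hj; rewrite /updf eqxx; lia.
- by rewrite /updf eqxx.
- move=> j hj; apply: hoare_eq (hdec hr) _ => r'; rewrite /updf eqxx.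
  by case: eqP => //; lia.
Qed.

Definition mv r r' := loop r (fseq (dec r) (inc r')).

Lemma hmv r r' p g o : valid r -> valid r' -> r != r' ->
  hoare (mv r r') (repr p g o) (g r * 5).+1
    (repr p (updf (updf g r 0) r' (g r' + g r)) o).
Proof.
move=> hr hr' hne; pose G j := updf (updf g r (g r - j)) r' (g r' + j).
have e0 : G 0 = g.
  apply: functional_extensionality => s; rewrite /G /updf subn0 addn0.
  by case: eqP => [->|] //; case: eqP => [->|].
have := @hloop r (fseq (dec r) (inc r')) (fun _ => p) G (fun _ => o) (g r) 3 hr.
rewrite e0 /= /G subnn; apply.
- by move=> j hj; rewrite /updf (negbTE hne) eqxx; lia.
- by rewrite /updf (negbTE hne) eqxx.
- move=> j hj; apply: hseq (hdec hr) _; apply: hoare_eq (hinc hr') _ => s.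
  rewrite /updf.
  rewrite !eqxx (negbTE hne) [r' == r]eq_sym (negbTE hne).
  by case: eqP => [_|_]; [lia | case: eqP => // _; lia].
Qed.

(** Reading a counter destroys it; with two targets it can be copied and restored at once. *)
Definition mv2 r r1 r2 := loop r (fseq (dec r) (fseq (inc r1) (inc r2))).

Lemma hmv2 r r1 r2 p g o : valid r -> valid r1 -> valid r2 ->
  r != r1 -> r != r2 -> r1 != r2 ->
  hoare (mv2 r r1 r2) (repr p g o) (g r * 7).+1
    (repr p (updf (updf (updf g r 0) r1 (g r1 + g r)) r2 (g r2 + g r)) o).
Proof.
move=> hr hr1 hr2 h1 h2 h3.
pose G j := updf (updf (updf g r (g r - j)) r1 (g r1 + j)) r2 (g r2 + j).
have e0 : G 0 = g.
  apply: functional_extensionality => s; rewrite /G /updf subn0 !addn0.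
  by case: eqP => [->|] //; case: eqP => [->|] //; case: eqP => [->|].
have := @hloop r (fseq (dec r) (fseq (inc r1) (inc r2))) (fun _ => p) G (fun _ => o) (g r) 5 hr.
rewrite e0 /= => H; apply: hoare_eq (H _ _ _) _; last by rewrite /G subnn.
- by move=> j hj; rewrite /G /updf (negbTE h1) (negbTE h2) eqxx; lia.
- by rewrite /G /updf (negbTE h1) (negbTE h2) eqxx subnn.
- move=> j hj; apply: (@hoare_le _ _ _ _ (1 + (1 + 1).+1).+1) => //.
  apply: hseq (hdec hr) _; apply: hseq (hinc hr1) _.
  apply: hoare_eq (hinc hr2) _ => s; rewrite /G /updf !eqxx.
  rewrite [r2 == r]eq_sym [r2 == r1]eq_sym [r1 == r]eq_sym.
  rewrite (negbTE h1) (negbTE h2) (negbTE h3).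
  by repeat (case: eqP => [_|_]); lia.
Qed.

Fixpoint incn c r : frag tapeix :=
  if c is c'.+1 then fseq (inc r) (incn c' r) else fskip tapeix.

Lemma hincn c r p g o : valid r ->
  hoare (incn c r) (repr p g o) (c * 2) (repr p (updf g r (g r + c)) o).
Proof.
move=> hr; elim: c g => [|c IHc] g.
  by rewrite addn0 (functional_extensionality _ _ (updf_same g r)); exact: hoare_skip.
rewrite mulSn; apply: hseq (hinc hr) _; apply: hoare_eq (IHc _) _ => s.
rewrite /updf eqxx.
by case: eqP => // _; lia.
Qed.

(* [comp e b] adds the value of [e] to the scratch register [b].  The scratch
   registers above [b] are zero before and after; the bound variable of [Sum] is
   saved in one of them, as it may be in use outside. *)
Fixpoint comp (e : exp) (b : nat) : frag tapeix :=
  match e with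
  | Const c => incn c (inr b)
  | EVar x => fseq (mv (inl x) (inr b.+1)) (mv2 (inr b.+1) (inl x) (inr b))
  | Add a c => fseq (comp a b) (comp c b)
  | Sub a c =>
      fseq (comp a b.+1) (fseq (comp c b.+2)
        (fseq (loop (inr b.+2) (fseq (dec (inr b.+2)) (dec (inr b.+1))))
              (mv (inr b.+1) (inr b))))
  | Mul a c =>
      fseq (comp a b.+1) (fseq (loop (inr b.+1) (fseq (dec (inr b.+1)) (comp c b.+2)))
        (mv (inr b.+2) (inr b)))
  | In a =>
      fseq (comp a b.+1) (fseq
        (loop (inr b.+1) (fseq (dec (inr b.+1)) (fseq (inc (inr b.+2)) (imove MoveR))))
        (fseq (inc_in (inr b))
          (loop (inr b.+2) (fseq (dec (inr b.+2)) (imove MoveL)))))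
  | Sum x a c =>
      fseq (comp a b.+1) (fseq (mv (inl x) (inr b.+2)) (fseq
        (loop (inr b.+1)
          (fseq (dec (inr b.+1)) (fseq (comp c b.+3) (inc (inl x)))))
        (fseq (clear (inl x)) (fseq (mv (inr b.+2) (inl x)) (mv (inr b.+3) (inr b))))))
  end.

End Compiler.

(** * Correctness and polynomial cost of compiled expressions *)

Section CompilerSpec.
Variables (X : Type) (N Sc : nat).

Notation tapeix := (tapeix X N Sc).
Notation valid := (valid N Sc).
Notation inc := (inc X N Sc).
Notation dec := (dec X N Sc).
Notation mv := (mv X N Sc).
Notation mv2 := (mv2 X N Sc).
Notation imove := (imove X N Sc).
Notation comp := (comp X N Sc).
Notation repr w := (@repr X N Sc w).

Definition envr (g : reg -> nat) (x : nat) : nat := g (inl x).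

(** One polynomial in a bound on the variables limits both the value and the running time. It is
    uniform in the input word, of which only single bits enter a value, and in the scratch registers
    up to [b], to the last of which the value is merely added. *)
Definition comp_spec e := exists2 f, polyb f & forall w M b g o,
  names e <= N -> b + scratch e <= Sc -> (forall b', b < b' -> g (inr b') = 0) ->
  (forall x, g (inl x) <= M) ->
  eval w (envr g) e <= f M /\
  hoare (comp e b) (repr w 0 g o) (f M)
    (repr w 0 (updf g (inr b) (g (inr b) + eval w (envr g) e)) o).

Lemma envr_inr g b v : envr (updf g (inr b) v) = envr g.
Proof. by apply: functional_extensionality => x. Qed.

Lemma comp_const c : comp_spec (Const c).
Proof.
exists (fun _ => c * 2); first exact: polyb_const.
move=> w M b g o _ /= hb _ _; split; first by lia.
by apply: hincn; rewrite /=; lia.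
Qed.

Lemma comp_var x : comp_spec (EVar x).
Proof.
exists (fun M => (M * 5).+1 + (M * 7).+1 + 1); first by solve_polyb.
move=> w M b g o /= hx hb hg hM; have hMx := hM x; split; first by rewrite /envr; lia.
have v0 : valid (inr b) by rewrite /=; lia.
have v1 : valid (inr b.+1) by rewrite /=; lia.
have n1 : (inr b.+1 : reg) != inr b by simp_reg; lia.
have h1 := @hmv X N Sc w (inl x) (inr b.+1) 0 g o hx v1 isT.
have h2 := @hmv2 X N Sc w (inr b.+1) (inl x) (inr b) 0
   (updf (updf g (inl x) 0) (inr b.+1) (g (inr b.+1) + g (inl x))) o v1 hx v0 isT n1 isT.
have h := hg b.+1 (leqnn _); apply: hoare_eq (hoare_le (hseq h1 h2) _) _.
  by rewrite /updf; simp_reg; rewrite eqxx h; lia.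
by rewrite /envr; reg_ext.
Qed.

Lemma comp_add a c : comp_spec a -> comp_spec c -> comp_spec (Add a c).
Proof.
move=> [fa pa ha] [fc pc hc]; exists (fun M => (fa M + fc M).+1); first by solve_polyb.
move=> w M b g o /=; rewrite geq_max => /andP[na nc] hb hg hM.
have [va ka] := ha w M b g o na ltac:(lia) hg hM.
have hg' b' : b < b' -> updf g (inr b) (g (inr b) + eval w (envr g) a) (inr b') = 0.
  by move=> hb'; rewrite /updf; simp_reg; case: eqP => [|_]; [lia | exact: hg].
have [vc kc] := hc w M b _ o nc ltac:(lia) hg' hM.
rewrite envr_inr in vc kc; split; first by lia.
by apply: hoare_eq (hseq ka kc) _; reg_ext; rewrite eqxx addnA.
Qed.

Lemma comp_sub a c : comp_spec a -> comp_spec c -> comp_spec (Sub a c).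
Proof.
move=> [fa pa ha] [fc pc hc].
exists (fun M => (fa M + (fc M + ((fc M * 5).+1 + (fa M * 5).+1).+1).+1).+1).
  by solve_polyb.
move=> w M b g o /=; rewrite geq_max => /andP[na nc] hb hg hM.
have v0 : valid (inr b) by rewrite /=; lia.
have v1 : valid (inr b.+1) by rewrite /=; lia.
have v2 : valid (inr b.+2) by rewrite /=; lia.
have n1 : (inr b.+1 : reg) != inr b by simp_reg; lia.
have [va ka] := ha w M b.+1 g o na ltac:(lia) (fun b' h => hg b' (ltnW h)) hM.
set A := eval w (envr g) a in va ka *.
have g1 := hg b.+1 (leqnn _); have g2 := hg b.+2 (leqW (leqnn _)).
rewrite g1 add0n in ka.
have hg' b' : b.+2 < b' -> updf g (inr b.+1) A (inr b') = 0.
  by move=> hb'; rewrite /updf; simp_reg; case: eqP => [|_]; [lia | apply: hg; lia].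
have [vc kc] := hc w M b.+2 (updf g (inr b.+1) A) o nc ltac:(lia) hg' hM.
rewrite envr_inr in vc kc; set C := eval w (envr g) c in vc kc *.
split; first by lia.
(* [dec] leaves a counter at 0 unchanged, so [C] decrements of the minuend compute the truncated
   difference. *)
pose G j := updf (updf g (inr b.+1) (A - j)) (inr b.+2) (C - j).
have k3 : hoare (loop (inr b.+2) (fseq (dec (inr b.+2)) (dec (inr b.+1))))
    (repr w 0 (G 0) o) (C * 5).+1 (repr w 0 (G C) o).
  apply: (@hloop X N Sc w _ _ (fun _ => 0) G (fun _ => o)) => //.
  - by move=> j hj; rewrite /G /updf eqxx; lia.
  - by rewrite /G /updf eqxx subnn.
  - move=> j hj; apply: hseq (hdec v2) _; apply: hoare_eq (hdec v1) _.
    by rewrite /G; reg_ext.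
have k4 := @hmv X N Sc w (inr b.+1) (inr b) 0 (G C) o v1 v0 n1.
have e0 : updf (updf g (inr b.+1) A) (inr b.+2) (updf g (inr b.+1) A (inr b.+2) + C) =1 G 0.
  by rewrite /G; reg_ext.
have {}k3 := hseq k3 k4.
apply: hoare_le (hoare_eq (hseq ka (hseq (hoare_eq kc e0) k3)) _) _.
  by rewrite /G; reg_ext.
by rewrite /G /updf; simp_reg; case: eqP => [|_]; rewrite ?eqxx; lia.
Qed.

Lemma comp_mul a c : comp_spec a -> comp_spec c -> comp_spec (Mul a c).
Proof.
move=> [fa pa ha] [fc pc hc].
exists (fun M => (fa M + ((fa M * (1 + fc M).+3).+1 + (fa M * fc M * 5).+1).+1).+1).
  by solve_polyb.
move=> w M b g o /=; rewrite geq_max => /andP[na nc] hb hg hM.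
have v0 : valid (inr b) by rewrite /=; lia.
have v1 : valid (inr b.+1) by rewrite /=; lia.
have v2 : valid (inr b.+2) by rewrite /=; lia.
have n2 : (inr b.+2 : reg) != inr b by simp_reg; lia.
have [va ka] := ha w M b.+1 g o na ltac:(lia) (fun b' h => hg b' (ltnW h)) hM.
set A := eval w (envr g) a in va ka *.
have g1 := hg b.+1 (leqnn _); have g2 := hg b.+2 (leqW (leqnn _)).
rewrite g1 add0n in ka.
have [vc _] := hc w M b.+2 g o nc ltac:(lia) (fun b' h => hg b' (ltn_trans (leqnn _) (ltnW h))) hM.
set C := eval w (envr g) c in vc *.
split; first by have := leq_mul va vc; lia.
pose G j := updf (updf g (inr b.+1) (A - j)) (inr b.+2) (j * C).
have k3 : hoare (loop (inr b.+1) (fseq (dec (inr b.+1)) (comp c b.+2)))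
    (repr w 0 (G 0) o) (A * (1 + fc M).+3).+1 (repr w 0 (G A) o).
  apply: (@hloop X N Sc w _ _ (fun _ => 0) G (fun _ => o)) => //.
  - by move=> j hj; rewrite /G /updf; simp_reg; rewrite eqxx; case: eqP; lia.
  - by rewrite /G /updf; simp_reg; rewrite eqxx; case: eqP; lia.
  - move=> j hj; apply: hseq (hdec v1) _.
    have hg' b' : b.+2 < b' -> updf (G j) (inr b.+1) (G j (inr b.+1)).-1 (inr b') = 0.
      move=> hb'; rewrite /G /updf; simp_reg.
      by repeat (case: eqP => ?; try lia); apply: hg; lia.
    have [_ kc] := hc w M b.+2 _ o nc ltac:(lia) hg' hM.
    apply: hoare_eq kc _; rewrite !envr_inr -/C /G; reg_ext.
have k4 := @hmv X N Sc w (inr b.+2) (inr b) 0 (G A) o v2 v0 n2.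
have e0 : updf g (inr b.+1) A =1 G 0 by rewrite /G; reg_ext.
have {}k3 := hseq k3 k4.
apply: hoare_le (hoare_eq (hseq (hoare_eq ka e0) k3) _) _.
  by rewrite /G; reg_ext.
have h1 := leq_mul va vc; have h2 : A * (1 + fc M).+3 <= fa M * (1 + fc M).+3 by rewrite leq_mul2r va orbT.
by rewrite /G /updf; simp_reg; rewrite eqxx; lia.
Qed.

Lemma comp_in a : comp_spec a -> comp_spec (In a).
Proof.
move=> [fa pa ha].
exists (fun M => (fa M + ((fa M * 7).+1 + (1 + (fa M * 5).+1).+1).+1).+1).
  by solve_polyb.
move=> w M b g o /= na hb hg hM.
have v0 : valid (inr b) by rewrite /=; lia.
have v1 : valid (inr b.+1) by rewrite /=; lia.
have v2 : valid (inr b.+2) by rewrite /=; lia.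
have [va ka] := ha w M b.+1 g o na ltac:(lia) (fun b' h => hg b' (ltnW h)) hM.
set A := eval w (envr g) a in va ka *.
have g1 := hg b.+1 (leqnn _); have g2 := hg b.+2 (leqW (leqnn _)).
rewrite g1 add0n in ka; split; first by case: nth; lia.
(* While the input head advances, register [b.+2] counts its moves; the second loop spends this
   count to bring the head back. *)
pose G j := updf (updf g (inr b.+1) (A - j)) (inr b.+2) j.
have k3 : hoare (loop (inr b.+1) (fseq (dec (inr b.+1)) (fseq (inc (inr b.+2)) (imove MoveR))))
    (repr w 0 (G 0) o) (A * 7).+1 (repr w A (G A) o).
  apply: (@hloop X N Sc w _ _ id G (fun _ => o)) => //.
  - by move=> j hj; rewrite /G /updf; simp_reg; rewrite eqxx; case: eqP; lia.
  - by rewrite /G /updf; simp_reg; rewrite eqxx; case: eqP; lia.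
  - move=> j hj; apply: (@hoare_le _ _ _ _ (1 + (1 + 1).+1).+1) => //.
    apply: hseq (hdec v1) _; apply: hseq (hinc v2) _.
    by apply: hoare_eq; [exact: himoveR | rewrite /G; reg_ext].
have k4 := @hinc_in X N Sc w (inr b) A (G A) o v0.
set g4 := updf (G A) _ _ in k4.
pose H j := updf g4 (inr b.+2) (A - j).
have k5 : hoare (loop (inr b.+2) (fseq (dec (inr b.+2)) (imove MoveL)))
    (repr w A (H 0) o) (A * 5).+1 (repr w 0 (H A) o).
  have := @hloop X N Sc w (inr b.+2) (fseq (dec (inr b.+2)) (imove MoveL)) (fun j => A - j) H (fun _ => o) A 3.
  rewrite subn0 subnn; apply=> //.
  - by move=> j hj; rewrite /H /updf eqxx; lia.
  - by rewrite /H /updf eqxx subnn.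
  - move=> j hj; apply: hseq (hdec v2) _; have -> : A - j = (A - j.+1).+1 by lia.
    by apply: hoare_eq; [exact: himoveL | rewrite /H; reg_ext].
have e0 : updf g (inr b.+1) A =1 G 0 by rewrite /G; reg_ext.
have e1 : g4 =1 H 0 by rewrite /H /g4 /G; reg_ext.
have {}k4 := hseq (hoare_eq k4 e1) k5.
apply: hoare_le (hoare_eq (hseq (hoare_eq ka e0) (hseq k3 k4)) _) _; last by lia.
by rewrite /H /g4 /G; reg_ext.
Qed.

Lemma envr_inl g x v : envr (updf g (inl x) v) = upd (envr g) x v.
Proof. by apply: functional_extensionality => y. Qed.

Lemma comp_sum x a c : comp_spec a -> comp_spec c -> comp_spec (Sum x a c).
Proof.
(* The bound variable never exceeds the value of [a], so inside the loop all variables are bounded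
   by [M + fa M]. *)
move=> [fa pa ha] [fc pc hc]; pose M' M := M + fa M.
have pM : polyb M' by apply: polyb_add => //; exact: polyb_id.
have pc' := polyb_comp pc pM.
exists (fun M => (fa M + ((M * 5).+1 + ((fa M * (1 + (fc (M' M) + 1).+1).+3).+1 +
   ((fa M * 3).+1 + ((M * 5).+1 + (fa M * fc (M' M) * 5).+1).+1).+1).+1).+1).+1).
  by solve_polyb.
move=> w M b g o /=; rewrite !geq_max => /and3P[nx na nc] hb hg hM.
have v0 : valid (inr b) by rewrite /=; lia.
have v1 : valid (inr b.+1) by rewrite /=; lia.
have v2 : valid (inr b.+2) by rewrite /=; lia.
have v3 : valid (inr b.+3) by rewrite /=; lia.
have vx : valid (inl x) by [].
have [va ka] := ha w M b.+1 g o na ltac:(lia) (fun b' h => hg b' (ltnW h)) hM.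
set A := eval w (envr g) a in va ka *.
have g1 := hg b.+1 (leqnn _); have g2 := hg b.+2 (leqW (leqnn _)).
have g3 : g (inr b.+3) = 0 by apply: hg; lia.
have hMx := hM x.
rewrite g1 add0n in ka.
pose V v := eval w (upd (envr g) x v) c.
have Sle j : j <= A -> \sum_(0 <= v < j) V v <= j * fc (M' M).
  move=> hj; rewrite -[j in j * _]subn0 -sum_nat_const_nat.
  rewrite big_nat [leqRHS]big_nat; apply: leq_sum => v /andP[_ hv].
  have := hc w (M' M) b.+3 (updf g (inl x) v) o nc ltac:(lia).
  rewrite envr_inl => /(_ _ _)[] // => [b' hb'|y]; first by rewrite /updf; simp_reg; apply: hg; lia.
  rewrite /updf /M'; simp_reg; case: eqP => _; [lia | have := hM y; lia].
split.
  have h1 := Sle A (leqnn _); have h2 := leq_mul va (leqnn (fc (M' M))).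
  by apply: leq_trans h1 _; lia.
pose G j := updf (updf (updf (updf g (inr b.+1) (A - j)) (inr b.+2) (g (inl x)))
   (inl x) j) (inr b.+3) (\sum_(0 <= v < j) V v).
have k2 := @hmv X N Sc w (inl x) (inr b.+2) 0 (updf g (inr b.+1) A) o vx v2 isT.
have k3 : hoare (loop (inr b.+1) (fseq (dec (inr b.+1)) (fseq (comp c b.+3) (inc (inl x)))))
    (repr w 0 (G 0) o) (A * (1 + (fc (M' M) + 1).+1).+3).+1 (repr w 0 (G A) o).
  apply: (@hloop X N Sc w _ _ (fun _ => 0) G (fun _ => o)) => //.
  - by move=> j hj; rewrite /G /updf; simp_reg; do 3 (case: eqP => ? //; try lia).
  - by rewrite /G /updf; simp_reg; do 3 (case: eqP => ? //; try lia).
  - move=> j hj; apply: hseq (hdec v1) _.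
    set gj := updf (G j) _ _.
    have ej : envr gj = upd (envr g) x j.
      by apply: functional_extensionality.
    have hgj b' : b.+3 < b' -> gj (inr b') = 0.
      move=> hb'; rewrite /gj /G /updf; simp_reg.
      by repeat (case: eqP => ?; try lia); apply: hg; lia.
    have hMj y : gj (inl y) <= M' M.
      rewrite /gj /G /updf /M'; simp_reg; case: eqP => _; first by lia.
      exact: leq_trans (hM y) (leq_addr _ _).
    have [_ kc] := hc w (M' M) b.+3 gj o nc ltac:(lia) hgj hMj.
    rewrite ej in kc; apply: hseq kc _; apply: hoare_eq (hinc vx) _.
    rewrite /gj /G; reg_ext; rewrite big_nat_recr //.
have k4 := @hclear X N Sc w (inl x) 0 (G A) o vx.
have k5 := @hmv X N Sc w (inr b.+2) (inl x) 0 (updf (G A) (inl x) 0) o v2 vx isT.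
set g5 := updf _ (inl x) (_ + _) in k5.
have k6 := @hmv X N Sc w (inr b.+3) (inr b) 0 g5 o v3 v0 ltac:(simp_reg; lia).
have e0 : updf (updf (updf g (inr b.+1) A) (inl x) 0) (inr b.+2)
    (updf g (inr b.+1) A (inr b.+2) + updf g (inr b.+1) A (inl x)) =1 G 0.
  by rewrite /G big_geq //; reg_ext.
have {}k4 := hseq k4 (hseq k5 k6).
have {}k3 := hseq k3 k4.
apply: hoare_le (hoare_eq (hseq ka (hseq (hoare_eq k2 e0) k3)) _) _.
  by rewrite /g5 /G; reg_ext; rewrite /V /=; lia.
have h1 := Sle A (leqnn _); have h2 := leq_mul va (leqnn (fc (M' M))).
have h3 : A * (1 + (fc (M' M) + 1).+1).+3 <= fa M * (1 + (fc (M' M) + 1).+1).+3.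
  by rewrite leq_mul2r va orbT.
rewrite /g5 /G /updf; simp_reg; rewrite eqxx.
repeat (case: eqP => ?; try lia).
Qed.

Lemma comp_ok e : comp_spec e.
Proof.
elim: e => *; [exact: comp_const | exact: comp_var | exact: comp_add | exact: comp_sub
 | exact: comp_mul | exact: comp_in | exact: comp_sum].
Qed.

End CompilerSpec.

(** * Output programs *)

Inductive oprog :=
| Out of exp
| OSeq of oprog & oprog
| OFor of nat & exp & oprog.

Fixpoint out (w : seq bool) (rho : nat -> nat) (O : oprog) : seq bool :=
  match O with
  | Out e => [:: 0 < eval w rho e]
  | OSeq P Q => out w rho P ++ out w rho Q
  | OFor x a P => flatten [seq out w (upd rho x v) P | v <- iota 0 (eval w rho a)]
  end.

Fixpoint onames (O : oprog) : nat :=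
  match O with
  | Out e => names e
  | OSeq P Q => maxn (onames P) (onames Q)
  | OFor x a P => maxn x (maxn (names a) (onames P))
  end.

Fixpoint oscratch (O : oprog) : nat :=
  match O with
  | Out e => scratch e
  | OSeq P Q => maxn (oscratch P) (oscratch Q)
  | OFor x a P => (maxn (scratch a) (oscratch P)).+2
  end.

Section OutputCompiler.
Variables (X : Type) (N Sc : nat).

Notation repr w := (@repr X N Sc w).
Notation tapeix := (tapeix X N Sc).

Fixpoint compO (O : oprog) (b : nat) : frag tapeix :=
  match O with
  | Out e => fseq (comp X N Sc e b) (fseq (append X N Sc (inr b)) (clear X N Sc (inr b)))
  | OSeq P Q => fseq (compO P b) (compO Q b)
  | OFor x a P =>
      fseq (comp X N Sc a b) (fseq (mv X N Sc (inl x) (inr b.+1)) (fseq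
        (loop (inr b) (fseq (dec X N Sc (inr b)) (fseq (compO P b.+2) (inc X N Sc (inl x)))))
        (fseq (clear X N Sc (inl x)) (mv X N Sc (inr b.+1) (inl x)))))
  end.

(** Unlike for expressions, register [b] itself must be zero at the start: it receives an
    intermediate value that is tested or counted down. *)
Definition compO_spec O := exists2 f, polyb f & forall w M b g o,
  onames O <= N -> b + oscratch O <= Sc -> (forall b', b <= b' -> g (inr b') = 0) ->
  (forall x, g (inl x) <= M) ->
  size (out w (envr g) O) <= f M /\
  hoare (compO O b) (repr w 0 g o) (f M) (repr w 0 g (o ++ out w (envr g) O)).

Lemma compO_ok O : compO_spec O.
Proof.
elim: O => [e|P [fp pp hp] Q [fq pq hq]|x a P [fp pp hp]].
- have [f pf hf] := comp_ok X N Sc e.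
  exists (fun M => (f M + (1 + (f M * 3).+1).+1).+1); first by solve_polyb.
  move=> w M b g o /= hn hb hg hM; have vb : valid N Sc (inr b) by rewrite /=; lia.
  have [va ka] := hf w M b g o hn hb (fun b' h => hg b' (ltnW h)) hM.
  rewrite (hg b (leqnn b)) add0n in ka; set A := eval _ _ _ in va ka *.
  have k2 := @happend X N Sc w (inr b) 0 (updf g (inr b) A) o vb.
  have k3 := @hclear X N Sc w (inr b) 0 (updf g (inr b) A) (rcons o (0 < A)) vb.
  split=> //; rewrite cats1; rewrite [updf g (inr b) A (inr b)]/updf eqxx in k2 k3.
  apply: hoare_le (hoare_eq (hseq ka (hseq k2 k3)) _) _; last by lia.
  by have h := hg b (leqnn b); reg_ext.
- exists (fun M => (fp M + fq M).+1); first by solve_polyb.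
  move=> w M b g o /=; rewrite geq_max => /andP[np nq] hb hg hM.
  have [sp kp] := hp w M b g o np ltac:(lia) hg hM.
  have [sq kq] := hq w M b g (o ++ out w (envr g) P) nq ltac:(lia) hg hM.
  by split; [rewrite size_cat; lia | rewrite catA; exact: hseq kp kq].
- have [fa pa ha] := comp_ok X N Sc a; pose M' M := M + fa M.
  have pM : polyb M' by apply: polyb_add => //; exact: polyb_id.
  have pp' := polyb_comp pp pM.
  exists (fun M => (fa M + ((M * 5).+1 + ((fa M * (1 + (fp (M' M) + 1).+1).+3).+1 +
     ((fa M * 3).+1 + (M * 5).+1).+1).+1).+1).+1); first by solve_polyb.
  move=> w M b g o /=; rewrite !geq_max => /and3P[nx na np] hb hg hM.
  have v0 : valid N Sc (inr b) by rewrite /=; lia.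
  have v1 : valid N Sc (inr b.+1) by rewrite /=; lia.
  have vx : valid N Sc (inl x) by [].
  have [va ka] := ha w M b g o na ltac:(lia) (fun b' h => hg b' (ltnW h)) hM.
  set A := eval w (envr g) a in va ka *.
  have g0 := hg b (leqnn _); have g1 := hg b.+1 (leqW (leqnn _)).
  have hMx := hM x; rewrite g0 add0n in ka.
  pose V v := out w (upd (envr g) x v) P.
  have Vle v : v < A -> size (V v) <= fp (M' M).
    move=> hv; have := hp w (M' M) b.+2 (updf g (inl x) v) o np ltac:(lia).
    rewrite envr_inl => /(_ _ _)[] // => [b' hb'|y]; first by rewrite /updf; simp_reg; apply: hg; lia.
    rewrite /updf /M'; simp_reg; case: eqP => _; first by lia.
    exact: leq_trans (hM y) (leq_addr _ _).
  split.
    have h3 : A * (1 + (fp (M' M) + 1).+1).+3 <= fa M * (1 + (fp (M' M) + 1).+1).+3.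
      by rewrite leq_mul2r va orbT.
    suff : size (flatten [seq V v | v <- iota 0 A]) <= A * fp (M' M).
      by rewrite /V; have := leq_mul va (leqnn (fp (M' M))); lia.
    rewrite size_flatten /shape -map_comp sumnE big_map -[X in X * _](size_iota 0).
    rewrite -sum1_size big_distrl /= big_seq [leqRHS]big_seq; apply: leq_sum => v.
    by rewrite mem_iota mul1n; exact: Vle.
  pose G j := updf (updf (updf g (inr b) (A - j)) (inr b.+1) (g (inl x))) (inl x) j.
  pose O j := o ++ flatten [seq V v | v <- iota 0 j].
  have k2 := @hmv X N Sc w (inl x) (inr b.+1) 0 (updf g (inr b) A) o vx v1 isT.
  have k3 : hoare (loop (inr b) (fseq (dec X N Sc (inr b)) (fseq (compO P b.+2) (inc X N Sc (inl x)))))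
      (repr w 0 (G 0) (O 0)) (A * (1 + (fp (M' M) + 1).+1).+3).+1 (repr w 0 (G A) (O A)).
    apply: (@hloop _ _ _ w _ _ (fun _ => 0)) => //.
    + by move=> j hj; rewrite /G /updf; simp_reg; do 3 (case: eqP => ? //; try lia).
    + by rewrite /G /updf; simp_reg; do 3 (case: eqP => ? //; try lia).
    + move=> j hj; apply: hseq (hdec v0) _.
      set gj := updf (G j) _ _.
      have ej : envr gj = upd (envr g) x j by apply: functional_extensionality.
      have hgj b' : b.+2 <= b' -> gj (inr b') = 0.
        move=> hb'; rewrite /gj /G /updf; simp_reg.
        by repeat (case: eqP => ?; try lia); apply: hg; lia.
      have hMj y : gj (inl y) <= M' M.
        rewrite /gj /G /updf /M'; simp_reg; case: eqP => _; first by lia.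
        exact: leq_trans (hM y) (leq_addr _ _).
      have [_ kp] := hp w (M' M) b.+2 gj (O j) np ltac:(lia) hgj hMj.
      rewrite ej in kp.
      have -> : O j.+1 = O j ++ out w (upd (envr g) x j) P.
        by rewrite /O -addn1 iotaD map_cat flatten_cat /= cats0 catA.
      apply: hseq kp _; apply: hoare_eq (hinc vx) _.
      by rewrite /gj /G; reg_ext.
  have k4 := @hclear X N Sc w (inl x) 0 (G A) (O A) vx.
  have k5 := @hmv X N Sc w (inr b.+1) (inl x) 0 (updf (G A) (inl x) 0) (O A) v1 vx isT.
  have e0 : updf (updf (updf g (inr b) A) (inl x) 0) (inr b.+1)
      (updf g (inr b) A (inr b.+1) + updf g (inr b) A (inl x)) =1 G 0.
    by rewrite /G; reg_ext.
  have {}k3 := hseq k3 (hseq k4 k5).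
  have k2' : hoare (mv X N Sc (inl x) (inr b.+1)) (repr w 0 (updf g (inr b) A) o)
      (updf g (inr b) A (inl x) * 5).+1 (repr w 0 (G 0) (O 0)).
    by rewrite /O cats0; exact: hoare_eq k2 e0.
  apply: hoare_le (hoare_eq (hseq ka (hseq k2' k3)) _) _.
    by rewrite /G; reg_ext.
  have h3 : A * (1 + (fp (M' M) + 1).+1).+3 <= fa M * (1 + (fp (M' M) + 1).+1).+3.
    by rewrite leq_mul2r va orbT.
  rewrite /G /updf; simp_reg; rewrite eqxx.
  by repeat (case: eqP => ?; try lia); move: (g (inl x)) hMx => gx hMx; lia.
Qed.

End OutputCompiler.

(** * The complete machine *)

(** The position just behind the prefix is included, because the blank found there ends the copying
    loop. *)
Lemma bit_prefix_nth r j : j <= size (bit_prefix r) ->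
  nth None r j = nth None (map Some (bit_prefix r)) j.
Proof.
elim: r j => [|[b|] r IHr] [|j] //= h; rewrite ?nth_nil //; exact: IHr.
Qed.

Lemma bit_prefix_eq r w :
  (forall j, nth None r j = nth None (map Some w) j) -> bit_prefix r = w.
Proof.
elim: w r => [|b w IHw] [|c r] h //=.
- by have /= -> := h 0.
- by have := h 0.
- have /= -> := h 0; congr cons; apply: IHw => j; exact: (h j.+1).
Qed.

Lemma size_bit_prefix r : size (bit_prefix r) <= size r.
Proof. by elim: r => //= -[b|] r. Qed.

Definition blank_tape : tape := ([::], [::]).

Section Machine.
Variables (M : TM) (N Sc : nat).

Notation X := 'I_(tapes M).+1.
Notation tapeix := (tapeix X N Sc).

Definition sim : frag tapeix :=
  @Frag tapeix (state M) (start M) (@halting M)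
    (fun q rd => let: (q', act) := delta q (fun i => rd (inl i)) in
       (q', fun i => match i with inl j => act j | inr _ => keep (rd i) end)).

Definition init_tapes (u : seq bool) : tapeix -> tape :=
  fun i => if i is inl j then (init M u).2 j else blank_tape.

Lemma sim_step n u q T : iter n (@fstep _ sim) (start M, init_tapes u) = (q, T) ->
  iter n (@step M) (init M u) = (q, fun j => T (inl j)) /\
  forall j, tape_at (fun _ => None) 0 (T (inr j)).
Proof.
elim: n q T => [|n IHn] q T /=.
  by case=> <- <-; split=> // j; split=> i; rewrite nth_nil.
case E: (iter n (@fstep _ sim) (start M, init_tapes u)) => [q1 T1]; have [-> hT] := IHn _ _ E.
rewrite /fstep /step /=; case: ifP => _; first by case=> <- <-.
case: delta => q' act [<- <-]; split=> // j.
exact: tape_at_keep.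
Qed.

(** Only the cells up to the first blank are described: the output convention says nothing about
    what lies behind it or to the left of the head. *)
Definition src (w : seq bool) (j : nat) (T : tapeix -> tape) : Prop :=
  forall i, i + j <= size w -> nth None (T (inl ord_max)).2 i = nth None (map Some w) (j + i).

Lemma src_rewr w j T : src w j T -> src w j (rewr T).
Proof.
move=> h i hi; rewrite -h // /rewr /act_tape /= /tape_read.
by case: (T _).2 i {hi} => [|c r] [|i] //=; rewrite nth_nil.
Qed.

Definition simulated (w : seq bool) (T : tapeix -> tape) : Prop :=
  src w 0 T /\ forall j, tape_at (fun _ => None) 0 (T (inr j)).

Lemma simulated_rewr w T : simulated w T -> simulated w (rewr T).
Proof. by case=> /src_rewr h1 h2; split=> // j; exact: tape_at_keep. Qed.

Lemma hsim u t w : computes_within M u t w ->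
  hoare sim (fun T => T = init_tapes u) t (simulated w).
Proof.
move=> [hh ho] _ ->; case E: (iter t (@fstep _ sim) (start M, init_tapes u)) => [q T].
have [e hT] := sim_step E; exists t, T; split=> //.
  by exists q; split=> //; move: hh; rewrite e.
split=> // i; rewrite addn0 add0n -ho e => hi.
exact: bit_prefix_nth.
Qed.

Definition setup : frag tapeix :=
  prim (inl ord0) (fun _ i c =>
    match i with
    | inl _ => keep c
    | inr (Some (Some _)) => (Some true, Stay)
    | inr _ => (c, MoveR)
    end).

(** Variable 0 counts the copied bits and thus ends up as the length of the word. *)
Definition copied (w : seq bool) (j : nat) (T : tapeix -> tape) : Prop :=
  src w j T /\
  repr (take j w) j (updf (fun _ => 0) (inl 0) j) [::] T.

Lemma copied_rewr w j T : copied w j T -> copied w j (rewr T).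
Proof. by case=> /src_rewr h1 /repr_rewr h2. Qed.

Lemma hsetup w : hoare setup (simulated w) 1 (copied w 0).
Proof.
apply: hoare_prim => T [h1 h2]; split; first exact: src_rewr h1.
rewrite take0; split=> [||i].
- by apply: tape_at_ext (tape_at_go (h2 _) _) => //; case=> // j; rewrite /= nth_nil.
- by apply: tape_at_ext (tape_at_go (h2 _) _) => //; case=> // j; rewrite /= nth_nil.
- have -> : updf (fun _ => 0) (inl 0) 0 (ixreg i) = 0 by rewrite /updf; case: ifP.
  by apply: tape_at_ext (@tape_at_act _ _ _ _ Stay _ (h2 _) _) => //; case.
Qed.

Definition copy_step : frag tapeix :=
  prim (inl ord_max) (fun c0 i c =>
    match i with
    | inl j => if j == ord_max then (c, MoveR) else keep c
    | inr (Some None) => (c0, MoveR)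
    | inr j => if j == regix N Sc (inl 0) then (c, MoveR) else keep c
    end).

Lemma hcopy_step w j : j < size w -> hoare copy_step (copied w j) 1 (copied w j.+1).
Proof.
move=> hj; apply: hoare_prim => T [h1 [h2 h3 h4]]; split.
  move=> i hi; rewrite eqxx addSnnS -h1; last by lia.
  by rewrite /= nth_behead.
have e : tape_read (T (inl ord_max)) = Some (nth false w j).
  by rewrite /tape_read -nth0 h1 ?add0n ?(ltnW hj) // addn0 (nth_map false).
split=> [||i].
- rewrite e; have -> : take j.+1 w = rcons (take j w) (nth false w j) by rewrite (take_nth false).
  apply: tape_at_ext (tape_at_act (m := MoveR) (p' := j.+2) _ h2 _) => //.
  by have := word_cells_rcons (take j w) (nth false w j); rewrite size_take hj.
- exact: tape_at_keep.
- have v0 : valid N Sc (inl 0) by [].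
  rewrite (regixE i v0) /updf; move: (h4 i); rewrite /updf; case: eqP => _ h; last exact: tape_at_keep.
  exact: (tape_at_go h).
Qed.

Definition copy : frag tapeix := fwhile (inl ord_max) (fun c => c != None) copy_step.

Lemma hcopy w : hoare copy (copied w 0) (size w * 3).+1 (copied w (size w)).
Proof.
apply: hoare_fwhile => [j T _|j T hj [h _]|T [h _]|j hj].
- exact: copied_rewr.
- by rewrite /tape_read -nth0 h ?(nth_map false) ?addn0 //; lia.
- by rewrite /tape_read -nth0 h // addn0 nth_default // size_map.
- exact: hcopy_step.
Qed.

Definition tape_step (i0 : aux N Sc) (m : move) : frag tapeix :=
  prim (inr i0) (fun _ i c => if is_aux i0 i then (c, m) else keep c).

(** The separate first move leaves the blank behind the word, on which the loop would stop at
    once. *)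
Definition rewind (i0 : aux N Sc) : frag tapeix :=
  fseq (tape_step i0 MoveL) (fseq (fwhile (inr i0) (fun c => c != None) (tape_step i0 MoveL))
    (tape_step i0 MoveR)).

Definition at_pos (i0 : aux N Sc) u p (P : aux N Sc -> tape -> Prop) (T : tapeix -> tape) :=
  tape_at (word_cells u) p (T (inr i0)) /\
  forall j, j != i0 -> P j (T (inr j)).

Section Rewind.
Variables (i0 : aux N Sc) (u : seq bool) (P : aux N Sc -> tape -> Prop).
Hypothesis hP : forall j tp, P j tp -> P j (act_tape (keep (tape_read tp)) tp).

Lemma at_pos_rewr p T : at_pos i0 u p P T -> at_pos i0 u p P (rewr T).
Proof. by case=> h1 h2; split=> [|j /h2 h]; [exact: tape_at_keep | exact: hP]. Qed.

Lemma htape_stepL p : hoare (tape_step i0 MoveL) (at_pos i0 u p.+1 P) 1 (at_pos i0 u p P).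
Proof.
apply: hoare_prim => T [h1 h2]; split=> [|j hj]; rewrite /is_aux ?eqxx.
  exact: (tape_at_go h1).
by rewrite (negbTE hj); apply: hP; exact: h2.
Qed.

Lemma htape_stepR p : hoare (tape_step i0 MoveR) (at_pos i0 u p P) 1 (at_pos i0 u p.+1 P).
Proof.
apply: hoare_prim => T [h1 h2]; split=> [|j hj]; rewrite /is_aux ?eqxx.
  exact: (tape_at_go h1).
by rewrite (negbTE hj); apply: hP; exact: h2.
Qed.

Lemma hrewind : hoare (rewind i0) (at_pos i0 u (size u).+1 P) (size u * 3 + 5)
  (at_pos i0 u 1 P).
Proof.
have k : hoare (fwhile (inr i0) (fun c => c != None) (tape_step i0 MoveL))
    (at_pos i0 u (size u) P) (size u * 3).+1 (at_pos i0 u 0 P).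
  have := @hoare_fwhile _ (inr i0) (fun c => c != None) (tape_step i0 MoveL)
    (fun j => at_pos i0 u (size u - j) P) (size u) 1.
  rewrite subn0 subnn; apply=> [j T _|j T hj [h _]|T [h _]|j hj].
  - exact: at_pos_rewr.
  - rewrite (tape_at_read h); have -> : size u - j = (size u - j.+1).+1 by lia.
    by rewrite /= (nth_map false) //; lia.
  - by rewrite (tape_at_read h).
  - have -> : size u - j = (size u - j.+1).+1 by lia.
    exact: htape_stepL.
have k2 := hoare_fseq k (@at_pos_rewr 0) (@htape_stepR 0).
have k3 := hoare_fseq (@htape_stepL (size u)) (@at_pos_rewr _) k2.
by apply: hoare_le k3 _; lia.
Qed.

End Rewind.

(** The last rewinding is due to the output convention, which reads from the head onwards. *)
Definition machine (O : oprog) : frag tapeix :=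
  fseq sim (fseq setup (fseq copy (fseq (rewind (Some None))
    (fseq (compO X N Sc O 0) (rewind None))))).

(** A step lengthens the right half of a tape by at most two cells: one by writing on an empty half,
    one by moving left. *)
Lemma size_output u t : size (output (iter t (@step M) (init M u))) <= size u + t * 2.
Proof.
apply: leq_trans (size_bit_prefix _) _; move: ord_max.
elim: t => [|t IHt] i /=.
  by rewrite /init /=; case: eqP => //= _; rewrite size_map addn0.
rewrite /step; case: ifP => _; first by apply: leq_trans (IHt i) _; lia.
case: delta => q act /=; have := IHt i; case: ((iter t _ _).2 i) => l r /=.
by case: (act i).2 => /=; rewrite ?size_behead /=; lia.
Qed.

(** The length of the intermediate word [w] is linear in [size u + t], and it is the only nonzero
    variable when the program starts; the polynomial of the compiled program can therefore be taken
    at that bound. *)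
Lemma machine_ok O : onames O <= N -> oscratch O <= Sc ->
  exists2 f, polyb f & forall u t w, computes_within M u t w ->
    hoare (machine O) (fun T => T = init_tapes u) (f (size u + t))
      (fun T => tape_at (word_cells (out w (upd (fun _ => 0) 0 (size w)) O)) 1 (T (inr None))).
Proof.
move=> hN hSc; have [f pf hf] := compO_ok X N Sc O; pose F m :=
  (m + (1 + ((m * 3).+1 + ((m * 3 + 5) + (f m + (f m * 3 + 5)).+1).+1).+1).+1).+1.
have pF : polyb F by rewrite /F; solve_polyb.
have p2 : polyb (fun m => m * 2) by apply: polyb_mul; [exact: polyb_id | exact: polyb_const].
exists (fun m => F (m * 2)); first exact: (polyb_comp pF p2).
move=> u t w hc; set m := (size u + t) * 2.
have hw : size w <= m by have := size_output u t; rewrite (proj2 hc) /m; lia.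
have ht : t <= m by rewrite /m; lia.
pose g1 := updf (fun _ : reg => 0) (inl 0) (size w).
have e1 : envr g1 = upd (fun _ => 0) 0 (size w) by apply: functional_extensionality.
have [so ko] := hf w m 0 g1 [::] hN hSc (fun _ _ => erefl) (fun x => ltac:(by rewrite /g1 /updf; case: eqP)).
rewrite e1 /= in so ko; set o := out w _ O in so ko *.
pose P1 (j : aux N Sc) tp := match j with
  | None => tape_at (word_cells [::]) 1 tp
  | Some (Some i) => tape_at counter_cells (g1 (ixreg i)) tp
  | _ => True end.
have hP1 j tp : P1 j tp -> P1 j (act_tape (keep (tape_read tp)) tp).
  by case: j => [[i|]|] //= h; exact: tape_at_keep.
have r1 T : repr w 0 g1 o T -> at_pos None o (size o).+1 (fun _ _ => True) T.
  by case.
have k1 := hoare_weaken r1 (fun T h => proj1 h) (leqnn _)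
  (@hrewind None o (fun _ _ => True) (fun _ _ _ => I)).
have r2 T : at_pos (Some None) w 1 P1 T -> repr w 0 g1 [::] T.
  by case=> h1 h2; split=> //; [exact: (h2 None) | move=> i; exact: (h2 (Some (Some i)))].
have r3 T : copied w (size w) T -> at_pos (Some None) w (size w).+1 P1 T.
  by case=> _ [h1 h2 h3]; rewrite take_size in h1; split=> // -[[i|]|] //= _; exact: h3.
have k2 := hoare_weaken r3 r2 (leqnn _) (@hrewind (Some None) w P1 hP1).
have k3 := hoare_fseq k2 (@repr_rewr _ N Sc w 0 g1 [::]) (hseq ko k1).
have k4 := hoare_fseq (@hcopy w) (@copied_rewr w (size w)) k3.
have k5 := hoare_fseq (hsetup (w := w)) (@copied_rewr w 0) k4.
apply: hoare_le (hoare_fseq (hsim hc) (@simulated_rewr w) k5) _.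
by rewrite /F; lia.
Qed.
End Machine.

(** * From named tapes to numbered tapes *)

Section ToTM.
Variables (I : Type) (t : nat) (enc : I -> 'I_t.+1) (dec : 'I_t.+1 -> I).
Hypothesis encK : cancel enc dec.

Definition to_TM (F : frag I) : TM :=
  @MkTM t (fstate F) (fstart F) (@fhalt _ F) (fun q rd =>
    let: (q', act) := fdelta q (fun i => rd (enc i)) in (q', fun j => act (dec j))).

Lemma to_TM_iter (F : frag I) n (q : fstate F) T :
  iter n (@step (to_TM F)) (q, fun j => T (dec j)) =
  let: (q', T') := iter n (@fstep _ F) (q, T) in (q', fun j => T' (dec j)).
Proof.
elim: n => //= n ->; case: (iter n (@fstep _ F) (q, T)) => q' T'.
rewrite /step /fstep /=; case: ifP => // _.
have -> : (fun i => tape_read (T' (dec (enc i)))) = fun i => tape_read (T' i).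
  by apply: functional_extensionality => i; rewrite encK.
by case: fdelta.
Qed.

Lemma to_TM_runs (F : frag I) T n t1 T' : runs F T n T' -> n <= t1 ->
  exists2 q, iter t1 (@step (to_TM F)) (fstart F, fun j => T (dec j)) =
    (q, fun j => T' (dec j)) & halting q.
Proof.
move=> [q [hr hq]] hn; exists q; last exact: hq.
rewrite -(subnK hn) iterD to_TM_iter hr.
by elim: (t1 - n) => //= k ->; rewrite /step ifT.
Qed.

End ToTM.

Section Conversion.
Variables (M : TM) (N Sc : nat).

Notation aux0 := (option ('I_N.+1 + 'I_Sc.+1))%type.
Notation I := (tapeix 'I_(tapes M).+1 N Sc).

Definition ntapes := tapes M + #|{: aux0}|.+1.

(** Both ends of the numbering matter: tape 0 must be the first tape of [M], which receives the
    input, and the last tape must be the output tape. *)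
Definition tape_enc (i : I) : 'I_ntapes.+1 :=
  match i with
  | inl j => lshift (#|{: aux0}|.+1) j
  | inr None => rshift (tapes M).+1 ord_max
  | inr (Some a) => rshift (tapes M).+1 (lift ord_max (enum_rank a))
  end.

Definition tape_dec (j : 'I_ntapes.+1) : I :=
  match @split (tapes M).+1 #|{: aux0}|.+1 j with
  | inl k => inl k
  | inr k => inr (omap enum_val (unlift ord_max k))
  end.

Lemma tape_encK : cancel tape_enc tape_dec.
Proof.
case=> [j|[a|]]; rewrite /tape_dec /tape_enc.
- by rewrite (unsplitK (inl j)).
- by rewrite (unsplitK (inr (lift ord_max (enum_rank a)))) liftK /= enum_rankK.
- by rewrite (unsplitK (inr ord_max)) unlift_none.
Qed.

Lemma tape_dec0 : tape_dec ord0 = inl ord0.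
Proof.
have -> : ord0 = tape_enc (inl ord0) by exact: val_inj.
exact: tape_encK.
Qed.

Lemma tape_dec_max : tape_dec ord_max = inr None.
Proof.
have -> : ord_max = tape_enc (inr None) by apply: val_inj; rewrite /= /ntapes addnS addSn.
exact: tape_encK.
Qed.

Lemma tape_dec_neq0 j : j != ord0 -> tape_dec j != inl ord0 :> (_ + _)%type.
Proof.
apply: contra => /eqP; rewrite /tape_dec; case: split_ordP => k -> // [->].
by apply/eqP/val_inj.
Qed.

Lemma compile_machine O : onames O <= N -> oscratch O <= Sc ->
  exists M' f, polyb f /\ forall u t w, computes_within M u t w ->
    computes_within M' u (f (size u + t)) (out w (upd (fun _ => 0) 0 (size w)) O).
Proof.
move=> hN hSc; have [f pf hf] := @machine_ok M N Sc O hN hSc.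
exists (to_TM tape_enc tape_dec (@machine M N Sc O)), f; split=> // u t w hc.
have [n [T' [hn hr hT]]] := hf u t w hc _ erefl.
have [q hq hh] := to_TM_runs tape_encK hr hn.
have e0 : init (to_TM tape_enc tape_dec (machine M N Sc O)) u =
    (fstart (machine M N Sc O), fun j => init_tapes u (tape_dec j)).
  congr pair; apply: functional_extensionality => j.
  case: eqP => [->|/eqP/tape_dec_neq0]; first by rewrite tape_dec0 /=.
  by case: (tape_dec j) => [k|k] //= hk; case: eqP => // e; rewrite e eqxx in hk.
rewrite /computes_within e0 hq; split; first exact: hh.
apply: bit_prefix_eq => j; have [h _] := hT; have := h j.
by rewrite -tape_dec_max add1n.
Qed.

End Conversion.

(** * Closure of the recursive functions under polynomial expressions *)

Lemma recursive_const n c : recursive (fun _ : n.-tuple nat => c).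
Proof.
elim: c => [|c IHc]; first exact: rec_zero.
apply: rec_eq (rec_comp rec_succ (fun _ : 'I_1 => IHc)) _ => v.
by rewrite /thead tnth_mktuple.
Qed.

Lemma recursive1 n (f : nat -> nat) (g : n.-tuple nat -> nat) :
  computable f -> recursive g -> recursive (fun v => f (g v)).
Proof.
move=> hf hg; apply: rec_eq (rec_comp hf (fun _ : 'I_1 => hg)) _ => v.
by rewrite /thead tnth_mktuple.
Qed.

Lemma recursive2 n (f : nat -> nat -> nat) (g h : n.-tuple nat -> nat) :
  recursive (fun v : 2.-tuple nat => f (tnth v ord0) (tnth v ord_max)) ->
  recursive g -> recursive h -> recursive (fun v => f (g v) (h v)).
Proof.
move=> hf hg hh; pose F (i : 'I_2) := if i == ord0 then g else h.
have hF i : recursive (F i) by rewrite /F; case: ifP.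
by apply: rec_eq (rec_comp hf hF) _ => v; rewrite !tnth_mktuple /F.
Qed.

Lemma recursive_add n (g h : n.-tuple nat -> nat) :
  recursive g -> recursive h -> recursive (fun v => g v + h v).
Proof.
apply: recursive2.
have hs : recursive (fun v : 3.-tuple nat => (tnth v (inord 1)).+1).
  exact: (@recursive1 3 succn) rec_succ (rec_proj _).
apply: rec_eq (rec_prec (rec_proj (@ord0 0)) hs) _ => v.
rewrite -[in RHS]/(thead v) /=.
have -> : tnth [tuple of behead v] ord0 = tnth v ord_max.
  by rewrite !(tnth_nth 0) /= nth_behead.
elim: (thead v) => //= k ->.
by rewrite !(tnth_nth 0) /= inordK.
Qed.

Lemma recursive_mul n (g h : n.-tuple nat -> nat) :
  recursive g -> recursive h -> recursive (fun v => g v * h v).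
Proof.
apply: recursive2.
have hs : recursive (fun v : 3.-tuple nat => tnth v (inord 2) + tnth v (inord 1)).
  by apply: recursive_add; exact: rec_proj.
apply: rec_eq (rec_prec (rec_zero 1) hs) _ => v.
rewrite -[in RHS]/(thead v) /=.
elim: (thead v) => //= k ->; rewrite mulSn; congr (_ + _).
  by rewrite !(tnth_nth 0) /= inordK //= nth_behead.
by rewrite !(tnth_nth 0) /= inordK.
Qed.

Lemma recursive_exp n (g : n.-tuple nat -> nat) d :
  recursive g -> recursive (fun v => g v ^ d).
Proof.
move=> hg; elim: d => [|d IHd]; first exact: recursive_const.
by apply: rec_eq (recursive_mul hg IHd) _ => v; rewrite expnS.
Qed.

Lemma computable_shift_exp f c d : computable f -> computable (fun k => (f k + c) ^ d).
Proof.
by move=> hf; apply: recursive_exp; apply: recursive_add => //; exact: recursive_const.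
Qed.

(** * Composing an fpt-reduction with an output program *)

Definition produces (O : oprog) (red : seq bool -> nat -> seq bool) (D : nat) : Prop :=
  forall x k, let w := instance x k in
  out w (upd (fun _ => 0) 0 (size w)) O = instance (red x k) ((k + 2) ^ D).

(** The compiled machine simulates the given reduction and runs [O] on its result. A polynomial of
    an fpt time bound is again one, and a parameter bounded by [g k] becomes one bounded by
    [(g k + 2) ^ D]. *)
Lemma fpt_trans_oprog (P Q R : pproblem) O red D :
  fpt_reducible P Q -> produces O red D ->
  (forall x k, Q x k <-> R (red x k) ((k + 2) ^ D)) ->
  fpt_reducible P R.
Proof.
move=> [red1 [par1 [M [f [g [c [hf hg h1 h2 h3]]]]]]] hO hQR.
have [M' [F [[d hF] hM']]] := @compile_machine M _ _ O (leqnn _) (leqnn _).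
exists (fun x k => red (red1 x k) (par1 x k)), (fun x k => (par1 x k + 2) ^ D), M'.
exists (fun k => (f k + 3) ^ d), (fun k => (g k + 2) ^ D), (c.+1 * d); split.
- exact: computable_shift_exp.
- exact: computable_shift_exp.
- by move=> x k; rewrite h1 hQR.
- move=> x k; case: D {hO hQR} => // D; rewrite leq_exp2r //; have := h2 x k; lia.
- move=> x k; rewrite -hO; set s := size (instance x k).
  have [hh ho] := hM' _ _ _ (h3 x k); rewrite -/s in hh ho.
  (* Since [s] is positive, s + f k * s^c + 2 <= (f k + 3) * s^(c+1); the d-th power of this bounds
     the time. *)
  set t0 := F _ in hh ho; have ht : t0 <= (f k + 3) ^ d * s ^ (c.+1 * d).
    apply: leq_trans (hF _) _; rewrite expnM -expnMn.
    case: d {hF} => // d; rewrite leq_exp2r //.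
    have s0 : 0 < s by rewrite /s /instance size_cat /=; lia.
    have : 0 < s ^ c by rewrite expn_gt0 s0.
    by rewrite expnS; nia.
  rewrite /computes_within -(subnK ht) iterD; set c0 := iter t0 _ _ in hh ho *.
  (* A halted configuration is a fixed point, so the remaining steps of the time bound are idle. *)
  have itc j : iter j (@step M') c0 = c0 by elim: j => //= j ->; rewrite /step hh.
  by rewrite itc.
Qed.

(** * Digits *)

Definition dig (B e j : nat) : nat := e %/ B ^ j %% B.

Fixpoint num (B m : nat) (a : nat -> nat) : nat :=
  if m is m'.+1 then a 0 + B * num B m' (fun j => a j.+1) else 0.

Lemma eq_num B m a a' : a =1 a' -> num B m a = num B m a'.
Proof. by elim: m a a' => //= m IHm a a' h; rewrite h (IHm _ (fun j => a' j.+1)). Qed.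

Lemma num_lt B m a : 0 < B -> (forall j, j < m -> a j < B) -> num B m a < B ^ m.
Proof.
move=> hB; elim: m a => [|m IHm] a ha //=; rewrite expnS.
have h0 := ha 0 isT; have := IHm (fun j => a j.+1) (fun j => ha j.+1).
by nia.
Qed.

Lemma dig_num B m a j : (forall j, j < m -> a j < B) -> j < m -> dig B (num B m a) j = a j.
Proof.
rewrite /dig; elim: m a j => [|m IHm] a j ha //= hj; have h0 := ha 0 isT.
have hB : 0 < B by lia.
rewrite mulnC; case: j hj => [|j] hj.
  by rewrite expn0 divn1 addnC modnMDl modn_small.
rewrite expnS divnMA [a 0 + _]addnC divnMDl // [a 0 %/ B]divn_small // addn0.
by rewrite IHm // => i; exact: (ha i.+1).
Qed.

Lemma num_dig B m e : e < B ^ m -> num B m (dig B e) = e.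
Proof.
elim: m e => [|m IHm] e /=; first by rewrite expn0; case: e.
rewrite expnS => he; have hB : 0 < B by case: posnP he => // ->; rewrite mul0n.
have -> : num B m (fun j => dig B e j.+1) = num B m (dig B (e %/ B)).
  by apply: eq_num => j; rewrite /dig expnS divnMA.
rewrite IHm; first by rewrite /dig expn0 divn1 mulnC addnC -divn_eq.
by rewrite ltn_divLR // mulnC.
Qed.

Lemma dig_lt B e j : 0 < B -> dig B e j < B.
Proof. by move=> hB; rewrite /dig ltn_pmod. Qed.

(** * The combinatorial core *)

(* An element has digits Z: indices Z l <= k + 1 and values Z (D + l) for l < D,
   standing for s (Z l) = Z (D + l).  A clause has digits Y: a tag Y 0, then either
   the indices Y 1, ..., Y D of a block, followed for the consistency clauses by a
   value, or values of the universally quantified variables. *)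
Section Core.
Variables (k N n D B m q a b : nat).
Variable Mx : (nat -> nat) -> seq nat -> seq nat -> Prop.
Hypotheses (hD : 1 < D) (hq : q.+1 = B ^ m) (hBk : k.+1 < B) (hBN : N.+1 < B)
  (hBn : n < B) (hBD : D.+1 < B) (hmD : D.*2 <= m) (hmD2 : D.+2 <= m) (hma : a < m).

(** Ordering only the first two pairs suffices, because any indices i < j occupy these two places in
    some block. The other conditions fix the sentinels at the indices 0 and k + 1. *)
Definition ok (Z : nat -> nat) : Prop :=
  (forall l, l < D -> [/\ Z l <= k.+1, Z l = 0 -> Z (D + l) = 0
                        & Z l = k.+1 -> Z (D + l) = N.+1]) /\
  (Z 0 < Z 1 -> Z D < Z D.+1).

(** Every number below [B ^ m] acts as a clause. This guard turns those with illegal indices into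
    clauses that all admissible elements hit. *)
Definition range_idx (Y : nat -> nat) : Prop := forall l, l < D -> Y l.+1 <= k.+1.

Definition block_cl (Y Z : nat -> nat) : Prop :=
  range_idx Y -> forall l, l < D -> Z l = Y l.+1.

(* In the block of indices Y 1, ..., Y D, the chosen element has at place l the value
   that the block with constant index Y (l + 1) has at place 0. *)
Definition cons_cl (l : nat) (Y Z : nat -> nat) : Prop :=
  range_idx Y ->
  ((forall j, j < D -> Z j = Y j.+1) /\ Z (D + l) <> Y D.+1) \/
  ((forall j, j < D -> Z j = Y l.+1) /\ Z D = Y D.+1).

Definition tuple_le (c : nat) (vs : seq nat) : bool := (size vs == c) && all (fun v => v <= n) vs.

Definition main_cl (Y Z : nat -> nat) : Prop :=
  forall vs, tuple_le a vs -> (forall j, j < a -> nth 0 vs j = Y j.+1) ->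
  exists2 us, tuple_le b us & Mx Z vs us.

Definition clause (Y Z : nat -> nat) : Prop :=
  [\/ Y 0 = 0 /\ block_cl Y Z,
      exists2 l, l < D & Y 0 = l.+1 /\ cons_cl l Y Z
    | D < Y 0 /\ main_cl Y Z].

Definition hits (y e : nat) : Prop := ok (dig B e) /\ clause (dig B y) (dig B e).

Definition listing (s : nat -> nat) : Prop :=
  [/\ s 0 = 0, s k.+1 = N.+1 & forall i j, i < j -> j <= k.+1 -> s i < s j].

Definition truthful (s Z : nat -> nat) : Prop :=
  forall l, l < D -> Z l <= k.+1 /\ Z (D + l) = s (Z l).

Lemma listing_le s i : listing s -> i <= k.+1 -> s i <= N.+1.
Proof.
case=> _ <- hs; rewrite leq_eqVlt => /orP[/eqP -> // | hi].
by apply: ltnW; exact: hs.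
Qed.

Let B0 : 0 < B. Proof. lia. Qed.

Lemma digs_ex (f : nat -> nat) : (forall j, j < m -> f j < B) ->
  exists y : 'I_q.+1, forall j, j < m -> dig B y j = f j.
Proof.
move=> hf; have h := num_lt B0 hf; rewrite -hq in h.
by exists (Ordinal h) => j hj; exact: dig_num.
Qed.

(** Each block contributes the element that carries the values of [s] at its indices; for every
    clause some block then supplies a hitting element. *)
Lemma hitting_set_of_listing s : listing s ->
  (forall vs, tuple_le a vs -> exists2 us, tuple_le b us &
     exists2 h : nat -> nat, (forall l, h l <= k.+1) &
       forall Z, (forall l, l < D -> Z l = h l /\ Z (D + l) = s (h l)) -> Mx Z vs us) ->
  exists2 T : {set 'I_q.+1}, #|T| = k.+2 ^ D &
    forall y : 'I_q.+1, exists2 e : 'I_q.+1, e \in T & hits y e.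
Proof.
move=> hs hM; have [s0 s1 smono] := hs.
(* Digits from [D.*2] on are 0, so that each block supplies exactly one element and the size comes
   out right. *)
pose digits (h : {ffun 'I_D -> 'I_k.+2}) j :=
  let v i := if insub i is Some i' then val (h i') else 0 in
  if j < D then v j else if j < D.*2 then s (v (j - D)) else 0.
have vP (h : {ffun 'I_D -> 'I_k.+2}) i :
    (if insub i is Some i' then val (h i') else 0) <= k.+1.
  by case: insubP => /= [u _ _|_] //; rewrite -ltnS.
have digits_lt h j : digits h j < B.
  rewrite /digits; case: ifP => _; first by apply: leq_ltn_trans (vP _ _) _.
  case: ifP => _ //; apply: leq_ltn_trans hBN; exact: listing_le.
have elt h : {e : 'I_q.+1 | [forall j : 'I_m, dig B e j == digits h j]}.
  apply: sigW; have [e he] := digs_ex (fun j _ => digits_lt h j).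
  by exists e; apply/forallP => j; rewrite he.
pose el h := sval (elt h).
have el1 h (l : 'I_D) : dig B (el h) l = h l.
  rewrite /el; case: (elt h) => e /= /forallP he.
  have hl : l < m by have := ltn_ord l; lia.
  rewrite (eqP (he (Ordinal hl))) /= /digits ltn_ord.
  by case: insubP => [u _ /val_inj -> //|]; rewrite ltn_ord.
have el2 h (l : 'I_D) : dig B (el h) (D + l) = s (h l).
  rewrite /el; case: (elt h) => e /= /forallP he.
  have hl : D + l < m by have := ltn_ord l; lia.
  rewrite (eqP (he (Ordinal hl))) /= /digits.
  have -> : D + l < D = false by lia.
  have -> : D + l < D.*2 by have := ltn_ord l; lia.
  have -> : D + l - D = l by lia.
  by case: insubP => [u _ /val_inj -> //|]; rewrite ltn_ord.
have hok h : ok (dig B (el h)).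
  split=> [l hl|].
    have e1 := el1 h (Ordinal hl); have e2 := el2 h (Ordinal hl); rewrite /= in e1 e2.
    rewrite e1 e2; split; first by rewrite -ltnS.
      by move=> ->.
    by move=> ->.
  have hD0 : 0 < D by lia.
  have := el1 h (Ordinal hD0); have := el1 h (Ordinal hD); rewrite /= => -> ->.
  have := el2 h (Ordinal hD0); have := el2 h (Ordinal hD); rewrite /= addn0 addn1 => -> -> hlt.
  by apply: smono => //; rewrite -ltnS.
have exh (f : nat -> nat) : (forall l, l < D -> f l <= k.+1) ->
    exists h, forall l, l < D -> dig B (el h) l = f l /\ dig B (el h) (D + l) = s (f l).
  move=> hf; exists [ffun l : 'I_D => inord (f l)] => l hl.
  have := el1 [ffun l : 'I_D => inord (f l)] (Ordinal hl).
  have := el2 [ffun l : 'I_D => inord (f l)] (Ordinal hl).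
  by rewrite ffunE /= inordK ?ltnS ?hf // => -> ->.
have el_inj : injective el.
  move=> h h' e; apply/ffunP => l; apply: val_inj; rewrite /= -!el1 e; done.
exists [set el h | h in [set: {ffun 'I_D -> 'I_k.+2}]].
  by rewrite card_imset // cardsT card_ffun !card_ord.
move=> y; have inT h : el h \in [set el h | h in [set: {ffun 'I_D -> 'I_k.+2}]].
  by apply: imset_f; rewrite inE.
pose Y := dig B y.
suff [h hc] : exists h, clause Y (dig B (el h)) by exists (el h).
have [Y0|] := posnP (Y 0).
  have [hr|hr] := boolP [forall l : 'I_D, Y l.+1 <= k.+1].
    have [h hh] := exh (fun l => Y l.+1) (fun l hl => forallP hr (Ordinal hl)).
    by exists h; constructor 1; split=> // _ l /hh [].
  (* The guard fails, so an arbitrary element hits the clause. *)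
  exists [ffun=> ord0]; constructor 1; split=> // hr'; case/negP: hr.
  by apply/forallP => l; exact: hr'.
have [hY _|hY hY0] := ltnP D (Y 0); last first.
  have [hr|hr] := boolP [forall l : 'I_D, Y l.+1 <= k.+1]; last first.
    exists [ffun=> ord0]; constructor 2; exists (Y 0).-1; first by lia.
    split; [lia | move=> hr'; case/negP: hr; apply/forallP => l; exact: hr'].
  have hl : (Y 0).-1 < D by lia.
  have hrl := forallP hr (Ordinal hl).
  (* If the value named in the clause is the true one, the element of the constant block hits;
     otherwise the element of the named block does, as its value differs. *)
  have [eW|nW] := eqVneq (s (Y (Y 0).-1.+1)) (Y D.+1).
    have [h hh] := exh (fun _ => Y (Y 0).-1.+1) (fun _ _ => hrl).
    exists h; constructor 2; exists (Y 0).-1 => //; split; first by lia.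
    move=> _; right; split=> [j /hh []//|]; have [|_] := hh 0; first by lia.
    by rewrite addn0 => ->.
  have [h hh] := exh (fun l => Y l.+1) (fun l hl => forallP hr (Ordinal hl)).
  exists h; constructor 2; exists (Y 0).-1 => //; split; first by lia.
  move=> _; left; split=> [j /hh []//|]; have [_ ->] := hh _ hl.
  exact/eqP.
have [hv|hv] := boolP (tuple_le a [seq Y j.+1 | j <- iota 0 a]); last first.
  exists [ffun=> ord0]; constructor 3; split=> // vs hvs e; case/negP: hv.
  suff <- : vs = [seq Y j.+1 | j <- iota 0 a] by [].
  case/andP: hvs => /eqP sz _; apply: (@eq_from_nth _ 0); first by rewrite size_map size_iota.
  by move=> i hi; rewrite sz in hi; rewrite e // (nth_map 0) ?size_iota // nth_iota.
have [us hus [h hh hMx]] := hM _ hv; have [h' hh'] := exh h (fun l _ => hh l).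
exists h'; constructor 3; split=> // vs hvs e; exists us => //.
suff -> : vs = [seq Y j.+1 | j <- iota 0 a] by exact: hMx.
case/andP: hvs => /eqP sz _; apply: (@eq_from_nth _ 0); first by rewrite size_map size_iota.
by move=> i hi; rewrite sz in hi; rewrite e // (nth_map 0) ?size_iota // nth_iota.
Qed.

(** [s i] is read off the element of the block with constant index [i]; the consistency clauses
    carry it over to all other blocks. *)
Lemma listing_of_hitting_set (T : {set 'I_q.+1}) : #|T| = k.+2 ^ D ->
  (forall y : 'I_q.+1, exists2 e : 'I_q.+1, e \in T & hits y e) ->
  exists2 s, listing s & forall vs, tuple_le a vs ->
    exists2 Z, truthful s Z & exists2 us, tuple_le b us & Mx Z vs us.
Proof.
move=> cT hT.
pose pr (e : 'I_q.+1) : {ffun 'I_D -> 'I_k.+2} := [ffun l : 'I_D => inord (dig B e l)].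
have blk (h : {ffun 'I_D -> 'I_k.+2}) : exists2 e, e \in T &
    ok (dig B e) /\ forall l : 'I_D, dig B e l = h l.
  pose f j := if j is j'.+1 then (if insub j' is Some i' then val (h i') else 0) else 0.
  have fl (l : 'I_D) : f l.+1 = h l.
    by rewrite /f; case: insubP => [u _ /val_inj -> //|]; rewrite ltn_ord.
  have hf j : j < m -> f j < B.
    case: j => [|j] _ /=; first by lia.
    by case: insubP => [u _ _|_]; [have := ltn_ord (h u); lia | lia].
  have [y hy] := digs_ex hf; have [e eT [eok ecl]] := hT y; exists e => //; split=> // l.
  have y0 : dig B y 0 = 0 by rewrite hy //; lia.
  have yl (i : 'I_D) : dig B y i.+1 = h i by rewrite hy ?fl //; have := ltn_ord i; lia.
  case: ecl => [[_ hb]|[l' _ []]|[]]; [|by rewrite y0|by rewrite y0].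
  rewrite hb; [by rewrite yl | by move=> i hi; have /= -> := yl (Ordinal hi); rewrite -ltnS | by []].
have prT : pr @: T = [set: {ffun 'I_D -> 'I_k.+2}].
  apply/eqP; rewrite -subTset; apply/subsetP => h _; have [e eT [_ he]] := blk h.
  apply/imsetP; exists e => //; apply/ffunP => l; apply: val_inj.
  by rewrite ffunE /= he inordK.
(* A surjection between finite sets of equal size is injective: each block holds exactly one element
   of [T]. *)
have pr_inj : {in T &, injective pr}.
  by apply/imset_injP; rewrite prT cardsT card_ffun !card_ord cT.
(* Incidence guarantees [ok] only for an element that hits something. But the clause of the block
   [pr e] is hit by some [e'] with the same projection, so [e' = e]. This also covers digits out of
   range, which [inord] sends to 0. *)
have allok e : e \in T -> ok (dig B e).
  move=> eT; have [e' e'T [oke' he']] := blk (pr e).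
  suff -> : e = e' by [].
  apply: pr_inj => //; apply/ffunP => l; apply: val_inj.
  by rewrite [in RHS]ffunE /= he' inordK.
have uniq_blk e e' : e \in T -> e' \in T -> (forall l, l < D -> dig B e l = dig B e' l) -> e = e'.
  by move=> eT e'T h; apply: pr_inj => //; apply/ffunP => l; rewrite !ffunE h.
have cblk i : exists2 e, e \in T & i <= k.+1 -> forall l, l < D -> dig B e l = i.
  have [e eT [_ he]] := blk [ffun=> inord i]; exists e => // hi l hl.
  by rewrite (he (Ordinal hl)) ffunE inordK.
have /fin_all_exists2[c cT' cP] : forall i : 'I_k.+2, exists2 e, e \in T &
    forall l, l < D -> dig B e l = i.
  by move=> i; have [e eT he] := cblk i; exists e => // l hl; apply: he => //; rewrite -ltnS.
pose s i := dig B (c (inord i)) D.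
have cons e l : e \in T -> l < D -> dig B e (D + l) = s (dig B e l).
  move=> eT hl; have [hok _] := allok e eT; have [hle _ _] := hok l hl.
  (* The consistency clause for the indices of [e], naming the value of [e] itself at place [l]. Its
     first alternative would have to be met by [e], the only element of its block, and fails; the
     second yields the claim. *)
  pose f j := if j == 0 then l.+1 else if j == D.+1 then dig B e (D + l) else dig B e j.-1.
  have hf j : j < m -> f j < B.
    by rewrite /f => _; case: ifP => _; [lia | case: ifP => _; exact: dig_lt].
  have [y hy] := digs_ex hf.
  have y0 : dig B y 0 = l.+1 by rewrite hy //; lia.
  have yD : dig B y D.+1 = dig B e (D + l) by rewrite hy /f ?eqxx //; lia.
  have yj j : j < D -> dig B y j.+1 = dig B e j.
    by move=> hj; rewrite hy /f /=; [case: eqP => //; lia | lia].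
  have [e' e'T [_ ecl]] := hT y.
  case: ecl => [[]|[l' hl' [e1 hcl]]|[]]; [by rewrite y0| |by rewrite y0; lia].
  have el : l' = l by rewrite y0 in e1; case: e1.
  have hr : range_idx (dig B y).
    by move=> j hj; rewrite yj //; have [] := hok j hj.
  rewrite el /cons_cl yD in hcl; case: (hcl hr) => -[h1 h2].
    by case: h2; rewrite (uniq_blk e' e) // => j hj; rewrite h1 // yj.
  rewrite -h2 /s; congr (dig B _ D); congr val.
  apply: uniq_blk => // j hj; rewrite h1 // cP // yj // inordK // ltnS.
exists s; last first.
  move=> vs hvs.
  pose f j := if j == 0 then D.+1 else nth 0 vs j.-1.
  have [sz /allP hall] := andP hvs.
  have hf j : j < m -> f j < B.
    rewrite /f; case: ifP => _ // _; have [h|h] := ltnP j.-1 (size vs).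
      by apply: leq_ltn_trans hBn; apply: hall; exact: mem_nth.
    by rewrite nth_default.
  have [y hy] := digs_ex hf; have [e eT [eok ecl]] := hT y.
  exists (dig B e).
    by move=> l hl; split; [have [h _] := eok; have [] := h l hl | exact: cons].
  have y0 : dig B y 0 = D.+1 by rewrite hy //; lia.
  case: ecl => [[]|[l' hl' []]|[_]]; [by rewrite y0 | by rewrite y0; lia |].
  by apply=> // j hj; rewrite hy //; lia.
have cval i : i <= k.+1 -> forall l, l < D -> dig B (c (inord i)) l = i.
  by move=> hi l hl; rewrite cP // inordK.
have hD0 : 0 < D by lia.
split.
- have [h _] := allok _ (cT' (inord 0)); have [_ h0 _] := h 0 hD0.
  by rewrite /s -[in LHS](addn0 D) h0 // cval.
- have [h _] := allok _ (cT' (inord k.+1)); have [_ _ h1] := h 0 hD0.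
  by rewrite /s -[in LHS](addn0 D) h1 // cval.
- move=> i j hij hj.
  (* A block with [i] at place 0 and [j] at place 1, the two places whose order [ok] controls. *)
  have [e eT [[_ eok] he]] := blk [ffun l : 'I_D => inord (if val l == 0 then i else j)].
  have e0 := he (Ordinal hD0); have e1 := he (Ordinal hD).
  rewrite ffunE /= inordK in e0; last by lia.
  rewrite ffunE /= inordK in e1; last by lia.
  have := cons e 0 eT hD0; have := cons e 1 eT hD; rewrite addn0 addn1 e0 e1 => <- <-.
  by apply: eok; rewrite e0 e1.
Qed.

End Core.

(** * Positions in the encoding of a structure *)

Section Codes.
Variable n : nat.

(** The position of a tuple in the lexicographic enumeration. It serves both for looking up tables
    in the input and as the numbering of tuples that listings use, there shifted by one. *)
Definition code m (v : m.-tuple 'I_n.+1) : nat :=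
  foldl (fun c (a : 'I_n.+1) => c * n.+1 + a) 0 v.

Lemma foldl_code c (s : seq 'I_n.+1) :
  foldl (fun c (a : 'I_n.+1) => c * n.+1 + a) c s =
  c * n.+1 ^ size s + foldl (fun c (a : 'I_n.+1) => c * n.+1 + a) 0 s.
Proof.
elim: s c => [|a s IHs] c /=; first by rewrite expn0 muln1 addn0.
rewrite IHs [in RHS]IHs mul0n add0n expnS; lia.
Qed.

Lemma code_cons m (a : 'I_n.+1) (v : m.-tuple 'I_n.+1) :
  code (cons_tuple a v) = a * n.+1 ^ m + code v.
Proof. by rewrite /code /= mul0n add0n foldl_code size_tuple. Qed.

Lemma flatten_iota M N :
  flatten [seq [seq a * N + j | j <- iota 0 N] | a <- iota 0 M] = iota 0 (M * N).
Proof.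
elim: M => [|M IHM]; first by rewrite mul0n.
rewrite mulSnr [in RHS]iotaD -addn1 iotaD map_cat flatten_cat IHM /= cats0 !add0n.
by congr (_ ++ _); rewrite -[in RHS](addn0 (M * N)) iotaDl.
Qed.

Lemma map_code m : map (@code m) (all_tuples n m) = iota 0 (n.+1 ^ m).
Proof.
elim: m => [|m IHm] //=; rewrite expnS -flatten_iota map_flatten -map_comp.
rewrite -(val_enum_ord n.+1) -map_comp; congr flatten; apply: eq_map => a /=.
by rewrite -IHm -!map_comp; apply: eq_map => v /=; rewrite code_cons.
Qed.

Lemma mem_all_tuples m (v : m.-tuple 'I_n.+1) : v \in all_tuples n m.
Proof.
elim: m v => [|m IHm] v /=; first by rewrite inE; apply/eqP; exact: tuple0.
apply/allpairsPdep; exists (thead v), [tuple of behead v].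
by split; rewrite ?mem_enum ?IHm //; apply: val_inj => /=; case/tupleP: v => a v.
Qed.

Lemma size_all_tuples m : size (all_tuples n m) = n.+1 ^ m.
Proof. by rewrite -(size_map (@code m)) map_code size_iota. Qed.

Lemma code_lt m (v : m.-tuple 'I_n.+1) : code v < n.+1 ^ m.
Proof.
have : code v \in map (@code m) (all_tuples n m) by apply: map_f; exact: mem_all_tuples.
by rewrite map_code mem_iota add0n.
Qed.

Lemma code_onto m c : c < n.+1 ^ m -> exists v : m.-tuple 'I_n.+1, code v = c.
Proof.
move=> hc; have : c \in map (@code m) (all_tuples n m) by rewrite map_code mem_iota.
by case/mapP => v _ ->; exists v.
Qed.

Lemma code_inj m : injective (@code m).
Proof.
elim: m => [|m IHm] v v'; first by rewrite (tuple0 v) (tuple0 v').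
case/tupleP: v => a v; case/tupleP: v' => a' v'; rewrite !code_cons => e.
have hv := code_lt v; have hv' := code_lt v'.
have N0 : 0 < n.+1 ^ m by rewrite expn_gt0.
have ea : a = a'.
  apply: val_inj; rewrite /=; have := congr1 (divn^~ (n.+1 ^ m)) e.
  by rewrite !divnMDl // !divn_small // !addn0.
rewrite ea in e *; move/addnI/IHm: e => -> //.
Qed.

(** A table whose entries are looked up in a word is a slice of that word; this allows a structure
    to be rebuilt from its encoding. *)
Lemma map_nth_code m z o : o + n.+1 ^ m <= size z ->
  [seq nth false z (o + code v) | v <- all_tuples n m] = take (n.+1 ^ m) (drop o z).
Proof.
move=> hs; rewrite (map_comp (fun c => nth false z (o + c)) (@code m)) map_code.
apply: (@eq_from_nth _ false); first by rewrite size_map size_iota size_takel // size_drop; lia.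
move=> i; rewrite size_map size_iota => hi.
by rewrite (nth_map 0) ?size_iota // nth_iota // nth_take // nth_drop.
Qed.

Lemma nth_table m (g : m.-tuple 'I_n.+1 -> bool) v :
  nth false [seq g v | v <- all_tuples n m] (code v) = g v.
Proof.
have hi := mem_all_tuples v; have h : index v (all_tuples n m) < size (all_tuples n m) by rewrite index_mem.
have e : code v = index v (all_tuples n m).
  have := nth_map v 0 (@code m) h; rewrite map_code nth_index // nth_iota ?add0n //.
  by rewrite -size_all_tuples.
by rewrite e (nth_map v) // nth_index.
Qed.

Lemma map_graph_code m :
  [seq code v * n.+1 + val a | v <- all_tuples n m, a <- enum 'I_n.+1] = iota 0 (n.+1 ^ m.+1).
Proof.
rewrite expnSr -flatten_iota -map_code -(val_enum_ord n.+1) -map_comp.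
by congr flatten; apply: eq_map => v /=; rewrite -map_comp.
Qed.

Lemma map_nth_graph m z o : o + n.+1 ^ m.+1 <= size z ->
  [seq nth false z (o + (code v * n.+1 + val a)) | v <- all_tuples n m, a <- enum 'I_n.+1] =
  take (n.+1 ^ m.+1) (drop o z).
Proof.
move=> hs; have -> : [seq nth false z (o + (code v * n.+1 + val a)) | v <- all_tuples n m, a <- enum 'I_n.+1]
   = [seq nth false z (o + c) | c <- iota 0 (n.+1 ^ m.+1)].
  by rewrite -map_graph_code map_flatten -map_comp; congr flatten; apply: eq_map => v /=; rewrite -map_comp.
apply: (@eq_from_nth _ false); first by rewrite size_map size_iota size_takel // size_drop; lia.
move=> i; rewrite size_map size_iota => hi.
by rewrite (nth_map 0) ?size_iota // nth_iota // nth_take // nth_drop.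
Qed.

Lemma nth_graph m (g : m.-tuple 'I_n.+1 -> 'I_n.+1 -> bool) v (a : 'I_n.+1) :
  nth false [seq g v a | v <- all_tuples n m, a <- enum 'I_n.+1] (code v * n.+1 + a) = g v a.
Proof.
have [p hp] : exists p, p = code v * n.+1 + a by eexists.
pose P := [seq (v, a) | v <- all_tuples n m, a <- enum 'I_n.+1].
have eL : map (fun u => code u.1 * n.+1 + val u.2) P = iota 0 (n.+1 ^ m.+1).
  by rewrite -map_graph_code map_flatten -map_comp; congr flatten; apply: eq_map => v' /=; rewrite -map_comp.
have -> : [seq g v a | v <- all_tuples n m, a <- enum 'I_n.+1] = map (fun u => g u.1 u.2) P.
  by rewrite map_flatten -map_comp; congr flatten; apply: eq_map => v' /=; rewrite -map_comp.
have mP : (v, a) \in P by apply/allpairsPdep; exists v, a; rewrite mem_all_tuples mem_enum.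
have hi : index (v, a) P < size P by rewrite index_mem.
have e : p = index (v, a) P.
  have := nth_map (v, a) 0 (fun u => code u.1 * n.+1 + val u.2) hi.
  rewrite eL nth_index //= -hp nth_iota ?add0n //.
  by have := congr1 size eL; rewrite size_map size_iota => <-.
by rewrite -hp e (nth_map (v, a)) // nth_index.
Qed.

End Codes.

(** * Concatenated tables *)

Section Tables.
Variables (K : eqType) (len : K -> nat).

Definition off (s : seq K) (x : K) : nat := sumn [seq len y | y <- take (index x s) s].

Lemma off_cons y s x : off (y :: s) x = if y == x then 0 else len y + off s x.
Proof. by rewrite /off /=; case: ifP. Qed.

Lemma nth_tables (s : seq K) (tab : K -> seq bool) rest x i :
  (forall y, size (tab y) = len y) -> x \in s -> i < len x ->
  nth false (flatten (map tab s) ++ rest) (off s x + i) = nth false (tab x) i.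
Proof.
move=> hs; elim: s => //= y s IHs hx hi; rewrite off_cons -catA nth_cat hs.
case: eqP hx => [->|/eqP ne]; first by rewrite add0n hi.
rewrite inE eq_sym (negbTE ne) /= => hx.
by rewrite ltnNge -addnA leq_addr /= addKn IHs.
Qed.

Lemma tables_of_word (s : seq K) (tab : K -> seq bool) z :
  uniq s -> sumn (map len s) <= size z ->
  (forall x, x \in s -> tab x = take (len x) (drop (off s x) z)) ->
  flatten (map tab s) = take (sumn (map len s)) z.
Proof.
elim: s z => [|y s IHs] z /=; first by rewrite take0.
case/andP=> ny us hz ht; rewrite takeD; congr (_ ++ _).
  by rewrite ht ?mem_head // off_cons eqxx drop0.
apply: IHs => // [|x hx]; first by rewrite size_drop; lia.
rewrite ht ?inE ?hx ?orbT // off_cons drop_drop; case: eqP => [e|_].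
  by rewrite e hx in ny.
by rewrite addnC.
Qed.

Lemma size_tables (s : seq K) (tab : K -> seq bool) :
  (forall y, size (tab y) = len y) -> size (flatten (map tab s)) = sumn (map len s).
Proof. by move=> hs; rewrite size_flatten /shape -map_comp; congr sumn; apply: eq_map. Qed.

Lemma off_le s x : x \in s -> off s x + len x <= sumn (map len s).
Proof.
elim: s => //= y s IHs; rewrite inE off_cons; case: eqP => [->|_ /=]; first by rewrite eqxx /=; lia.
by case: eqP => //= _ /IHs; lia.
Qed.

End Tables.

(** * Words that encode structures *)

Section Words.
Variable V : vocab.

Definition lead (x : seq bool) : nat := find negb x.

Lemma lead_nseq k x : lead (nseq k true ++ false :: x) = k.
Proof. by rewrite /lead find_cat has_nseq /= andbF size_nseq addn0. Qed.

Definition rlen (b : nat) (R : rel_sym V) : nat := b ^ rel_ar R.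
Definition flen (b : nat) (F : fun_sym V) : nat := b ^ (fun_ar F).+1.

Definition roff (b : nat) (R : rel_sym V) : nat := b.+1 + off (rlen b) (enum (rel_sym V)) R.

Definition fbase (b : nat) : nat := b.+1 + sumn [seq rlen b R | R <- enum (rel_sym V)].

Definition foff (b : nat) (F : fun_sym V) : nat := fbase b + off (flen b) (enum (fun_sym V)) F.

Definition wsize (b : nat) : nat := fbase b + sumn [seq flen b F | F <- enum (fun_sym V)].

(** An arithmetical description of the words in the image of [encode], which the program can test.
    The last condition says that every row of a function table has exactly one true bit. *)
Definition well_formed (b : nat) (x : seq bool) : Prop :=
  [/\ 0 < b, size x = wsize b &
    forall (F : fun_sym V) c, c < b ^ fun_ar F ->
      \sum_(0 <= a < b) nth false x (foff b F + (c * b + a)) = 1].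

Section Encoded.
Variables (n : nat) (A : structure V n).

Lemma lead_encode : lead (encode A) = n.+1.
Proof. exact: lead_nseq. Qed.

Let rtab R := [seq rel_int A v | v <- all_tuples n (rel_ar R)].
Let ftab F := [seq fun_int A v == a | v <- all_tuples n (fun_ar F), a <- enum 'I_n.+1].

Lemma size_rtab R : size (rtab R) = rlen n.+1 R.
Proof. by rewrite size_map size_all_tuples. Qed.

Lemma size_ftab F : size (ftab F) = flen n.+1 F.
Proof. by rewrite size_allpairs size_all_tuples size_enum_ord /flen expnSr. Qed.

Lemma nth_encode_rel R (v : (rel_ar R).-tuple 'I_n.+1) :
  nth false (encode A) (roff n.+1 R + code v) = rel_int A v.
Proof.
rewrite /encode -cat_rcons nth_cat size_rcons size_nseq /roff -addnA ltnNge leq_addr /= addKn.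
rewrite (nth_tables _ size_rtab) ?mem_enum //; last exact: code_lt.
exact: nth_table.
Qed.

Lemma nth_encode_fun F (v : (fun_ar F).-tuple 'I_n.+1) (a : 'I_n.+1) :
  nth false (encode A) (foff n.+1 F + (code v * n.+1 + a)) = (fun_int A v == a).
Proof.
rewrite /encode -cat_rcons catA nth_cat size_cat size_rcons size_nseq.
rewrite (size_tables _ size_rtab) -/(fbase n.+1) /foff -addnA ltnNge leq_addr /= addKn.
rewrite -[flatten _]cats0 (nth_tables _ size_ftab) ?mem_enum //.
  exact: (nth_graph (fun v a => fun_int A v == a)).
rewrite /flen expnSr; have := code_lt v; have := ltn_ord a; nia.
Qed.

Lemma encode_well_formed : well_formed n.+1 (encode A).
Proof.
split=> //.
  rewrite /encode size_cat size_nseq /= size_cat (size_tables _ size_rtab).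
  by rewrite (size_tables _ size_ftab) /wsize /fbase addnS addSn addnA.
move=> F c hc; have [v <-] := code_onto hc.
rewrite big_mkord (bigD1 (fun_int A v)) // nth_encode_fun eqxx big1 // => a /andP[_ ha].
by rewrite nth_encode_fun eq_sym (negbTE ha).
Qed.

End Encoded.

(** Row sums equal to 1 turn the function tables into graphs of functions, relation tables may be
    arbitrary, and the prefix is determined by [lead x]. *)
Lemma encode_of_well_formed x : well_formed (lead x) x ->
  exists n (A : structure V n), x = encode A.
Proof.
case hl: (lead x) => [|n] [] // _ hs hf; exists n.
have hF (F : fun_sym V) (v : (fun_ar F).-tuple 'I_n.+1) :
    {a : 'I_n.+1 | nth false x (foff n.+1 F + (code v * n.+1 + a))
      & forall a', nth false x (foff n.+1 F + (code v * n.+1 + a')) -> a' = a :> nat \/ n < a'}.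
  pose p (a : 'I_n.+1) := nth false x (foff n.+1 F + (code v * n.+1 + a)).
  have h1 : \sum_a p a = 1 by rewrite -(hf F _ (code_lt v)) big_mkord.
  have [a pa|p0] := pickP p; last by rewrite big1 // in h1 => a _; rewrite p0.
  exists a => // a' pa'; have [ha'|] := ltnP a' n.+1; last by right.
  left; apply/eqP/negPn/negP => ne; move: h1; rewrite (bigD1 a) //= pa.
  rewrite (bigD1 (Ordinal ha')) /=; last by apply: contra ne => /eqP <-.
  by rewrite {1}/p /= pa'.
pose A := @Structure V n (fun R v => nth false x (roff n.+1 R + code v))
  (fun F v => s2val (hF F v)).
exists A; rewrite /encode.
have hlead : x = nseq n.+1 true ++ false :: drop n.+2 x.
  have hlt : n.+1 < size x by rewrite hs /wsize /fbase; lia.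
  apply: (@eq_from_nth _ false).
    by rewrite size_cat size_nseq /= size_drop; lia.
  move=> i _; rewrite nth_cat size_nseq nth_nseq; case: ltngtP => hi.
  - by have := before_find false (a := negb) (s := x); rewrite -/(lead x) hl => /(_ _ hi) /negbFE ->.
  - have -> : i - n.+1 = (i - n.+2).+1 by lia.
    by rewrite /= nth_drop; congr nth; lia.
  - have := nth_find false (a := negb) (s := x); rewrite has_find -/(lead x) hl hlt hi subnn /=.
    by move=> /(_ isT) /negbTE.
have hz : size (drop n.+2 x) = sumn [seq rlen n.+1 R | R <- enum (rel_sym V)] +
    sumn [seq flen n.+1 F | F <- enum (fun_sym V)].
  by rewrite size_drop hs /wsize /fbase; lia.
rewrite {1}hlead; congr (_ ++ _ :: _).
rewrite -[LHS](cat_take_drop (sumn [seq rlen n.+1 R | R <- enum (rel_sym V)])); congr (_ ++ _).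
  apply/esym/tables_of_word; [exact: enum_uniq | by rewrite hz leq_addr |].
  move=> R hR; rewrite -map_nth_code.
    by apply: eq_map => v /=; rewrite nth_drop /roff addnA.
  by rewrite hz; apply: leq_trans (off_le (rlen n.+1) hR) (leq_addr _ _).
set z := drop _ (drop _ _).
have hz2 : size z = sumn [seq flen n.+1 F | F <- enum (fun_sym V)] by rewrite /z size_drop hz addKn.
have {1}-> : z = take (sumn [seq flen n.+1 F | F <- enum (fun_sym V)]) z by rewrite take_oversize // hz2.
apply/esym/tables_of_word; [exact: enum_uniq | by rewrite hz2 |].
move=> F hF'; rewrite -map_nth_graph; last first.
  by rewrite hz2; exact: (off_le (fun F0 => flen n.+1 F0) hF').
congr flatten; apply: eq_map => v; apply: eq_map => a /=.
rewrite /z !nth_drop; case: (hF F v) => a0 h0 h1 /=.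
have -> : n.+2 + (sumn [seq rlen n.+1 R | R <- enum (rel_sym V)] +
    (off (flen n.+1) (enum (fun_sym V)) F + (code v * n.+1 + a))) =
    foff n.+1 F + (code v * n.+1 + a) by rewrite /foff /fbase; lia.
apply/eqP/idP => [<- //|/h1 [/val_inj -> //|]].
by have := ltn_ord a; lia.
Qed.

End Words.

(** * Arithmetic formulas *)

(* The connectives are locked so that rewriting with the lemmas on [eval] and
   [holds] does not look through them. *)
Definition ENot a := locked (Sub (Const 1) a).
Definition EAnd a b := locked (Mul a b).
Definition EOr a b := locked (Add a b).
Definition EImp a b := locked (EOr (ENot a) b).
Definition ELt a b := locked (Sub b a).
Definition ELe a b := locked (ENot (Sub a b)).
Definition EEq a b := locked (EAnd (ELe a b) (ELe b a)).
Definition EEx x a b := locked (Sum x a b).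
Definition EAll x a b := locked (ENot (EEx x a (ENot b))).
Definition EAndL (s : seq exp) := locked (foldr EAnd (Const 1) s).
Definition EOrL (s : seq exp) := locked (foldr EOr (Const 0) s).
Definition ESumL (s : seq exp) := foldr Add (Const 0) s.
Definition EPow a c := locked (iter c (Mul a) (Const 1)).

Section Formulas.
Variables (w : seq bool).

Lemma eval_add rho a b : eval w rho (Add a b) = eval w rho a + eval w rho b.
Proof. by []. Qed.
Lemma eval_mul rho a b : eval w rho (Mul a b) = eval w rho a * eval w rho b.
Proof. by []. Qed.
Lemma eval_const rho c : eval w rho (Const c) = c. Proof. by []. Qed.
Lemma eval_var rho x : eval w rho (EVar x) = rho x. Proof. by []. Qed.
Lemma eval_in rho a : eval w rho (In a) = nth false w (eval w rho a). Proof. by []. Qed.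
Lemma eval_sum rho x a b : eval w rho (Sum x a b) =
  \sum_(0 <= v < eval w rho a) eval w (upd rho x v) b.
Proof. by []. Qed.
Definition evalE := (eval_add, eval_mul, eval_const, eval_var, eval_in, eval_sum).

Definition holds (rho : nat -> nat) (e : exp) : bool := 0 < eval w rho e.

Lemma holds_not rho a : holds rho (ENot a) = ~~ holds rho a.
Proof. by rewrite /ENot -lock /holds /= subn_gt0 ltnS -eqn0Ngt leqn0. Qed.

Lemma holds_and rho a b : holds rho (EAnd a b) = holds rho a && holds rho b.
Proof. by rewrite /EAnd -lock /holds /= muln_gt0. Qed.

Lemma holds_or rho a b : holds rho (EOr a b) = holds rho a || holds rho b.
Proof. by rewrite /EOr -lock /holds /= addn_gt0. Qed.

Lemma holds_imp rho a b : holds rho (EImp a b) = (holds rho a ==> holds rho b).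
Proof. by rewrite /EImp -lock holds_or holds_not implybE. Qed.

Lemma holds_lt rho a b : holds rho (ELt a b) = (eval w rho a < eval w rho b).
Proof. by rewrite /ELt -lock /holds /= subn_gt0. Qed.

Lemma holds_le rho a b : holds rho (ELe a b) = (eval w rho a <= eval w rho b).
Proof. by rewrite /ELe -lock holds_not /holds /= subn_gt0 -leqNgt. Qed.

Lemma holds_eq rho a b : holds rho (EEq a b) = (eval w rho a == eval w rho b).
Proof. by rewrite /EEq -lock holds_and !holds_le -eqn_leq. Qed.

Lemma holds_in rho a : holds rho (In a) = nth false w (eval w rho a).
Proof. by rewrite /holds /=; case: nth. Qed.

Lemma holds_ex rho x a b :
  holds rho (EEx x a b) <-> exists2 v, v < eval w rho a & holds (upd rho x v) b.
Proof.
rewrite /EEx -lock /holds /= lt0n sum_nat_seq_neq0; split.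
  case/hasP => v; rewrite mem_index_iota -lt0n => /andP[_ hv] hb.
  by exists v.
case=> v hv hb; apply/hasP; exists v; first by rewrite mem_index_iota.
by rewrite /= -lt0n.
Qed.

Lemma holds_all rho x a b :
  holds rho (EAll x a b) <-> forall v, v < eval w rho a -> holds (upd rho x v) b.
Proof.
rewrite /EAll -lock holds_not; split=> [h v hv|h].
  by apply: contraR h => nb; apply/holds_ex; exists v; rewrite // holds_not.
by apply/negP => /holds_ex [v hv]; rewrite holds_not h.
Qed.

(** The value is 0 or 1, so that a sum of such formulas counts. *)
Lemma eval_all rho x a b : eval w rho (EAll x a b) = holds rho (EAll x a b).
Proof. by rewrite /EAll /ENot -!lock /holds /=; case: (eval _ _ (EEx _ _ _)). Qed.

Lemma holds_andL rho (s : seq exp) : holds rho (EAndL s) = all (holds rho) s.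
Proof. by rewrite /EAndL -lock; elim: s => //= a s IHs; rewrite holds_and IHs. Qed.

Lemma holds_orL rho (s : seq exp) : holds rho (EOrL s) = has (holds rho) s.
Proof. by rewrite /EOrL -lock; elim: s => //= a s IHs; rewrite holds_or IHs. Qed.

Lemma holds_and_map rho (K : eqType) (f : K -> exp) (s : seq K) :
  holds rho (EAndL (map f s)) <-> forall y, y \in s -> holds rho (f y).
Proof. by rewrite holds_andL all_map; split=> [/allP|h]; last apply/allP. Qed.

Lemma holds_andn rho (f : nat -> exp) D :
  holds rho (EAndL [seq f l | l <- iota 0 D]) <-> forall l, l < D -> holds rho (f l).
Proof.
split=> [/holds_and_map h l hl|h]; first by apply: h; rewrite mem_iota.
by apply/holds_and_map => l; rewrite mem_iota; exact: h.
Qed.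

Lemma holds_orn rho (f : nat -> exp) D :
  holds rho (EOrL [seq f l | l <- iota 0 D]) <-> exists2 l, l < D & holds rho (f l).
Proof.
rewrite holds_orL has_map; split=> [/hasP [l]|[l hl h]].
  by rewrite mem_iota => hl h; exists l.
by apply/hasP; exists l; rewrite ?mem_iota.
Qed.

Lemma eval_sumL rho (K : Type) (f : K -> exp) (s : seq K) :
  eval w rho (ESumL (map f s)) = sumn [seq eval w rho (f y) | y <- s].
Proof. by elim: s => //= a s ->. Qed.

Lemma eval_pow rho a c : eval w rho (EPow a c) = eval w rho a ^ c.
Proof. by rewrite /EPow -lock; elim: c => //= c ->; rewrite expnS. Qed.

Fixpoint upds (T : Type) (rho : nat -> T) (xs : seq nat) (vs : seq T) : nat -> T :=
  match xs, vs with
  | x :: xs', v :: vs' => upds (upd rho x v) xs' vs'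
  | _, _ => rho
  end.

Lemma upds_notin (T : Type) (rho : nat -> T) xs vs y : y \notin xs -> upds rho xs vs y = rho y.
Proof.
elim: xs rho vs => //= x xs IHxs rho [|v vs] //; rewrite inE negb_or => /andP[ne ny].
by rewrite IHxs // /upd (negbTE ne).
Qed.

Lemma upds_nth (rho : nat -> nat) xs vs j : uniq xs -> size vs = size xs -> j < size xs ->
  upds rho xs vs (nth 0 xs j) = nth 0 vs j.
Proof.
elim: xs rho vs j => //= x xs IHxs rho [|v vs] //= j /andP[nx ux] [sz].
case: j => [|j] hj /=; last exact: IHxs.
by rewrite upds_notin // /upd eqxx.
Qed.

Definition EExs xs a b := foldr (fun x => EEx x a) b xs.

(** The bounds that occur depend on variable 0 alone, hence keep their value while the quantified
    variables change. *)
Lemma holds_exs rho xs a b c : (forall rho', rho' 0 = rho 0 -> eval w rho' a = c) ->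
  0 \notin xs ->
  holds rho (EExs xs a b) <->
  exists vs, [/\ size vs = size xs, all (fun v => v < c) vs & holds (upds rho xs vs) b].
Proof.
move=> ha; elim: xs rho ha => [|x xs IHxs] rho ha.
  by move=> _; split=> [h|[[|v vs] []//]]; exists [::].
rewrite inE negb_or => /andP[nx n0]; have ha' v rho' : rho' 0 = upd rho x v 0 -> eval w rho' a = c.
  by rewrite /upd (negbTE nx); exact: ha.
split.
  case/holds_ex => v; rewrite ha // => hv /(IHxs _ (ha' v) n0) [vs [h1 h2 h3]].
  by exists (v :: vs); rewrite /= h1 hv.
case=> -[|v vs] [] //= [h1] /andP[hv h2] h3; apply/holds_ex; exists v; first by rewrite ha.
by apply/(IHxs _ (ha' v) n0); exists vs.
Qed.

Lemma num_evars rho (B : exp) xs c : (forall rho', rho' 0 = rho 0 -> eval w rho' B = c) ->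
  eval w rho (foldr (fun x e => Add (EVar x) (Mul B e)) (Const 0) xs) =
  num c (size xs) (fun j => rho (nth 0 xs j)).
Proof. by move=> hB; elim: xs => //= x xs ->; rewrite hB. Qed.

End Formulas.

(** * Reading off the parameter and the structure *)

(* Variable 0 holds the length of the input, 1 and 2 the pair of vertices; those up
   to 8 are reserved.  [Fn] names the variables of the first-order formula, [Yn]
   the digits of the clause and [Zn] those of the element. *)
Definition Fn x := 3 * x + 9.
Definition Yn j := 3 * j + 10.
Definition Zn j := 3 * j + 11.

(** The length of the run of ones that begins at position [e], obtained by counting the v for which
    the bits at e, ..., e + v are all set. *)
Definition ELead (e : exp) :=
  Sum 7 (EVar 0) (EAll 8 (Add (EVar 7) (Const 1)) (In (Add e (EVar 8)))).
Definition EK := locked (ELead (Const 0)).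
Definition EK1 := locked (Add EK (Const 1)).
Definition EN1 := locked (ELead EK1).

Lemma lt_lead x v : (v < lead x) <-> (forall u, u < v.+1 -> nth false x u).
Proof.
split=> [hv u hu|h].
  by have := before_find false (leq_ltn_trans (hu : u <= v) hv) => /negbFE.
rewrite ltnNge; apply/negP => hv; have := h (lead x) hv; rewrite /lead.
have [hs|hs] := boolP (has negb x); first by rewrite (negbTE (nth_find false hs)).
by rewrite nth_default // hasNfind.
Qed.

Lemma sum_ltn L l : l <= L -> \sum_(0 <= v < L) (v < l) = l.
Proof.
move=> hl; suff -> : \sum_(0 <= v < L) (v < l) = minn l L by apply/minn_idPl.
elim: L {hl} => [|L IHL]; first by rewrite big_geq // minn0.
by rewrite big_nat_recr // IHL /=; lia.
Qed.

Lemma eval_lead w rho e c : rho 0 = size w ->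
  (forall u v, eval w (upd (upd rho 7 u) 8 v) e = c) ->
  eval w rho (ELead e) = lead (drop c w).
Proof.
move=> h0 he; rewrite /ELead /= -[RHS](@sum_ltn (size w)); last first.
  by apply: leq_trans (find_size _ _) _; rewrite size_drop leq_subr.
rewrite h0; apply: eq_bigr => v _.
rewrite -[LHS]/(eval w (upd rho 7 v) (EAll 8 (Add (EVar 7) (Const 1)) (In (Add e (EVar 8))))).
rewrite eval_all; congr nat_of_bool; apply/idP/idP.
  move/holds_all => h; apply/lt_lead => u hu; have := h u.
  by rewrite /= {1}/upd /= addn1 => /(_ hu); rewrite holds_in /= he nth_drop /upd.
move/lt_lead => h; apply/holds_all => u; rewrite /= {1}/upd /= addn1 => /h.
by rewrite holds_in /= he nth_drop /upd.
Qed.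

Lemma nth_instance x k i : nth false (instance x k) (k.+1 + i) = nth false x i.
Proof.
rewrite /instance nth_cat size_nseq ifN; last by rewrite -leqNgt addSn; lia.
by have -> : k.+1 + i - k = i.+1 by lia.
Qed.

Lemma size_instance x k : size (instance x k) = k.+1 + size x.
Proof. by rewrite /instance size_cat size_nseq /= addnS. Qed.

Section Instance.
Variables (x : seq bool) (k : nat).
Let w := instance x k.

Lemma eval_EK rho : rho 0 = size w -> eval w rho EK = k.
Proof. by move=> h; rewrite /EK -lock (@eval_lead _ _ _ 0) // drop0 lead_nseq. Qed.

Lemma eval_EK1 rho : rho 0 = size w -> eval w rho EK1 = k.+1.
Proof. by move=> h; rewrite /EK1 -lock !evalE eval_EK // addn1. Qed.

Lemma eval_EN1 rho : rho 0 = size w -> eval w rho EN1 = lead x.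
Proof.
move=> h; rewrite /EN1 -lock (@eval_lead _ _ _ k.+1) // => [|u v]; last by rewrite eval_EK1.
by rewrite /w /instance drop_cat size_nseq ltnNge leqW //= subSnn /= drop0.
Qed.

Section Offsets.
Variable V : vocab.

Definition ERlen (R : rel_sym V) := EPow EN1 (rel_ar R).
Definition EFlen (F : fun_sym V) := EPow EN1 (fun_ar F).+1.
Definition EOff (K : eqType) (f : K -> exp) (s : seq K) y := ESumL (map f (take (index y s) s)).
Definition ERoff (R : rel_sym V) :=
  locked (Add (Add EN1 (Const 1)) (EOff ERlen (enum (rel_sym V)) R)).
Definition EFbase :=
  locked (Add (Add EN1 (Const 1)) (ESumL (map ERlen (enum (rel_sym V))))).
Definition EFoff (F : fun_sym V) :=
  locked (Add EFbase (EOff EFlen (enum (fun_sym V)) F)).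
Definition EWsize := locked (Add EFbase (ESumL (map EFlen (enum (fun_sym V))))).

Lemma eval_EOff rho (K : eqType) (f : K -> exp) len s y :
  (forall z, eval w rho (f z) = len z) -> eval w rho (EOff f s y) = off len s y.
Proof. by move=> h; rewrite /EOff eval_sumL; congr sumn; exact: eq_map. Qed.

Variable rho : nat -> nat.
Hypothesis h0 : rho 0 = size w.

Lemma eval_ERlen R : eval w rho (ERlen R) = rlen (lead x) R.
Proof. by rewrite eval_pow eval_EN1. Qed.

Lemma eval_EFlen F : eval w rho (EFlen F) = flen (lead x) F.
Proof. by rewrite eval_pow eval_EN1. Qed.

Lemma eval_ERoff R : eval w rho (ERoff R) = roff (lead x) R.
Proof.
by rewrite /ERoff -lock !eval_add eval_EN1 // addn1 (eval_EOff _ _ eval_ERlen).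
Qed.

Lemma eval_EFbase : eval w rho EFbase = fbase V (lead x).
Proof.
rewrite /EFbase -lock !eval_add eval_EN1 // addn1 eval_sumL; congr (_ + sumn _); exact: eq_map eval_ERlen _.
Qed.

Lemma eval_EFoff F : eval w rho (EFoff F) = foff (lead x) F.
Proof.
by rewrite /EFoff -lock eval_add eval_EFbase (eval_EOff _ _ eval_EFlen).
Qed.

Lemma eval_EWsize : eval w rho EWsize = wsize V (lead x).
Proof.
rewrite /EWsize -lock eval_add eval_EFbase eval_sumL; congr (_ + sumn _); exact: eq_map eval_EFlen _.
Qed.

End Offsets.

Definition EFunOk V (F : fun_sym V) :=
  EAll 7 (EPow EN1 (fun_ar F)) (EEq (Sum 6 EN1
    (In (Add EK1 (Add (EFoff F) (Add (Mul (EVar 7) EN1) (EVar 6)))))) (Const 1)).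

Definition EValid V :=
  locked (EAnd (ELt (Const 0) EN1) (EAnd (EEq (EVar 0) (Add EK1 (EWsize V)))
    (EAndL [seq EFunOk F | F <- enum (fun_sym V)]))).

Lemma holds_EValid V rho : rho 0 = size w ->
  holds w rho (EValid V) <-> well_formed V (lead x) x.
Proof.
move=> h0.
have hF (F : fun_sym V) : holds w rho (EFunOk F) <-> forall c, c < lead x ^ fun_ar F ->
    \sum_(0 <= a < lead x) nth false x (foff (lead x) F + (c * lead x + a)) = 1.
  have e c : eval w (upd rho 7 c) (Sum 6 EN1
      (In (Add EK1 (Add (EFoff F) (Add (Mul (EVar 7) EN1) (EVar 6)))))) =
      \sum_(0 <= a < lead x) nth false x (foff (lead x) F + (c * lead x + a)).
    rewrite eval_sum eval_EN1 //; apply: eq_bigr => a _; rewrite !evalE.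
    by rewrite eval_EK1 // eval_EFoff // eval_EN1 // /w nth_instance.
  split=> [/holds_all h c|h]; last apply/holds_all => c.
    by have := h c; rewrite eval_pow eval_EN1 // => h' /h'; rewrite holds_eq e => /eqP.
  by rewrite eval_pow eval_EN1 // holds_eq e => /h ->.
rewrite /EValid -lock !holds_and holds_lt eval_EN1 // holds_eq !evalE eval_EK1 // eval_EWsize //.
rewrite h0 size_instance eqn_add2l; split.
  case/and3P => h1 /eqP h2 /holds_and_map h3; split=> // F; apply/hF; apply: h3.
  by rewrite mem_enum.
case=> h1 h2 h3; apply/and3P; split=> //; first exact/eqP.
by apply/holds_and_map => F _; apply/hF; exact: h3.
Qed.
End Instance.

(** * Translating the matrix *)

Section Translation.
Variables (V : vocab) (r : nat).
Notation VV := (vocab_ext V r).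

Definition fold_code m (f : 'I_m -> exp) : exp :=
  foldl (fun c i => Add (Mul c EN1) (f i)) (Const 0) (enum 'I_m).

(** A function value is recovered from the graph as the sum of all a weighted with the bit of the
    graph at a; exactly one bit is set. *)
Fixpoint TE (t : term VV) : exp :=
  match t with
  | Var x => EVar (Fn x)
  | App F ts =>
      Sum 6 EN1 (Mul (EVar 6) (In (Add EK1 (Add (@EFoff V F)
        (Add (Mul (fold_code (fun i => TE (ts i))) EN1) (EVar 6))))))
  end.

Definition codeE m (ts : 'I_m -> term VV) : exp := fold_code (fun i => TE (ts i)).

Definition S_args (a : atom VV) : option ('I_r -> term VV) :=
  match a with
  | Eq _ _ => None
  | Rel R ts =>
      match R as R0 return ('I_(@rel_ar VV R0) -> term VV) -> option ('I_r -> term VV) with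
      | None => fun ts => Some ts
      | Some _ => fun _ => None
      end ts
  end.

Fixpoint S_atoms (chi : fo VV) : seq ('I_r -> term VV) :=
  match chi with
  | FAtom a => if S_args a is Some ts then [:: ts] else [::]
  | FNot p | FEx _ p | FAll _ p => S_atoms p
  | FAnd p q | FOr p q => S_atoms p ++ S_atoms q
  end.

Section Trans.
Variable d : nat.
Notation D := d.*2.

Definition ES (c : exp) : exp :=
  EOrL [seq EEq (EVar (Zn (D + l.*2))) (Add c (Const 1)) | l <- iota 0 d].

(** The slots 2l and 2l + 1 form the l-th certificate: either the value in the even slot is the
    tuple, or the tuple lies strictly between two values with consecutive indices. Any certificate
    may serve any atom. Codes are raised by 1 to make room for the sentinel 0. *)
Definition EDec (c : exp) : exp :=
  EOrL [seq EOr (EEq (EVar (Zn (D + l.*2))) (Add c (Const 1)))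
     (EAnd (EAnd (ELt (EVar (Zn (D + l.*2))) (Add c (Const 1)))
                 (ELt (Add c (Const 1)) (EVar (Zn (D + l.*2.+1)))))
           (EEq (EVar (Zn l.*2.+1)) (Add (EVar (Zn l.*2)) (Const 1)))) | l <- iota 0 d].

Definition TA (a : atom VV) : exp :=
  match a with
  | Eq t u => EEq (TE t) (TE u)
  | Rel R ts =>
      match R as R0 return ('I_(@rel_ar VV R0) -> term VV) -> exp with
      | None => fun ts => ES (codeE ts)
      | Some R' => fun ts => In (Add EK1 (Add (@ERoff V R') (codeE ts)))
      end ts
  end.

(* Only applied to quantifier-free formulas. *)
Fixpoint trans (chi : fo VV) : exp :=
  match chi with
  | FAtom a => TA a
  | FNot p => ENot (trans p)
  | FAnd p q => EAnd (trans p) (trans q)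
  | FOr p q => EOr (trans p) (trans q)
  | FEx _ _ | FAll _ _ => Const 0
  end.

(** An element certifies only some of the members of S, so a negated atom can be trusted only after
    its tuple has been decided; hence the first conjunct. *)
Definition Ematrix (chi : fo VV) : exp :=
  locked (EAnd (EAndL [seq EDec (codeE ts) | ts <- S_atoms chi]) (trans chi)).

Section Semantics.
Variables (n : nat) (A : structure V n) (k : nat).
Let w := instance (encode A) k.

Definition tup (e : nat -> 'I_n.+1) (ts : 'I_r -> term VV) : r.-tuple 'I_n.+1 :=
  [tuple term_eval (expand A set0) e (ts i) | i < r].

Lemma term_eval_expand S e (t : term VV) :
  term_eval (expand A S) e t = term_eval (expand A set0) e t.
Proof.
elim: t => //= F ts IH; congr fun_int; apply: eq_from_tnth => i.
by rewrite !tnth_mktuple IH.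
Qed.

Lemma tuple_term_eval S e m (ts : 'I_m -> term VV) :
  [tuple term_eval (expand A S) e (ts i) | i < m] =
  [tuple term_eval (expand A set0) e (ts i) | i < m].
Proof. by apply: eq_from_tnth => i; rewrite !tnth_mktuple term_eval_expand. Qed.

Lemma eval_fold_code rho m (f : 'I_m -> exp) (g : 'I_m -> 'I_n.+1) : rho 0 = size w ->
  (forall i, eval w rho (f i) = g i) -> eval w rho (fold_code f) = code [tuple g i | i < m].
Proof.
move=> h0 hf; rewrite /fold_code /code /= -[0 in RHS](eval_const w rho 0).
elim: (enum _) (Const 0) => //= i s IHs c; rewrite IHs !evalE eval_EN1 // lead_encode hf.
by congr foldl.
Qed.

Lemma eval_TE rho (e : nat -> 'I_n.+1) (t : term VV) : rho 0 = size w ->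
  (forall x, rho (Fn x) = e x) -> eval w rho (TE t) = term_eval (expand A set0) e t.
Proof.
elim: t rho => [x|F ts IH] rho h0 he; first by rewrite evalE he.
rewrite [TE _]/= eval_sum eval_EN1 // lead_encode big_mkord /=.
set v := [tuple _ | i < _].
have hv (a : 'I_n.+1) : eval w (upd rho 6 a) (Mul (EVar 6) (In (Add EK1 (Add (@EFoff V F)
    (Add (Mul (fold_code (fun i => TE (ts i))) EN1) (EVar 6)))))) = a * (fun_int A v == a).
  have h0' : upd rho 6 a 0 = size w by [].
  rewrite !evalE eval_EK1 // eval_EFoff // lead_encode nth_instance eval_EN1 // lead_encode.
  rewrite (@eval_fold_code _ _ _ (fun i => term_eval (expand A set0) e (ts i))) //.
    by rewrite -[upd rho 6 a 6]/(nat_of_ord a) nth_encode_fun.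
  move=> i; apply: IH => // x; rewrite -he /upd /Fn; case: eqP => //; lia.
rewrite (eq_bigr _ (fun a _ => hv a)) (bigD1 (fun_int A v)) //= eqxx muln1 big1 ?addn0 //.
by move=> a ha; rewrite eq_sym (negbTE ha) muln0.
Qed.

Lemma eval_codeE rho (e : nat -> 'I_n.+1) m (ts : 'I_m -> term VV) : rho 0 = size w ->
  (forall x, rho (Fn x) = e x) ->
  eval w rho (codeE ts) = code [tuple term_eval (expand A set0) e (ts i) | i < m].
Proof. by move=> h0 he; apply: eval_fold_code => // i; exact: eval_TE. Qed.

(* The tuples which the element with digits Z certifies to be in S. *)
Definition SZ (Z : nat -> nat) : {set r.-tuple 'I_n.+1} :=
  [set v | has (fun l => Z (D + l.*2) == (code v).+1) (iota 0 d)].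

Definition decided (Z : nat -> nat) (c : nat) : bool :=
  has (fun l => (Z (D + l.*2) == c) ||
    [&& Z (D + l.*2) < c, c < Z (D + l.*2.+1) & Z l.*2.+1 == Z l.*2 + 1]) (iota 0 d).

Definition matrix_sem (chi : fo VV) (Z : nat -> nat) (e : nat -> 'I_n.+1) : Prop :=
  all (fun ts => decided Z (code (tup e ts)).+1) (S_atoms chi) /\
  fo_sat (expand A (SZ Z)) e chi.

Section Env.
Variables (rho : nat -> nat) (e : nat -> 'I_n.+1).
Hypotheses (h0 : rho 0 = size w) (he : forall x, rho (Fn x) = e x).
Let Z j := rho (Zn j).

Lemma holds_TA a : holds w rho (TA a) = atom_eval (expand A (SZ Z)) e a.
Proof.
case: a => [t u|[R|] ts] /=.
- by rewrite holds_eq !(eval_TE _ h0 he) !(term_eval_expand (SZ Z)).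
- rewrite holds_in !eval_add eval_EK1 // eval_ERoff // lead_encode nth_instance.
  rewrite (eval_codeE _ h0 he) nth_encode_rel; congr rel_int.
  by apply: eq_from_tnth => i; rewrite !tnth_mktuple term_eval_expand.
- rewrite holds_orL has_map inE; apply: eq_has => l /=.
  rewrite holds_eq !evalE (eval_codeE _ h0 he) addn1 /Z; congr (_ == (code _).+1).
  by apply: eq_from_tnth => i; rewrite !tnth_mktuple term_eval_expand.
Qed.

Lemma holds_trans chi : fo_qf chi ->
  holds w rho (trans chi) <-> fo_sat (expand A (SZ Z)) e chi.
Proof.
elim: chi => //= [a _|p IHp /IHp h|p IHp q IHq /andP[/IHp h1 /IHq h2]|p IHp q IHq /andP[/IHp h1 /IHq h2]].
- by rewrite holds_TA.
- by rewrite holds_not -h; split=> /negP.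
- by rewrite holds_and -h1 -h2; split=> /andP.
- by rewrite holds_or -h1 -h2; split=> /orP.
Qed.

Lemma holds_EDec ts : holds w rho (EDec (codeE ts)) = decided Z (code (tup e ts)).+1.
Proof.
rewrite holds_orL has_map; apply: eq_has => l /=.
by rewrite holds_or !holds_and !holds_eq !holds_lt !evalE (eval_codeE _ h0 he) addn1 andbA.
Qed.

Lemma holds_Ematrix chi : fo_qf chi ->
  holds w rho (Ematrix chi) <-> matrix_sem chi Z e.
Proof.
move=> hq; rewrite /Ematrix -lock holds_and holds_andL all_map /matrix_sem -(holds_trans hq).
rewrite (eq_all (a2 := fun ts => decided Z (code (tup e ts)).+1)); first by split=> /andP.
exact: holds_EDec.
Qed.
End Env.

(** * Sets of tuples as increasing sequences *)

Notation N := (n.+1 ^ r).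

(** The sentinel indices may be included in the range of [i]: their values 0 and N + 1 are not of
    the form [(code v).+1]. *)
Definition lists (s : nat -> nat) (S : {set r.-tuple 'I_n.+1}) : Prop :=
  listing k N s /\ forall v, (v \in S) <-> exists2 i, i <= k.+1 & s i = (code v).+1.

(** Truthfulness makes every certified tuple a member of [S]. A tuple decided negatively lies
    strictly between consecutive values of [s], so by monotonicity it is not listed. Thus both sets
    agree on all tuples that [chi] asks about. *)
Lemma fo_sat_SZ chi Z e s S : fo_qf chi -> lists s S -> truthful k D s Z ->
  all (fun ts => decided Z (code (tup e ts)).+1) (S_atoms chi) ->
  fo_sat (expand A (SZ Z)) e chi <-> fo_sat (expand A S) e chi.
Proof.
move=> + [[_ _ smono] hS] hZ.
elim: chi => //= [[t u|[R|] ts] _|p IHp hq|p IHp q IHq /andP[hp hq]|p IHp q IHq /andP[hp hq]].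
- by rewrite /= !(term_eval_expand (SZ Z)) !(term_eval_expand S).
- by move=> _ /=; rewrite !(tuple_term_eval (SZ Z)) !(tuple_term_eval S).
- have tupE S' : [tuple term_eval (expand A S') e (ts i) | i < r] = tup e ts.
    exact: tuple_term_eval.
  rewrite /= andbT => /hasP [l]; rewrite mem_iota => /= hl hdec.
  rewrite !tupE inE; split.
    case/hasP => l'; rewrite mem_iota => /= hl' /eqP e'; apply/hS.
    by have [h1 h2] := hZ l'.*2 ltac:(lia); exists (Z l'.*2); rewrite // -h2.
  case/hS => i hi ei; apply/hasP; exists l; first by rewrite mem_iota.
  case/orP: hdec => // /and3P[h1 h2 /eqP h3].
  have [g1 g2] := hZ l.*2 ltac:(lia); have [g3 g4] := hZ l.*2.+1 ltac:(lia).
  rewrite g2 -ei in h1; rewrite g4 h3 addn1 -ei in h2.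
  rewrite h3 addn1 in g3.
  have [hlt|hge] := ltnP (Z l.*2) i.
    move: hlt; rewrite leq_eqVlt => /orP[/eqP eq|hlt]; first by rewrite eq ltnn in h2.
    by have := smono _ _ hlt hi; lia.
  move: hge; rewrite leq_eqVlt => /orP[/eqP eq|hlt]; first by rewrite eq ltnn in h1.
  by have := smono _ _ hlt g1; lia.
- by move=> /(IHp hq) ->.
- by rewrite all_cat => /andP[/(IHp hp) -> /(IHq hq) ->].
- by rewrite all_cat => /andP[/(IHp hp) -> /(IHq hq) ->].
Qed.

Lemma locate s c : listing k N s -> 0 < c -> c <= N ->
  (exists2 i, i <= k.+1 & s i = c) \/ (exists2 i, i <= k & s i < c < s i.+1).
Proof.
move=> [s0 s1 smono] hc hN.
have h j : j <= k.+1 -> c < s j ->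
    (exists2 i, i <= k.+1 & s i = c) \/ (exists2 i, i <= k & s i < c < s i.+1).
  elim: j => [|j IHj] hj hcj; first by rewrite s0 in hcj.
  case: (ltngtP (s j) c) => h.
  - by right; exists j => //; rewrite h hcj.
  - by apply: IHj => //; exact: ltnW.
  - by left; exists j => //; exact: ltnW.
by apply: (h k.+1) => //; rewrite s1 ltnS.
Qed.

(** The atom number l receives the l-th certificate: a member listed at i gets the indices (i, i), a
    nonmember the two neighbouring indices. *)
Lemma matrix_complete chi e s S : fo_qf chi -> size (S_atoms chi) <= d -> lists s S ->
  fo_sat (expand A S) e chi ->
  exists2 h : nat -> nat, (forall l, h l <= k.+1) &
    forall Z, (forall l, l < D -> Z l = h l /\ Z (D + l) = s (h l)) -> matrix_sem chi Z e.
Proof.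
move=> hq hd hS hsat; have [hl _] := hS.
have /fin_all_exists[f hf] : forall v : r.-tuple 'I_n.+1, exists p : nat * nat,
    [/\ p.1 <= k.+1, p.2 <= k.+1 &
      (s p.1 = (code v).+1) \/ [/\ s p.1 < (code v).+1, (code v).+1 < s p.2 & p.2 = p.1 + 1]].
  move=> v; have [[i hi e1]|[i hi /andP[e1 e2]]] := locate hl (ltn0Sn (code v)) (code_lt v).
    by exists (i, i); split=> //; left.
  by exists (i, i.+1); split=> //=; [exact: leqW | right; split; rewrite ?addn1].
(* Slots beyond the number of atoms certify this default tuple; they only have to be truthful. *)
pose t0 : r.-tuple 'I_n.+1 := [tuple ord0 | _ < r].
pose vs := [seq tup e ts | ts <- S_atoms chi].
pose h j := let p := f (nth t0 vs j./2) in if odd j then p.2 else p.1.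
exists h => [l|Z hZ]; first by rewrite /h; case: (hf (nth t0 vs l./2)); case: ifP.
have hdec : all (fun ts => decided Z (code (tup e ts)).+1) (S_atoms chi).
  rewrite -(all_map (tup e) (fun v => decided Z (code v).+1)) -/vs.
  apply/(all_nthP t0) => l hl'; have hld : l < d by rewrite /vs size_map in hl'; lia.
  apply/hasP; exists l; first by rewrite mem_iota.
  have [g1 g2] := hZ l.*2 ltac:(lia); have [g3 g4] := hZ l.*2.+1 ltac:(lia).
  rewrite g1 g2 g3 g4 /h /= odd_double doubleK uphalf_double /=.
  case: (hf (nth t0 vs l)) => _ _ [->|[h1 h2 h3]]; first by rewrite eqxx.
  by rewrite h1 h2 h3 eqxx orbT.
split=> //; apply/(fo_sat_SZ hq hS _ hdec) => //.
move=> l hl'; have [-> ->] := hZ l hl'; split=> //.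
by rewrite /h; case: (hf (nth t0 vs l./2)); case: ifP.
Qed.

Lemma lists_of_set (S : {set r.-tuple 'I_n.+1}) : #|S| = k -> exists s, lists s S.
Proof.
move=> hk; pose l := sort leq [seq code v | v <- enum S].
have hl : size l = k by rewrite size_sort size_map -cardE.
have ul : sorted ltn l.
  rewrite ltn_sorted_uniq_leq sort_uniq map_inj_uniq ?enum_uniq //; last exact: code_inj.
  exact: (sort_sorted leq_total).
pose L := 0 :: rcons (map succn l) N.+1.
have lN c : c \in l -> c < N by rewrite mem_sort => /mapP[v _ ->]; exact: code_lt.
have sL : sorted ltn L.
  rewrite /L /= rcons_path; apply/andP; split.
    case: (l) ul => //= c l'; rewrite path_map; exact.
  have [->|] := l =P [::]; first by [].
  by move=> /eqP; case/lastP: (l) lN => // l' c lN _; rewrite map_rcons last_rcons /= ltnS lN // mem_rcons mem_head.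
exists (nth 0 L); split.
  split=> //; first by rewrite /L /= nth_rcons size_map hl ltnn eqxx.
  move=> i j hij hj; apply: (sorted_ltn_nth ltn_trans) => //; rewrite inE /= size_rcons size_map hl; lia.
move=> v; split=> [hv|[i hi]].
  have hc : (code v).+1 \in L.
    rewrite inE mem_rcons inE map_f ?orbT // mem_sort; apply: map_f; by rewrite mem_enum.
  exists (index (code v).+1 L); last exact: nth_index.
  by have := hc; rewrite -index_mem /= size_rcons size_map hl ltnS.
case: i hi => [|i] //= hi; rewrite nth_rcons size_map hl; case: ltngtP => // [hik|_].
  rewrite (nth_map 0) ?hl // => -[e1]; have : nth 0 l i \in l by rewrite mem_nth ?hl.
  by rewrite e1 mem_sort => /mapP[v' + /code_inj ->]; rewrite mem_enum.
by move=> [e1]; have := code_lt v; rewrite -e1 ltnn.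
Qed.

Lemma set_of_listing s : listing k N s ->
  exists2 S : {set r.-tuple 'I_n.+1}, #|S| = k & lists s S.
Proof.
move=> hs; have [s0 s1 smono] := hs.
have /fin_all_exists[f hf] : forall i : 'I_k, exists v : r.-tuple 'I_n.+1, (code v).+1 = s i.+1.
  move=> i; have h1 := smono 0 i.+1 isT (ltnW (ltn_ord i)); rewrite s0 in h1.
  have h2 := smono i.+1 k.+1 (ltn_ord i) (leqnn _); rewrite s1 in h2.
  by have [|v hv] := @code_onto n r (s i.+1).-1; [lia | exists v; rewrite hv; lia].
have f_inj : injective f.
  move=> i j e1; have e2 : s i.+1 = s j.+1 by rewrite -!hf e1.
  apply: val_inj => /=; case: (ltngtP i j) => // h.
    by have := smono i.+1 j.+1 h (ltnW (ltn_ord j)); rewrite e2 ltnn.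
  by have := smono j.+1 i.+1 h (ltnW (ltn_ord i)); rewrite e2 ltnn.
exists [set f i | i in [set: 'I_k]]; first by rewrite card_imset // cardsT card_ord.
split=> // v; split=> [/imsetP[i _ ->]|[i hi ei]].
  by exists i.+1; [exact: ltnW (ltn_ord i) | rewrite hf].
have hik : 0 < i <= k.
  have := code_lt v; case: i hi ei => [|i] hi ei; first by rewrite s0 in ei.
  move: hi; rewrite leq_eqVlt => /orP[/eqP e1|//]; rewrite e1 s1 in ei; lia.
have hi' : i.-1 < k by lia.
apply/imsetP; exists (Ordinal hi') => //; apply: code_inj; apply: succn_inj.
by rewrite hf /= -ei prednK //; case/andP: hik.
Qed.

End Semantics.
End Trans.
End Translation.

(** * The incidence relation as a formula *)

Section Hit.
Variables (V : vocab) (r : nat) (chi : fo (vocab_ext V r)) (xs ys : seq nat).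

(** The successor guarantees two slots per element even if no atom mentions S. *)
Definition pair_count := (size (S_atoms chi)).+1.
Definition slot_count := pair_count.*2.
(** Large enough for the 2D digits of an element, for the tag, D indices and value of a consistency
    clause, and for the tag and the universal values of a main clause. *)
Definition digit_count := slot_count.*2 + size xs + 2.

Notation D := slot_count.
Notation m := digit_count.
Notation Y j := (EVar (Yn j)).
Notation Z j := (EVar (Zn j)).

Definition EOk : exp := locked (EAnd
  (EAndL [seq EAnd (ELe (Z l) EK1) (EAnd (EImp (EEq (Z l) (Const 0)) (EEq (Z (D + l)) (Const 0)))
      (EImp (EEq (Z l) EK1) (EEq (Z (D + l)) (Add (EPow EN1 r) (Const 1))))) | l <- iota 0 D])
  (EImp (ELt (Z 0) (Z 1)) (ELt (Z D) (Z D.+1)))).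

Definition ERange : exp := locked (EAndL [seq ELe (Y l.+1) EK1 | l <- iota 0 D]).

Definition EBlock : exp :=
  locked (EImp ERange (EAndL [seq EEq (Z l) (Y l.+1) | l <- iota 0 D])).

Definition ECons (l : nat) : exp := locked (EImp ERange (EOr
  (EAnd (EAndL [seq EEq (Z j) (Y j.+1) | j <- iota 0 D]) (ENot (EEq (Z (D + l)) (Y D.+1))))
  (EAnd (EAndL [seq EEq (Z j) (Y l.+1) | j <- iota 0 D]) (EEq (Z D) (Y D.+1))))).

(** Copies clause digits into first-order variables by bounded universal quantifiers, so that a
    digit outside the universe makes the clause vacuously true. *)
Fixpoint EGuard (zs : seq nat) (i : nat) (body : exp) : exp :=
  if zs is z :: zs' then
    EAll (Fn z) EN1 (EImp (EEq (EVar (Fn z)) (Y i)) (EGuard zs' i.+1 body))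
  else body.

Definition EMain : exp :=
  locked (EGuard xs 1 (EExs [seq Fn y | y <- ys] EN1 (Ematrix pair_count chi))).

Definition EBody : exp := locked (EAnd EOk (EOr (EAnd (EEq (Y 0) (Const 0)) EBlock)
  (EOr (EOrL [seq EAnd (EEq (Y 0) (Const l.+1)) (ECons l) | l <- iota 0 D])
       (EAnd (ELt (Const D) (Y 0)) EMain)))).

(** The input length exceeds both the parameter and the size of the universe; the exponent [r.+1]
    leaves room for the value N + 1, and the summand [D.+2] for the tags. *)
Definition EBase : exp := locked (EPow (Add (EVar 0) (Const D.+2)) r.+1).

Definition ENum (zs : seq nat) : exp :=
  foldr (fun z e => Add (EVar z) (Mul EBase e)) (Const 0) zs.

(** Expressions have no division, so the digits of the two vertices are guessed and checked against
    the vertices. [EValid V] removes all edges when the input encodes no structure. *)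
Definition EHit : exp := EAnd (EValid V)
  (EExs [seq Yn j | j <- iota 0 m] EBase (EExs [seq Zn j | j <- iota 0 m] EBase
    (EAnd (EEq (EVar 1) (ENum [seq Yn j | j <- iota 0 m]))
      (EAnd (EEq (EVar 2) (ENum [seq Zn j | j <- iota 0 m])) EBody)))).

(** * Semantics of the incidence formula *)

Section Spec.
Variables (n : nat) (A : structure V n) (k : nat).
Let w := instance (encode A) k.
Notation N := (n.+1 ^ r).
Definition radix := (size w + D.+2) ^ r.+1.

Lemma eval_EBase rho : rho 0 = size w -> eval w rho EBase = radix.
Proof. by move=> h; rewrite /EBase -lock eval_pow !evalE h. Qed.

Definition fenv (vs us : seq nat) : nat -> 'I_n.+1 :=
  upds (upds (fun _ => ord0) xs (map inord vs)) ys (map inord us).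

Definition matrix_at (Z : nat -> nat) (vs us : seq nat) : Prop :=
  matrix_sem pair_count A chi Z (fenv vs us).

Lemma upds_Fn (rho : nat -> nat) (e : nat -> 'I_n.+1) zs vs x :
  (forall x, rho (Fn x) = e x) -> all (fun v => v <= n) vs ->
  upds rho [seq Fn z | z <- zs] vs (Fn x) = upds e zs (map inord vs) x.
Proof.
elim: zs rho e vs => [|z zs IH] rho e [|v vs] //= he /andP[hv hvs].
apply: IH => // x'; rewrite /upd.
have -> : (Fn x' == Fn z) = (x' == z) by rewrite /Fn; lia.
by case: eqP => // _; rewrite inordK.
Qed.

Lemma notin_Fn (zs : seq nat) y : y %% 3 != 0 \/ y < 9 -> y \notin [seq Fn z | z <- zs].
Proof. by move=> h; apply/mapP => -[z _ e]; rewrite e /Fn in h; lia. Qed.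

Section Body.
Variable rho : nat -> nat.
Hypothesis h0 : rho 0 = size w.
Let Yf j := rho (Yn j).
Let Zf j := rho (Zn j).

Lemma holds_EOk : holds w rho EOk <-> ok k N D Zf.
Proof.
rewrite /EOk -lock holds_and; split=> [/andP[/holds_andn h1 h2]|[h1 h2]].
  split=> [l /h1|].
    rewrite !holds_and !holds_imp !holds_le !holds_eq !eval_add eval_pow !eval_var !eval_const.
    rewrite eval_EK1 // eval_EN1 // lead_encode addn1.
    case/and3P => h3 /implyP h4 /implyP h5; split=> // e.
      by apply/eqP/h4/eqP.
    by apply/eqP/h5/eqP.
  by move: h2; rewrite holds_imp !holds_lt => /implyP.
apply/andP; split; last by rewrite holds_imp !holds_lt; apply/implyP.
apply/holds_andn => l /h1 [h3 h4 h5].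
rewrite !holds_and !holds_imp !holds_le !holds_eq !eval_add eval_pow !eval_var !eval_const.
rewrite eval_EK1 // eval_EN1 // lead_encode addn1.
apply/and3P; split=> //; apply/implyP => /eqP e; apply/eqP; [exact: h4 | exact: h5].
Qed.

Lemma holds_ERange : holds w rho ERange <-> range_idx k D Yf.
Proof.
rewrite /ERange -lock; split=> [/holds_andn h l /h|h]; last apply/holds_andn => l /h.
  by rewrite holds_le eval_EK1.
by rewrite holds_le eval_EK1.
Qed.

Lemma holds_eqs (f : nat -> nat) :
  holds w rho (EAndL [seq EEq (Z j) (Y (f j)) | j <- iota 0 D]) <->
  forall j, j < D -> Zf j = Yf (f j).
Proof.
split=> [/holds_andn h j /h|h]; first by rewrite holds_eq => /eqP.
by apply/holds_andn => j /h; rewrite holds_eq => /eqP.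
Qed.

Lemma holds_EBlock : holds w rho EBlock <-> block_cl k D Yf Zf.
Proof.
rewrite /EBlock -lock holds_imp; split=> [/implyP h /(proj2 holds_ERange) /h|h].
  exact: (proj1 (holds_eqs succn)).
by apply/implyP => /holds_ERange /h; exact: (proj2 (holds_eqs succn)).
Qed.

Lemma holds_ECons l : holds w rho (ECons l) <-> cons_cl k D l Yf Zf.
Proof.
have [p1 p2] := holds_eqs succn; have [q1 q2] := holds_eqs (fun _ => l.+1).
rewrite /ECons -lock holds_imp; split=> [/implyP h /(proj2 holds_ERange) /h|h].
  rewrite holds_or !holds_and holds_not !holds_eq => /orP[]/andP[].
    by move=> /p1 h1 /eqP h2; left.
  by move=> /q1 h1 /eqP h2; right.
apply/implyP => /holds_ERange /h; rewrite holds_or !holds_and holds_not !holds_eq.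
case=> -[h1 h2]; apply/orP; [left | right]; apply/andP; split; try exact/eqP.
  exact: p2.
exact: q2.
Qed.

End Body.

Lemma holds_EGuard rho zs i body : rho 0 = size w ->
  holds w rho (EGuard zs i body) <->
  forall vs, tuple_le n (size zs) vs ->
    (forall j, j < size zs -> nth 0 vs j = rho (Yn (i + j))) ->
    holds w (upds rho [seq Fn z | z <- zs] vs) body.
Proof.
elim: zs rho i => [|z zs IH] rho i h0.
  split=> [h [|v vs] //|h]; exact: (h [::]).
have h0' v : upd rho (Fn z) v 0 = size w by rewrite /upd /Fn addnC.
have hY v j : upd rho (Fn z) v (Yn j) = rho (Yn j).
  by rewrite /upd /Fn /Yn; case: eqP => //; lia.
split.
  move/holds_all => h [|v vs] // /andP[/eqP [sz] /= /andP[hv hvs]] hj.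
  have := h v; rewrite eval_EN1 // lead_encode ltnS holds_imp => /(_ hv)/implyP.
  rewrite holds_eq !eval_var hY {1}/upd eqxx.
  have := hj 0 isT; rewrite addn0 /= => ->; rewrite eqxx => /(_ isT).
  move/(IH _ i.+1 (h0' _)); apply; first by rewrite /tuple_le sz eqxx.
  by move=> j hj'; rewrite hY addSnnS -(hj j.+1).
move=> h; apply/holds_all => v; rewrite eval_EN1 // lead_encode ltnS => hv.
rewrite holds_imp; apply/implyP; rewrite holds_eq !eval_var hY {1}/upd eqxx => /eqP e.
apply/(IH _ i.+1 (h0' _)) => vs /andP[/eqP sz hvs] hj.
apply: (h (v :: vs)); first by rewrite /tuple_le /= sz eqxx hv.
by case=> [|j] hj'; rewrite ?addn0 // /= hj // hY addSnnS.
Qed.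

Hypothesis hq : fo_qf chi.

(** The hypothesis on [rho (Fn x)] matches the default value [ord0] from which [fenv] starts. *)
Lemma holds_EMain rho : rho 0 = size w -> (forall x, rho (Fn x) = 0) ->
  holds w rho EMain <->
  main_cl n (size xs) (size ys) matrix_at (fun j => rho (Yn j)) (fun j => rho (Zn j)).
Proof.
move=> h0 hF; pose rv vs := upds rho [seq Fn z | z <- xs] vs.
have rv0 vs : rv vs 0 = size w by rewrite /rv upds_notin // notin_Fn //; right.
pose ru vs us := upds (rv vs) [seq Fn z | z <- ys] us.
have hM vs us : tuple_le n (size xs) vs -> tuple_le n (size ys) us ->
    holds w (ru vs us) (Ematrix pair_count chi) <-> matrix_at (fun j => rho (Zn j)) vs us.
  move=> /andP[_ hvs] /andP[_ hus].
  have e0 : ru vs us 0 = size w by rewrite /ru upds_notin // notin_Fn //; right.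
  have e1 x : ru vs us (Fn x) = fenv vs us x.
    by rewrite /ru /fenv; apply: upds_Fn => // x'; apply: upds_Fn.
  have -> : (fun j => rho (Zn j)) = (fun j => ru vs us (Zn j)).
    apply: functional_extensionality => j; rewrite /ru /rv.
    by rewrite !upds_notin // notin_Fn //; left; rewrite /Zn; lia.
  exact: (@holds_Ematrix V r pair_count n A k _ _ e0 e1 chi hq).
have hex vs : tuple_le n (size xs) vs ->
    holds w (rv vs) (EExs [seq Fn y | y <- ys] EN1 (Ematrix pair_count chi)) <->
    exists2 us, tuple_le n (size ys) us & matrix_at (fun j => rho (Zn j)) vs us.
  move=> hvs; rewrite (@holds_exs _ _ _ _ _ n.+1); first last.
  - by rewrite notin_Fn //; right.
  - by move=> rho' e0; rewrite eval_EN1 ?lead_encode // e0.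
  split=> [[us [h1 h2 h3]]|[us hus hm']].
    rewrite size_map in h1.
    have hus : tuple_le n (size ys) us by rewrite /tuple_le h1 eqxx.
    by exists us => //; apply/hM.
  by exists us; move/andP: (hus) => [/eqP h1 h2]; rewrite size_map; split=> //; apply/hM.
rewrite /EMain -lock holds_EGuard //; split=> [h vs hvs hj|h vs hvs hj].
  by apply/hex => //; exact: h.
by apply/hex => //; exact: h.
Qed.

Lemma holds_EBody rho : rho 0 = size w -> (forall x, rho (Fn x) = 0) ->
  holds w rho EBody <->
  ok k N D (fun j => rho (Zn j)) /\
  clause k n D (size xs) (size ys) matrix_at (fun j => rho (Yn j)) (fun j => rho (Zn j)).
Proof.
move=> h0 hF; have kOk := @holds_EOk rho h0; have kB := @holds_EBlock rho h0.
have kC l := @holds_ECons rho h0 l; have kM := @holds_EMain rho h0 hF.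
rewrite /EBody -lock holds_and !holds_or !holds_and holds_eq holds_lt !eval_var !eval_const.
split.
  case/andP => /kOk hok hc; split=> //.
  case/or3P: hc => [/andP[/eqP e /kB h]|/holds_orn [l hl]|/andP[h1 /kM h2]].
  - by constructor 1.
  - rewrite holds_and holds_eq => /andP[/eqP e /kC h].
    by constructor 2; exists l.
  - by constructor 3.
case=> /kOk -> hc; rewrite andTb; apply/or3P; case: hc => [[e h]|[l hl [e h]]|[h1 h2]].
- by constructor 1; rewrite e eqxx /=; apply/kB.
- constructor 2; apply/(@holds_orn w rho (fun l => EAnd (EEq (Y 0) (Const l.+1)) (ECons l))); exists l => //; rewrite holds_and holds_eq; apply/andP; split.
    by rewrite eval_var e.
  exact/kC.
- by constructor 3; rewrite h1 /=; apply/kM.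
Qed.

(** [hits] speaks of digit functions on all of nat, so the digits beyond [m] have to agree with the
    unassigned variables, which are 0. *)
Lemma dig_ge B e j i : 0 < B -> e < B ^ i -> i <= j -> dig B e j = 0.
Proof.
move=> radix he hij; rewrite /dig divn_small ?mod0n //.
by apply: leq_trans he _; rewrite leq_pexp2l.
Qed.

Lemma radix_gt0 : 0 < radix.
Proof. by rewrite expn_gt0 addnS. Qed.

Lemma holds_EHit y e : y < radix ^ m -> e < radix ^ m ->
  holds w (upd (upd (upd (fun _ => 0) 0 (size w)) 1 y) 2 e) EHit <->
  hits k N n D radix (size xs) (size ys) matrix_at y e.
Proof.
move=> hy he; set rho := upd _ 2 e; have h0 : rho 0 = size w by [].
have hv : holds w rho (EValid V).
  by apply/(holds_EValid V h0); rewrite lead_encode; exact: encode_well_formed.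
have B0 := radix_gt0.
have inj f (c : nat) : (forall i j, f i = f j -> i = j :> nat) -> uniq [seq f j | j <- iota 0 c].
  by move=> hf; rewrite map_inj_uniq ?iota_uniq.
have uY : uniq [seq Yn j | j <- iota 0 m] by apply: inj => i j; rewrite /Yn; lia.
have uZ : uniq [seq Zn j | j <- iota 0 m] by apply: inj => i j; rewrite /Zn; lia.
have nY z : z < 9 \/ z %% 3 <> 1 -> z \notin [seq Yn j | j <- iota 0 m].
  by move=> h; apply/mapP => -[j _ ej]; rewrite ej /Yn in h; lia.
have nZ z : z < 9 \/ z %% 3 <> 2 -> z \notin [seq Zn j | j <- iota 0 m].
  by move=> h; apply/mapP => -[j _ ej]; rewrite ej /Zn in h; lia.
have szY : size [seq Yn j | j <- iota 0 m] = m by rewrite size_map size_iota.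
have szZ : size [seq Zn j | j <- iota 0 m] = m by rewrite size_map size_iota.
pose r1 vs := upds rho [seq Yn j | j <- iota 0 m] vs.
pose r2 vs us := upds (r1 vs) [seq Zn j | j <- iota 0 m] us.
have r10 vs : r1 vs 0 = size w by rewrite /r1 upds_notin // nY //; left.
have r20 vs us : r2 vs us 0 = size w by rewrite /r2 upds_notin // nZ //; left.
have r2F vs us x : r2 vs us (Fn x) = 0.
  rewrite /r2 upds_notin; last by apply: nZ; right; rewrite /Fn; lia.
  rewrite /r1 upds_notin; last by apply: nY; right; rewrite /Fn; lia.
  by rewrite /rho /upd /Fn addnC.
have r2Y vs us j : size vs = m -> j < m -> r2 vs us (Yn j) = nth 0 vs j.
  move=> sz hj; rewrite /r2 upds_notin; last by apply: nZ; right; rewrite /Yn; lia.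
  rewrite -(@upds_nth rho [seq Yn j | j <- iota 0 m]) ?szY //.
  by rewrite (nth_map 0) ?size_iota // nth_iota.
have r2Z vs us j : size us = m -> j < m -> r2 vs us (Zn j) = nth 0 us j.
  move=> sz hj; rewrite -(@upds_nth (r1 vs) [seq Zn j | j <- iota 0 m]) ?szZ //.
  by rewrite (nth_map 0) ?size_iota // nth_iota.
have r2Y' vs us j : m <= j -> r2 vs us (Yn j) = 0.
  move=> hj; rewrite /r2 upds_notin; last by apply: nZ; right; rewrite /Yn; lia.
  rewrite /r1 upds_notin; first by rewrite /rho /upd /Yn addnC.
  by apply/mapP => -[j']; rewrite mem_iota /Yn; lia.
have r2Z' vs us j : m <= j -> r2 vs us (Zn j) = 0.
  move=> hj; rewrite /r2 upds_notin; last first.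
    by apply/mapP => -[j']; rewrite mem_iota /Zn; lia.
  rewrite /r1 upds_notin; last by apply: nY; right; rewrite /Zn; lia.
  by rewrite /rho /upd /Zn addnC.
have hnum vs us zs : eval w (r2 vs us) (ENum zs) =
    num radix (size zs) (fun j => r2 vs us (nth 0 zs j)).
  by apply: num_evars => rho' e0; apply: eval_EBase; rewrite e0.
have r2c vs us z : 0 < z < 9 -> r2 vs us z = rho z.
  case/andP => _ hz; rewrite /r2 upds_notin; last by apply: nZ; left.
  by rewrite /r1 upds_notin //; apply: nY; left.
have hbody vs us : size vs = m -> size us = m ->
    (forall j, j < m -> nth 0 vs j = dig radix y j) -> (forall j, j < m -> nth 0 us j = dig radix e j) ->
    holds w (r2 vs us) EBody <-> hits k N n D radix (size xs) (size ys) matrix_at y e.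
  move=> s1 s2 h1 h2; rewrite holds_EBody //.
  have -> : (fun j => r2 vs us (Yn j)) = dig radix y.
    apply: functional_extensionality => j; have [hj|hj] := ltnP j m; first by rewrite r2Y // h1.
    by rewrite r2Y' // (dig_ge B0 hy hj).
  have -> : (fun j => r2 vs us (Zn j)) = dig radix e.
    apply: functional_extensionality => j; have [hj|hj] := ltnP j m; first by rewrite r2Z // h2.
    by rewrite r2Z' // (dig_ge B0 he hj).
  by [].
(* Guessed digits below the radix that represent [z] are the digits of [z]. *)
have digsE vs f z : size vs = m -> all (fun v => v < radix) vs ->
    (forall j, j < m -> f j = nth 0 vs j) -> z = num radix m f ->
    forall j, j < m -> nth 0 vs j = dig radix z j.
  move=> sz /all_nthP hall hf -> j hj; rewrite dig_num // ?hf // => j' hj'.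
  by rewrite hf // hall // sz.
rewrite /EHit holds_and hv andTb (@holds_exs _ _ _ _ _ radix); first last.
- by apply: nY; left.
- by move=> rho' e0; apply: eval_EBase; rewrite e0.
split.
  case=> vs [s1 a1]; rewrite -/(r1 vs) (@holds_exs _ _ _ _ _ radix); first last.
  - by apply: nZ; left.
  - by move=> rho' e0; apply: eval_EBase; rewrite e0.
  case=> us [s2 a2]; rewrite -/(r2 vs us) !holds_and !holds_eq !hnum !eval_var !szY !szZ !r2c //.
  rewrite szY in s1; rewrite szZ in s2.
  case/and3P => /eqP e1 /eqP e2; rewrite hbody //.
    apply: digsE e1 => // j hj; rewrite (nth_map 0) ?size_iota // nth_iota //.
    exact: r2Y.
  apply: digsE e2 => // j hj; rewrite (nth_map 0) ?size_iota // nth_iota //.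
  exact: r2Z.
move=> hh; pose vs := [seq dig radix y j | j <- iota 0 m]; pose us := [seq dig radix e j | j <- iota 0 m].
have nd z j : j < m -> nth 0 [seq dig radix z j | j <- iota 0 m] j = dig radix z j.
  by move=> hj; rewrite (nth_map 0) ?size_iota // nth_iota.
have ad z : all (fun v => v < radix) [seq dig radix z j | j <- iota 0 m].
  by rewrite all_map; apply/allP => j _; exact: dig_lt.
have sd z : size [seq dig radix z j | j <- iota 0 m] = m by rewrite size_map size_iota.
exists vs; split; [by rewrite szY sd | exact: ad |].
rewrite -/(r1 vs) (@holds_exs _ _ _ _ _ radix); first last.
- by apply: nZ; left.
- by move=> rho' e0; apply: eval_EBase; rewrite e0.
exists us; split; [by rewrite szZ sd | exact: ad |].
have eqn f z : z < radix ^ m -> (forall j, j < m -> f j = dig radix z j) -> z = num radix m f.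
  move=> hz hf; rewrite -[LHS](num_dig hz); elim: (m) f (dig radix z) hf => //= c IH f g hf.
  by rewrite hf // (IH (fun j => f j.+1) (fun j => g j.+1)) // => j hj; exact: (hf j.+1).
rewrite -/(r2 vs us) !holds_and !holds_eq !hnum !eval_var !szY !szZ !r2c //.
apply/and3P; split.
- apply/eqP/eqn => // j hj; rewrite (nth_map 0) ?size_iota // nth_iota //.
  by rewrite r2Y ?sd // nd.
- apply/eqP/eqn => // j hj; rewrite (nth_map 0) ?size_iota // nth_iota //.
  by rewrite r2Z ?sd // nd.
- by apply/hbody => // [||j hj|j hj]; [exact: sd | exact: sd | exact: nd | exact: nd].
Qed.

End Spec.

Lemma holds_EHit_valid x k rho : rho 0 = size (instance x k) ->
  holds (instance x k) rho EHit -> exists n (A : structure V n), x = encode A.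
Proof.
move=> h0; rewrite holds_and => /andP[/(holds_EValid V h0) h _].
exact: encode_of_well_formed h.
Qed.

End Hit.

(** * The team formula and hitting sets *)

Definition digraph : vocab :=
  @Vocab unit (fun _ => 2) void (fun _ => 0).

Definition edge n (A : structure digraph n) (a b : 'I_n.+1) : bool :=
  @rel_int digraph n A tt [tuple if i == ord0 then a else b | i < 2].

(** Variable 0 is the free one, 1 will be quantified universally and 2 existentially. *)
Definition dom_theta : teamfo digraph :=
  TAnd (@TIncl digraph 1 (fun _ => Var 2) (fun _ => Var 0))
    (TLit true (@Rel digraph tt (fun i : 'I_2 => Var (if i == ord0 then 1 else 2)))).

Definition dom_phi : teamfo digraph := TAll 1 (TEx 2 dom_theta).

Section Teams.
Local Open Scope fset_scope.
Local Open Scope fmap_scope.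

Lemma team_fv_dom_phi : team_fv dom_phi = [fset 0].
Proof.
apply/fsetP => x; rewrite /= !big_ord_recl !big_ord0 /= !inE !orbF.
by case: x => [|[|[|x]]].
Qed.

Variables (n : nat) (A : structure digraph n).

Definition single (a : 'I_n.+1) : assignment n := ([fmap] : assignment n).[0 <- a].

Lemma env_set (s : assignment n) x a y : env s.[x <- a] y = if y == x then a else env s y.
Proof. by rewrite /env fnd_set; case: eqP. Qed.

Lemma env_single a : env (single a) 0 = a.
Proof. by rewrite env_set. Qed.

Lemma domf_single a : domf (single a) = [fset 0].
Proof. by rewrite dom_setf; apply/fsetP => x; rewrite !inE orbF. Qed.

Lemma single_env (s : assignment n) : domf s = [fset 0] -> s = single (env s 0).
Proof.
move=> hs; apply/fmapP => y; rewrite fnd_set /env; case: eqP => [->|/eqP ne].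
  have h0 : 0 \in domf s by rewrite hs inE.
  by rewrite (in_fnd h0).
have hy : y \notin domf s by rewrite hs inE.
by rewrite !not_fnd.
Qed.

(** For the converse, the existential quantifier takes all values that are attained at variable 0 in
    the team and joined to variable 1 by an edge. *)
Lemma team_sat_dom_phi (T : {fset assignment n}) :
  team_sat A T dom_phi <->
  forall s, s \in T -> forall b, exists2 s', s' \in T & edge A b (env s' 0).
Proof.
have litE (s : assignment n) : atom_eval A (env s)
    (@Rel digraph tt (fun i : 'I_2 => Var (if i == ord0 then 1 else 2))) = edge A (env s 1) (env s 2).
  by rewrite /edge /=; congr (rel_int A); apply: eq_from_tnth => i; rewrite !tnth_mktuple; case: ifP.
split.
  case=> f [hf [hincl hlit]] s sT b.
  have t1 : s.[1 <- b] \in [fset s.[1 <- a] | s in T, a in [set: 'I_n.+1]].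
    by apply: in_imfset2 => //; rewrite inE.
  have /set0Pn [c hc] := hf _ t1.
  have t2 : s.[1 <- b].[2 <- c] \in [fset t.[2 <- a] | t in
      [fset s.[1 <- a] | s in T, a in [set: 'I_n.+1]], a in f t].
    by apply: in_imfset2.
  have [s2 [/imfset2P [s1 /imfset2P [s' s'T [b' _ ->]] [c' _ ->]] /(_ ord0)]] := hincl _ t2.
  rewrite /= !env_set /= => ec; exists s' => //; rewrite -ec.
  by have := hlit _ t2; rewrite litE !env_set.
move=> h; pose f (t : assignment n) : {set 'I_n.+1} :=
  [set c | (c \in [seq env s 0 | s <- enum_fset T]) && edge A (env t 1) c].
exists f; split.
  move=> t /imfset2P [s sT [b _ ->]]; have [s' s'T hs'] := h s sT b.
  apply/set0Pn; exists (env s' 0); rewrite inE env_set /= hs' andbT.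
  by apply: map_f.
split=> t /imfset2P [u /imfset2P [s sT [b _ ->]] [c]].
  rewrite inE => /andP[/mapP [s' s'T ec] _] ->.
  (* [s'] must survive into the extended team for the inclusion atom; it does so with [ord0] for
     variable 1 and some witness of the edge condition for variable 2. *)
  have [s'' s''T he] := h s' s'T ord0.
  exists s'.[1 <- ord0].[2 <- env s'' 0]; split.
    apply: in_imfset2; first by apply: in_imfset2 => //; rewrite inE.
    by rewrite inE env_set /= he andbT; apply: map_f.
  by move=> i /=; rewrite !env_set.
rewrite inE => /andP[_ hc] ->; rewrite litE !env_set /=.
by rewrite env_set in hc.
Qed.

Lemma card_team (T : {fset assignment n}) (S : {set 'I_n.+1}) :
  (forall s, (s \in T) = (s \in map single (enum S))) -> #|` T| = #|S|.
Proof.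
move=> h; have -> : T = seq_fset tt (map single (enum S)).
  by apply/fsetP => s; rewrite h seq_fsetE.
rewrite size_seq_fset undup_id ?size_map ?cardE // map_inj_uniq ?enum_uniq //.
by move=> a b e; rewrite -(env_single a) e env_single.
Qed.

(** The first alternative reflects that the empty team satisfies the formula. *)
Definition hitting (S : {set 'I_n.+1}) : Prop :=
  S = set0 \/ forall y, exists2 z, z \in S & edge A y z.

Lemma team_hitting k :
  (exists T : {fset assignment n},
    [/\ forall s, s \in T -> domf s = team_fv dom_phi, #|` T| = k & team_sat A T dom_phi]) <->
  exists S : {set 'I_n.+1}, #|S| = k /\ hitting S.
Proof.
split=> [[T [hd <- /team_sat_dom_phi hT]]|[S [<- hS]]].
  pose S := [set a | single a \in T].
  have hs s : s \in T -> s = single (env s 0).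
    by move=> /hd; rewrite team_fv_dom_phi; exact: single_env.
  exists S; split.
    apply/esym/card_team => s; apply/idP/mapP => [sT|[a]].
      by exists (env s 0); [rewrite mem_enum inE -hs | exact: hs].
    by rewrite mem_enum inE => ha ->.
  have [->|[a]] := set_0Vmem S; first by left.
  rewrite inE => aT; right=> y; have [s' s'T h] := hT _ aT y.
  by exists (env s' 0); rewrite // inE -hs.
exists (seq_fset tt (map single (enum S))).
have memT s : (s \in seq_fset tt (map single (enum S))) = (s \in map single (enum S)).
  by rewrite seq_fsetE.
split; first by move=> s; rewrite memT team_fv_dom_phi => /mapP [a _ ->]; exact: domf_single.
  exact: card_team.
apply/team_sat_dom_phi => s; rewrite memT => /mapP [a]; rewrite mem_enum => aS _ b.
case: hS => [S0|/(_ b) [z zS hz]]; first by rewrite S0 inE in aS.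
by exists (single z); [rewrite memT map_f // mem_enum | rewrite env_single].
Qed.

End Teams.

Lemma pWT_hitting x k : pWT dom_phi x k <->
  exists n (A : structure digraph n), x = encode A /\
  exists S : {set 'I_n.+1}, #|S| = k /\ hitting A S.
Proof.
split=> -[n [A [hx h]]]; exists n, A; split=> //; exact/team_hitting.
Qed.

(** * Membership in W[2] *)

Definition dom_S (x : nat) : fo (vocab_ext digraph 1) :=
  FAtom (@Rel (vocab_ext digraph 1) None (fun _ => Var x)).

(** The disjunct on variable 0 makes the sentence true for empty S; for nonempty S it can be refuted
    by an element of S. *)
Definition dom_psi : fo (vocab_ext digraph 1) :=
  FAll 0 (FAll 1 (FEx 2 (FOr (FNot (dom_S 0)) (FAnd (dom_S 2)
    (FAtom (@Rel (vocab_ext digraph 1) (Some tt)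
      (fun i : 'I_2 => Var (if i == ord0 then 1 else 2)))))))).

Lemma fo_fv_dom_psi : fo_fv dom_psi = fset0.
Proof.
apply/fsetP => x; rewrite /= !big_ord_recl !big_ord0 /= !inE !orbF.
by case: x => [|[|[|x]]].
Qed.

Lemma Pi2_dom_psi : Pi_class 2 dom_psi.
Proof.
apply: (@prenex_ext _ true 1); apply: (@prenex_new _ true 1).
apply: (@prenex_new _ false 0); exact: prenex_qf.
Qed.

Lemma tuple1_eta (T : Type) (v : 1.-tuple T) : v = [tuple thead v].
Proof. by case/tupleP: v => z v; rewrite [v]tuple0 theadE; exact: val_inj. Qed.

Lemma fo_sat_dom_psi n (A : structure digraph n) (S : {set 1.-tuple 'I_n.+1}) e :
  fo_sat (expand A S) e dom_psi <->
  S = set0 \/ forall y, exists2 z : 'I_n.+1, [tuple z] \in S & edge A y z.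
Proof.
have hS (e' : nat -> 'I_n.+1) x :
    [tuple e' x | i < 1] = [tuple e' x].
  by apply: eq_from_tnth => i; rewrite tnth_mktuple (tnth_nth ord0) /=; case: i => -[].
have hE (e' : nat -> 'I_n.+1) : @rel_int digraph n A tt [tuple e' (if i == ord0 then 1 else 2) | i < 2]
    = edge A (e' 1) (e' 2).
  by congr (@rel_int digraph n A tt); apply: eq_from_tnth => i; rewrite !tnth_mktuple /=; case: ifP.
rewrite /=; split=> [h|h a b].
  have [->|[v vS]] := set_0Vmem S; [by left | right=> y].
  have [z] := h (thead v) y; rewrite !hS hE /upd /= => -[nv|[zS hz]]; last by exists z.
  by case: nv; rewrite -tuple1_eta.
case: h => [->|/(_ b) [z zS hz]].
  by exists ord0; left; rewrite inE.
by exists z; right; rewrite !hS hE.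
Qed.

Lemma pWD_dom_psi x k : pWD dom_psi x k <-> pWT dom_phi x k.
Proof.
rewrite pWT_hitting; split=> -[n [A [hx [S [hk hS]]]]]; exists n, A; split=> //.
  pose S' := [set z : 'I_n.+1 | [tuple z] \in S].
  have eS : S = [set [tuple z] | z in S'].
    apply/setP => v; apply/idP/imsetP => [vS|[z]]; last by rewrite inE => ? ->.
    by exists (thead v); rewrite ?inE -?tuple1_eta.
  exists S'; split.
    by rewrite -hk eS card_imset // => a b /(congr1 (@thead 0 _)); rewrite !theadE.
  case/fo_sat_dom_psi: hS => [S0|hS]; [left | right=> y].
    by apply/setP => z; rewrite !inE S0 inE.
  by have [z zS hz] := hS y; exists z => //; rewrite inE.
exists [set [tuple z] | z in S]; split.
  by rewrite -hk card_imset // => a b /(congr1 (@thead 0 _)); rewrite !theadE.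
apply/fo_sat_dom_psi; case: hS => [->|hS]; first by left; rewrite imset0.
by right=> y; have [z zS hz] := hS y; exists z => //; apply: imset_f.
Qed.

(** Its single tape serves for input and output and it starts in a halting state, so it computes the
    identity in zero steps. *)
Definition halt_TM : TM :=
  @MkTM 0 unit tt xpredT (fun _ _ => (tt, fun _ => (None, Stay))).

Lemma fpt_reducible_iff (P Q : pproblem) : (forall x k, P x k <-> Q x k) -> fpt_reducible P Q.
Proof.
move=> h; exists (fun x _ => x), (fun _ k => k), halt_TM, (fun _ => 0), id, 0; split=> //.
- exact: recursive_const.
- by apply: rec_eq (rec_proj (@ord0 0)) _ => v.
move=> x k; rewrite mul0n; split=> //=; rewrite /output /= .
by elim: (instance x k) => //= b s ->.
Qed.

Lemma W2_pWT : W 2 (pWT dom_phi).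
Proof.
exists digraph, 1, dom_psi; split; [exact: fo_fv_dom_psi | exact: Pi2_dom_psi |].
by apply: fpt_reducible_iff => x k; rewrite pWD_dom_psi.
Qed.

(** * Hardness for W[2] *)

Lemma prenex_Sigma1 V (psi : fo V) : prenex false 1 psi ->
  exists ys chi, fo_qf chi /\ psi = foldr (@FEx V) chi ys.
Proof.
move: {-2}false (erefl false) {-2}1 (erefl 1) => u hu t ht h.
elim: h hu ht => {u t psi} [u psi hq|u t x psi h _|u t x psi h IH] //.
  move=> hu [ht]; rewrite ht in h; inversion h; subst; exists [:: x], psi; by split.
move=> hu ht; have [ys [chi [hq ->]]] := IH hu ht; rewrite hu.
by exists (x :: ys), chi.
Qed.

Lemma prenex_Pi2 V (psi : fo V) : prenex true 2 psi ->
  exists xs ys chi, fo_qf chi /\ psi = foldr (@FAll V) (foldr (@FEx V) chi ys) xs.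
Proof.
move: {-2}true (erefl true) {-2}2 (erefl 2) => u hu t ht h.
elim: h hu ht => {u t psi} [u psi hq|u t x psi h _|u t x psi h IH] //.
  move=> hu [ht]; rewrite ht hu in h; have [ys [chi [hq ->]]] := prenex_Sigma1 h.
  by rewrite hu; exists [:: x], ys, chi.
move=> hu ht; have [xs [ys [chi [hq ->]]]] := IH hu ht; rewrite hu.
by exists (x :: xs), ys, chi.
Qed.

Lemma fo_sat_FAlls V n (A : structure V n) e xs p :
  fo_sat A e (foldr (@FAll V) p xs) <->
  forall vs : seq 'I_n.+1, size vs = size xs -> fo_sat A (upds e xs vs) p.
Proof.
elim: xs e => [|x xs IH] e /=; first by split=> [h [|v vs]|h] //; exact: (h [::]).
split=> [h [|v vs] //= [sz]|h a]; first by have /IH := h v; apply.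
by apply/IH => vs sz; apply: (h (a :: vs)); rewrite /= sz.
Qed.

Lemma fo_sat_FExs V n (A : structure V n) e ys p :
  fo_sat A e (foldr (@FEx V) p ys) <->
  exists us : seq 'I_n.+1, size us = size ys /\ fo_sat A (upds e ys us) p.
Proof.
elim: ys e => [|y ys IH] e /=; first by split=> [h|[[|u us] [] //]]; exists [::].
split=> [[a /IH [us [sz h]]]|[[|u us] [] //= [sz] h]].
  by exists (a :: us); rewrite /= sz.
by exists u; apply/IH; exists us.
Qed.

Section Reduction.
Variables (V : vocab) (r : nat) (chi : fo (vocab_ext V r)) (xs ys : seq nat).
Hypothesis hq : fo_qf chi.

Notation D := (slot_count chi).
Notation m := (digit_count chi xs).
Notation Hit := (EHit chi xs ys).
Let psi := foldr (@FAll _) (foldr (@FEx _) chi ys) xs.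

Definition base (x : seq bool) (k : nat) : nat := (size (instance x k) + D.+2) ^ r.+1.
Definition univ (x : seq bool) (k : nat) : nat := (base x k ^ m).-1.

Definition target (x : seq bool) (k : nat) : structure digraph (univ x k) :=
  @Structure digraph (univ x k)
    (fun R v => let w := instance x k in
       holds w (upd (upd (upd (fun _ => 0) 0 (size w)) 1 (nth ord0 v 0)) 2 (nth ord0 v 1)) Hit)
    (fun F => match F with end).

Lemma univE x k : (univ x k).+1 = base x k ^ m.
Proof. by rewrite /univ prednK // expn_gt0 expn_gt0 addnS. Qed.

(** Writes the new parameter and the universe size in unary, each ended by a zero, and then the
    adjacency matrix with clauses as rows and elements as columns. *)
Definition prog : oprog :=
  OSeq (OFor 3 (EPow (Add EK (Const 2)) D) (Out (Const 1)))
  (OSeq (Out (Const 0))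
  (OSeq (OFor 3 (EPow (EBase chi) m) (Out (Const 1)))
  (OSeq (Out (Const 0))
    (OFor 1 (EPow (EBase chi) m) (OFor 2 (EPow (EBase chi) m) (Out Hit)))))).

Lemma out_ones w rho z a : out w rho (OFor z a (Out (Const 1))) = nseq (eval w rho a) true.
Proof.
rewrite -[in RHS](size_iota 0 (eval w rho a)) -[LHS]/(flatten [seq [:: true] | _ <- iota 0 (eval w rho a)]).
by elim: (iota _ _) => //= v s ->.
Qed.

Lemma encode_digraph n (A : structure digraph n) : encode A =
  nseq n.+1 true ++ false :: flatten [seq [seq edge A a b | b <- enum 'I_n.+1] | a <- enum 'I_n.+1].
Proof.
have e1 : enum (rel_sym digraph) = [:: tt] by rewrite enumT unlock.
have e2 : enum (fun_sym digraph) = [::] by apply: size0nil; rewrite -cardE card_void.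
rewrite /encode e1 e2 /= !cats0; congr (_ :: _ ++ _ :: _).
rewrite map_flatten -map_comp; congr flatten; apply: eq_map => a /=.
elim: (enum 'I_n.+1) => //= b s ->; congr cons; congr (@rel_int digraph n A tt).
apply: eq_from_tnth => i; rewrite tnth_mktuple (tnth_nth ord0) /=.
by case: i => -[|[]].
Qed.

Lemma eval_EBase' rho x k : rho 0 = size (instance x k) ->
  eval (instance x k) rho (EBase chi) = base x k.
Proof. by move=> h; rewrite /EBase -lock eval_pow !evalE h. Qed.

Lemma edge_targetE x k (a b : 'I_(univ x k).+1) : let w := instance x k in
  edge (target x k) a b = holds w (upd (upd (upd (fun _ => 0) 0 (size w)) 1 a) 2 b) Hit.
Proof.
move=> w; rewrite /edge; set v := [tuple _ | i < 2].
rewrite -[LHS]/(holds w (upd (upd (upd (fun _ => 0) 0 (size w)) 1 (nth ord0 v 0)) 2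
  (nth ord0 v 1)) Hit).
have e0 : nth ord0 v 0 = a by rewrite -(tnth_nth ord0 v ord0) tnth_mktuple.
have e1 : nth ord0 v 1 = b by rewrite -(tnth_nth ord0 v ord_max) tnth_mktuple.
by rewrite e0 e1.
Qed.

Lemma prog_ok : produces prog (fun x k => encode (target x k)) D.
Proof.
move=> x k w; set rho := upd _ 0 (size w); have h0 : rho 0 = size w by [].
rewrite /prog; set O1 := OFor 3 _ _; set O2 := OFor 3 _ _; set O3 := OFor 1 _ _.
rewrite -[LHS]/(out w rho O1 ++ false :: (out w rho O2 ++ false :: out w rho O3)).
rewrite /O1 /O2 !out_ones !eval_pow eval_add eval_EK // eval_EBase' // -univE.
rewrite /instance encode_digraph; congr (_ ++ _ :: (_ ++ _ :: _)).
rewrite /O3 -[LHS]/(flatten [seq out w (upd rho 1 y) (OFor 2 (EPow (EBase chi) m) (Out Hit))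
   | y <- iota 0 (eval w rho (EPow (EBase chi) m))]).
rewrite eval_pow eval_EBase' // -univE -val_enum_ord -map_comp; congr flatten.
apply: eq_map => a.
rewrite -[LHS]/(flatten [seq [:: holds w (upd (upd rho 1 a) 2 z) Hit]
   | z <- iota 0 (eval w (upd rho 1 a) (EPow (EBase chi) m))]).
rewrite eval_pow eval_EBase' // -univE -val_enum_ord flatten_map1 -map_comp.
by apply: eq_map => b; rewrite edge_targetE.
Qed.

Lemma core_bounds n (A : structure V n) k : let B := base (encode A) k in
  [/\ k.+1 < B, (n.+1 ^ r).+1 < B, n < B & D.+1 < B].
Proof.
move=> B; have [_ hs _] := encode_well_formed A.
have hn : n.+2 <= size (encode A) by rewrite hs /wsize /fbase; lia.
pose c := size (instance (encode A) k) + D.+2.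
have hc : k + n + D + 5 <= c by rewrite /c size_instance; lia.
have eB : B = c * c ^ r by rewrite /B /base -/c expnS.
have h1 : n.+1 ^ r <= c ^ r by case: (r) => // r'; rewrite leq_exp2r //; lia.
have h2 : 0 < n.+1 ^ r by rewrite expn_gt0.
rewrite eB; move: (n.+1 ^ r) (c ^ r) h1 h2 => Q P h1 h2; split; nia.
Qed.

Lemma map_inord_val n (vs : seq 'I_n.+1) : map inord (map val vs) = vs.
Proof. by rewrite -map_comp -[RHS]map_id; apply: eq_map => v /=; rewrite inord_val. Qed.

Lemma tuple_le_val n (vs : seq 'I_n.+1) : tuple_le n (size vs) (map val vs).
Proof.
rewrite /tuple_le size_map eqxx all_map; apply/allP => v _ /=.
by rewrite -ltnS.
Qed.

Lemma edge_target n (A : structure V n) k (y e : 'I_(univ (encode A) k).+1) :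
  edge (target (encode A) k) y e <->
  hits k (n.+1 ^ r) n D (base (encode A) k) (size xs) (size ys) (matrix_at chi xs ys A) y e.
Proof.
have hy : y < base (encode A) k ^ m by rewrite -univE.
have he : e < base (encode A) k ^ m by rewrite -univE.
by rewrite edge_targetE; exact: (holds_EHit ys hq hy he).
Qed.

Lemma reduction_ok x k : pWD psi x k <-> pWT dom_phi (encode (target x k)) ((k + 2) ^ D).
Proof.
rewrite pWT_hitting addn2; split.
  case=> n [A [-> [S [hk hsat]]]]; have [s hs] := lists_of_set hk.
  have [b1 b2 b3 b4] := core_bounds A k.
  have [|T cT hT] := @hitting_set_of_listing k (n.+1 ^ r) n D (base (encode A) k) m
     (univ (encode A) k) (size xs) (size ys) (matrix_at chi xs ys A)
     isT (univE _ _) b1 b2 b3 b4 ltac:(rewrite /digit_count; lia) ltac:(rewrite /digit_count; lia)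
     ltac:(rewrite /digit_count; lia) s (proj1 hs).
    move=> vs /andP[/eqP sz hvs]; move/fo_sat_FAlls: hsat => /(_ (map inord vs)).
    rewrite size_map sz => /(_ erefl) /fo_sat_FExs [us [szu hu]].
    exists (map val us); first by rewrite -szu; exact: tuple_le_val.
    have := @matrix_complete V r (pair_count chi) n A k chi _ s S hq (leqnSn _) hs hu.
    case=> h h1 h2; exists h => // Z hZ.
    by rewrite /matrix_at /fenv map_inord_val; exact: h2.
  exists (univ (encode A) k), (target (encode A) k); split=> //.
  exists T; split=> //; right=> y; have [e eT he] := hT y.
  by exists e => //; apply/edge_target.
case=> n' [A' [eA [S [cS hS]]]].
have en : univ x k = n' by have := congr1 lead eA; rewrite !lead_encode => -[].
(* The empty set is excluded because its size would be (k+2)^D, which is positive. *)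
have {}hS y : exists2 z, z \in S & edge A' y z.
  case: hS => // S0; move: cS; rewrite S0 cards0 => /esym/eqP.
  by rewrite expn_eq0.
move: en => en; subst n'.
have eE a b : edge A' a b = edge (target x k) a b.
  by rewrite /edge -!nth_encode_rel eA.
(* The target has an edge, so the input must be the encoding of a structure. *)
have [z _] := hS ord0; rewrite eE => /holds_EHit_valid [//|n [A hx]]; subst x.
have [b1 b2 b3 b4] := core_bounds A k.
have hits_S (y : 'I_(univ (encode A) k).+1) : exists2 e : 'I_(univ (encode A) k).+1, e \in S & hits k (n.+1 ^ r) n D (base (encode A) k) (size xs) (size ys)
    (matrix_at chi xs ys A) y e.
  by have [e eS he] := hS y; exists e => //; apply/edge_target; rewrite -eE.
have [s hs hM] := @listing_of_hitting_set k (n.+1 ^ r) n D (base (encode A) k) m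
     (univ (encode A) k) (size xs) (size ys) (matrix_at chi xs ys A)
     isT (univE _ _) b1 b2 b3 b4 ltac:(rewrite /digit_count; lia) ltac:(rewrite /digit_count; lia)
     ltac:(rewrite /digit_count; lia) S cS hits_S.
have [S0 cS0 hl] := set_of_listing hs; exists n, A; split=> //; exists S0; split=> //.
apply/fo_sat_FAlls => vs sz; have htl := tuple_le_val vs; rewrite sz in htl.
have [Z hZ [us /andP[/eqP szu hus] [hdec hsat]]] := hM _ htl.
apply/fo_sat_FExs; exists (map inord us); rewrite size_map; split=> //.
rewrite /fenv map_inord_val in hdec hsat.
exact: (proj1 (fo_sat_SZ hq hl hZ hdec)).
Qed.

End Reduction.

Lemma W2_hard Q : W 2 Q -> fpt_reducible Q (pWT dom_phi).
Proof.
case=> V [r [psi [_ /prenex_Pi2 [xs [ys [chi [hq ->]]]] hred]]].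
apply: fpt_trans_oprog hred (prog_ok chi xs ys) _ => x k.
exact: reduction_ok.
Qed.

Theorem theorem13 :
  exists (V : vocab) (y z : nat) (theta : teamfo V),
    team_qf theta /\ W_complete 2 (pWT (TAll y (TEx z theta))).
Proof.
exists digraph, 1, 2, dom_theta; split=> //; split; first exact: W2_pWT.
exact: W2_hard.
Qed.
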